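(* Let $(G,K,M)$ be one of the triples $(O_o(n,n),\,SO_n\times SO_n,\,SO_n)$ with $n>2$, $(SU(n,n),\,S(U_n\times U_n),\,U_n)$ with $n\ge1$, or $(Sp(n,n),\,Sp_n\times Sp_n,\,Sp_n)$ with $n\ge1$, and endow $G$ with the kinetic energy metric associated with the Möbius action of $G$ on $M$. a) The action of $K\times K$ on $G$ given by $(k_1,k_2)(g)=k_1gk_2^{-1}$ is by isometries of the kinetic energy metric of $G$. b) The Riemannian metric on $K$ induced by the kinetic energy metric of $G$ is bi-invariant; moreover, it is the restriction to $K$ of a product metric on $M\times M$ such that the map $\rho:K\to K$ given by $\rho(g,h)=(h,g)$ is an isometry.
   Context: Let $\mathbb{F}=\mathbb{R},\mathbb{C}$ or $\mathbb{H}$ (quaternions; $\mathbb{H}^N$ is a right $\mathbb{H}$-vector space of column vectors, on which matrices act by left multiplication). $U(n,n,\mathbb{F})$ is the group of invertible $2n\times 2n$ matrices over $\mathbb{F}$ preserving $b((x,y),(\xi,\eta))=\overline{x}^T\xi-\overline{y}^T\eta$ ($x,\xi,y,\eta\in\mathbb{F}^n$). $O_o(n,n)$ is the identity component of $U(n,n,\mathbb{R})$, $SU(n,n)$ is the subgroup of $U(n,n,\mathbb{C})$ of matrices of determinant $1$, and $Sp(n,n)=U(n,n,\mathbb{H})$. $SO_n$, $U_n$, $Sp_n$ are the compact special orthogonal, unitary, and symplectic (quaternionic unitary $n\times n$ matrices) groups. $K$ is the maximal compact subgroup of $G$ consisting of the block diagonal matrices $\operatorname{diag}(g,h)$ with $g,h\in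 M$ (with $\det g\det h=1$ for $G=SU(n,n)$); $\operatorname{diag}(g,h)$ is identified with $(g,h)\in M\times M$. The Möbius action of $G$ on $M$ is $\begin{pmatrix}A&B\\C&D\end{pmatrix}\ast U=(AU+B)(CU+D)^{-1}$, with $n\times n$ blocks. $M$ carries the Riemannian metric induced by its inclusion in $\mathbb{F}^{n\times n}$ with the real inner product $\langle X,Y\rangle=\operatorname{Re}(\operatorname{tr}(\overline{X}^TY))$; let $\mu$ be its volume measure. For $g\in G$ and $X\in T_gG$, put $\widetilde X(q)=\left.\frac{d}{dt}\right|_0\gamma(t)\ast q\in T_{g\ast q}M$ where $\gamma$ is any smooth curve in $G$ with $\gamma(0)=g$, $\gamma'(0)=X$. The kinetic energy metric on $G$ is the Riemannian metric $\langle X,Y\rangle=\int_M\langle\widetilde X(q),\widetilde Y(q)\rangle\,d\mu(q)$, $X,Y\in T_gG$. *)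

(* Defs.v *)
From HB Require Import structures.
From mathcomp Require Import all_boot all_order all_algebra.
From mathcomp Require Import all_classical all_reals all_analysis.
From mathcomp Require Import complex ring.

Set Implicit Arguments.
Unset Strict Implicit.
Unset Printing Implicit Defensive.

Import Order.TTheory GRing.Theory Num.Theory.
Import numFieldNormedType.Exports.

Local Open Scope classical_set_scope.
Local Open Scope ring_scope.

Record quaternion (R : Type) : Type :=
  Quaternion { quat1 : R; quati : R; quatj : R; quatk : R }.

Section QuaternionRing.
Variable R : realType.
Local Notation H := (quaternion R).

Definition quat_to_prod (x : H) : R * R * R * R :=
  (quat1 x, quati x, quatj x, quatk x).
Definition quat_of_prod (p : R * R * R * R) : H :=
  Quaternion p.1.1.1 p.1.1.2 p.1.2 p.2.
Lemma quat_to_prodK : cancel quat_to_prod quat_of_prod.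
Proof. by case. Qed.

HB.instance Definition _ := Equality.copy H (can_type quat_to_prodK).
HB.instance Definition _ := Choice.copy H (can_type quat_to_prodK).

Definition quat_zero : H := Quaternion 0 0 0 0.
Definition quat_one : H := Quaternion 1 0 0 0.
Definition quat_opp (x : H) : H :=
  Quaternion (- quat1 x) (- quati x) (- quatj x) (- quatk x).
Definition quat_add (x y : H) : H :=
  Quaternion (quat1 x + quat1 y) (quati x + quati y)
             (quatj x + quatj y) (quatk x + quatk y).
Definition quat_mul (x y : H) : H :=
  let: Quaternion a b c d := x in
  let: Quaternion a' b' c' d' := y in
  Quaternion (a * a' - b * b' - c * c' - d * d')
             (a * b' + b * a' + c * d' - d * c')
             (a * c' - b * d' + c * a' + d * b')
             (a * d' + b * c' - c * b' + d * a').
Definition quat_conj (x : H) : H :=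
  Quaternion (quat1 x) (- quati x) (- quatj x) (- quatk x).

Let addA : associative quat_add.
Proof. by case=> ? ? ? ? [? ? ? ?] [? ? ? ?]; congr Quaternion; rewrite /= addrA. Qed.
Let addC : commutative quat_add.
Proof. by case=> ? ? ? ? [? ? ? ?]; congr Quaternion; rewrite /= addrC. Qed.
Let add0 : left_id quat_zero quat_add.
Proof. by case=> ? ? ? ?; congr Quaternion; rewrite /= add0r. Qed.
Let addN : left_inverse quat_zero quat_opp quat_add.
Proof. by case=> ? ? ? ?; congr Quaternion; rewrite /= addNr. Qed.

HB.instance Definition _ := GRing.isZmodule.Build H addA addC add0 addN.

Let mulA : associative quat_mul.
Proof. by case=> ? ? ? ? [? ? ? ?] [? ? ? ?]; congr Quaternion; ring. Qed.
Let mul1 : left_id quat_one quat_mul.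
Proof. by case=> ? ? ? ?; congr Quaternion; ring. Qed.
Let mulr1 : right_id quat_one quat_mul.
Proof. by case=> ? ? ? ?; congr Quaternion; ring. Qed.
Let mulDl : left_distributive quat_mul quat_add.
Proof. by case=> ? ? ? ? [? ? ? ?] [? ? ? ?]; congr Quaternion; rewrite /=; ring. Qed.
Let mulDr : right_distributive quat_mul quat_add.
Proof. by case=> ? ? ? ? [? ? ? ?] [? ? ? ?]; congr Quaternion; rewrite /=; ring. Qed.
Let one_neq0 : quat_one != quat_zero.
Proof. by apply/eqP => -[] /eqP; rewrite oner_eq0. Qed.

HB.instance Definition _ :=
  GRing.Zmodule_isNzRing.Build H mulA mul1 mulr1 mulDl mulDr one_neq0.

End QuaternionRing.

(* R, C or H with its conjugation, real part and coordinates in the standard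
   real basis.  Only the three instances below are used, so the fields carry no
   axioms. *)
Record scalars (R : realType) := Scalars {
  scalar_ring :> nzRingType;
  scalar_dim : nat;
  scalar_conj : scalar_ring -> scalar_ring;
  scalar_re : scalar_ring -> R;
  scalar_coord : scalar_ring -> 'rV[R]_scalar_dim;
  scalar_of_coord : 'rV[R]_scalar_dim -> scalar_ring }.

Definition real_scalars (R : realType) : scalars R :=
  @Scalars R R 1 id id (fun x => \row__ x) (fun v => v 0 0).

Definition complex_scalars (R : realType) : scalars R :=
  @Scalars R (R[i] : nzRingType) 2 (@conjc R) (@complex.Re R)
    (fun x => \row_k [:: complex.Re x; complex.Im x]`_k)
    (fun v => Complex (v 0 (inord 0)) (v 0 (inord 1))).

Definition quaternion_scalars (R : realType) : scalars R :=
  @Scalars R (quaternion R : nzRingType) 4 (@quat_conj R) (@quat1 R)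
    (fun x => \row_k [:: quat1 x; quati x; quatj x; quatk x]`_k)
    (fun v => Quaternion (v 0 (inord 0)) (v 0 (inord 1))
                         (v 0 (inord 2)) (v 0 (inord 3))).

Section Smooth.
Context {R : realType}.

(* C^k on an open set [U] of a finite-dimensional space, by iterated directional
   derivatives. *)
Fixpoint Ck_on (V W : normedModType R) (k : nat) (U : set V) (f : V -> W) :
    Prop :=
  (forall x, U x -> {for x, continuous f}) /\
  match k with
  | 0 => True
  | k'.+1 => forall v : V,
      (forall x, U x -> derivable f x v) /\ Ck_on k' U (fun x => 'D_v f x)
  end.

Definition smooth_on (V W : normedModType R) (U : set V) (f : V -> W) : Prop :=
  open U /\ forall k, Ck_on k U f.

Variable E : normedModType R.
Implicit Types (S : set E) (p X Y Z : E).

Definition smooth_curve S (gamma : R^o -> E) : Prop :=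
  exists U : set R^o,
    [/\ U 0, smooth_on U gamma & forall t, U t -> S (gamma t)].

Definition velocity0 (gamma : R^o -> E) : E := 'D_(1 : R^o) gamma (0 : R^o).

Definition tangent S p : set E :=
  [set X | exists gamma : R^o -> E,
     [/\ smooth_curve S gamma, gamma 0 = p & velocity0 gamma = X]].

Definition smooth_map S (f : E -> E) : Prop :=
  forall p, S p -> exists U : set E, exists f' : E -> E,
    [/\ U p, smooth_on U f' & forall x, S x -> U x -> f' x = f x].

Definition diffeomorphism S (f : E -> E) : Prop :=
  exists g : E -> E,
    [/\ forall x, S x -> S (f x), forall x, S x -> S (g x),
        (forall x, S x -> g (f x) = x) /\ (forall x, S x -> f (g x) = x),
        smooth_map S f & smooth_map S g].

(* The inverse of a chart of the embedded submanifold [S]; the last condition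
   says that [phi] is a homeomorphism from [U] onto a relatively open set. *)
Definition parametrization S (d : nat) (U : set 'rV[R]_d)
    (phi : 'rV[R]_d -> E) : Prop :=
  [/\ smooth_on U phi,
      forall x, U x -> S (phi x),
      forall x y, U x -> U y -> phi x = phi y -> x = y,
      forall x v, U x -> 'D_v phi x = 0 -> v = 0 &
      forall V : set 'rV[R]_d, open V -> V `<=` U ->
        exists W : set E, open W /\ phi @` V = S `&` W].

(* [m p X Y] is only meaningful for [p] in the submanifold and [X], [Y]
   tangent to it at [p]. *)
Definition metric_tensor := E -> E -> E -> R.

Definition riemannian_metric S (m : metric_tensor) : Prop :=
  [/\ forall p X Y, S p -> tangent S p X -> tangent S p Y ->
        m p X Y = m p Y X,
      forall p X Y Z (a : R), S p ->
        tangent S p X -> tangent S p Y -> tangent S p Z ->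
        m p (a *: X + Y) Z = a * m p X Z + m p Y Z,
      forall p X, S p -> tangent S p X -> X != 0 -> 0 < m p X X &
      forall d (U : set 'rV[R]_d) phi, parametrization S U phi ->
        forall v w : 'rV[R]_d,
        smooth_on U (fun x => m (phi x) ('D_v phi x) ('D_w phi x) : R^o)].

(* The differential of [f] maps [velocity0 gamma] to
   [velocity0 (f \o gamma)]. *)
Definition riemannian_isometry S (m : metric_tensor) (f : E -> E) : Prop :=
  diffeomorphism S f /\
  forall gamma1 gamma2 : R^o -> E,
    smooth_curve S gamma1 -> smooth_curve S gamma2 -> gamma1 0 = gamma2 0 ->
    m (f (gamma1 0)) (velocity0 (f \o gamma1)) (velocity0 (f \o gamma2)) =
    m (gamma1 0) (velocity0 gamma1) (velocity0 gamma2).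

Definition borel : Type := g_sigma_algebraType (@open E).

End Smooth.

Section Volume.
Context {R : realType}.

(* Integral of a nonnegative Borel function on R^d, as an iterated integral
   (Tonelli); the library has no Lebesgue measure on R^d. *)
Fixpoint lebesgue_rV (d : nat) : ('rV[R]_d -> \bar R) -> \bar R :=
  match d with
  | 0 => fun f => f 0
  | d'.+1 => fun f =>
      (\int[@lebesgue_measure R]_x
         lebesgue_rV (fun v : 'rV[R]_d' =>
           f (row_mx (x%:M : 'rV[R]_1) v : 'rV[R]_(d'.+1))))%E
  end.

Definition gram (E : normedModType R) (m : metric_tensor E) d
    (phi : 'rV[R]_d -> E) (x : 'rV[R]_d) : 'M[R]_d :=
  \matrix_(i, j) m (phi x) ('D_('e_i) phi x) ('D_('e_j) phi x).

(* The volume measure of [(S, m)], as a Borel measure on the ambient space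
   whose values off [S] are irrelevant. *)
Definition riemannian_volume (E : normedModType R) (S : set E)
    (m : metric_tensor E) (mu : {measure set (borel E) -> \bar R}) : Prop :=
  forall d (U : set 'rV[R]_d) phi, parametrization S U phi ->
  forall B : set (borel E), measurable B -> B `<=` phi @` U ->
    mu B = lebesgue_rV
      ((fun x => (Num.sqrt (\det (gram m phi x)))%:E) \_ (U `&` phi @^-1` B)).

End Volume.

Section MatrixCoordinates.
Context {R : realType} (F : scalars R).

(* Matrices over F have no normed R-module structure in the library:
   topology and differential calculus take place in real coordinates. *)
Definition mxcoord (m p : nat) (A : 'M[F]_(m, p)) :
    'M[R]_(m * p, scalar_dim F) :=
  \matrix_(k, l) scalar_coord (mxvec A 0 k) 0 l.

Definition mx_of_coord (m p : nat) (V : 'M[R]_(m * p, scalar_dim F)) :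
    'M[F]_(m, p) :=
  vec_mx (\row_k scalar_of_coord (row k V)).

Definition conj_tr (m p : nat) (A : 'M[F]_(m, p)) : 'M[F]_(p, m) :=
  (map_mx (@scalar_conj R F) A)^T.

Definition is_inverse (n : nat) (A B : 'M[F]_n) : Prop :=
  A *m B = 1%:M /\ B *m A = 1%:M.

(* [invmx] requires commutative coefficients. *)
Definition inverse_mx (n : nat) (A : 'M[F]_n) : 'M[F]_n :=
  xget 0 [set B | is_inverse A B].

Definition unitary_set (n : nat) : set 'M[F]_n :=
  [set A | is_inverse A (conj_tr A)].

Definition form_b (n : nat) (u v : 'cV[F]_(n + n)) : F :=
  (conj_tr (usubmx u) *m usubmx v - conj_tr (dsubmx u) *m dsubmx v) 0 0.

Definition indefinite_unitary_set (n : nat) : set 'M[F]_(n + n) :=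
  [set A | (exists B, is_inverse A B) /\
           forall u v, form_b (A *m u) (A *m v) = form_b u v].

Definition mobius (n : nat) (g : 'M[F]_(n + n)) (q : 'M[F]_n) : 'M[F]_n :=
  (ulsubmx g *m q + ursubmx g) *m inverse_mx (dlsubmx g *m q + drsubmx g).

Definition trace_metric (n : nat) : metric_tensor 'M[R]_(n * n, scalar_dim F) :=
  fun _ X Y => scalar_re (\tr (conj_tr (mx_of_coord X) *m mx_of_coord Y)).

(* Every curve [gamma] gives the same vector. *)
Definition mobius_field (n : nat) (G : set 'M[R]_((n + n) * (n + n), scalar_dim F))
    (g X : 'M[R]_((n + n) * (n + n), scalar_dim F))
    (q : 'M[R]_(n * n, scalar_dim F)) : 'M[R]_(n * n, scalar_dim F) :=
  xget 0 [set v | exists gamma : R^o -> 'M[R]_((n + n) * (n + n), scalar_dim F),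
    [/\ smooth_curve G gamma, gamma 0 = g, velocity0 gamma = X &
        v = velocity0 (fun t =>
              mxcoord (mobius (mx_of_coord (gamma t)) (mx_of_coord q)))]].

Definition kinetic_metric (n : nat)
    (G : set 'M[R]_((n + n) * (n + n), scalar_dim F))
    (M : set 'M[R]_(n * n, scalar_dim F))
    (mu : {measure set (borel 'M[R]_(n * n, scalar_dim F)) -> \bar R}) :
    metric_tensor 'M[R]_((n + n) * (n + n), scalar_dim F) :=
  fun g X Y =>
    \int[mu]_(q in (M : set (borel _)))
      trace_metric (q : 'M[R]_(n * n, scalar_dim F))
        (mobius_field G g X q) (mobius_field G g Y q).

Definition translation (m : nat) (k1 k2 : 'M[F]_m)
    (g : 'M[R]_(m * m, scalar_dim F)) : 'M[R]_(m * m, scalar_dim F) :=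
  mxcoord (k1 *m mx_of_coord g *m k2).

Definition block_swap (n : nat) (k : 'M[R]_((n + n) * (n + n), scalar_dim F)) :
    'M[R]_((n + n) * (n + n), scalar_dim F) :=
  let A := mx_of_coord k in
  mxcoord (block_mx (drsubmx A) 0 0 (ulsubmx A)).

(* Identifies [diag(g, h)] with [(g, h)], and likewise tangent vectors. *)
Definition diag_blocks (n : nat) (k : 'M[R]_((n + n) * (n + n), scalar_dim F)) :
    'M[R]_(n * n, scalar_dim F) * 'M[R]_(n * n, scalar_dim F) :=
  let A := mx_of_coord k in (mxcoord (ulsubmx A), mxcoord (drsubmx A)).

End MatrixCoordinates.

Definition product_metric (R : realType) (E1 E2 : normedModType R)
    (m1 : metric_tensor E1) (m2 : metric_tensor E2) :
    metric_tensor (E1 * E2)%type :=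
  fun p X Y => m1 p.1 X.1 Y.1 + m2 p.2 X.2 Y.2.

(* (O_o(n,n), SO_n x SO_n, SO_n), (SU(n,n), S(U_n x U_n), U_n) and
   (Sp(n,n), Sp_n x Sp_n, Sp_n). *)
Variant triple := Orthogonal | Unitary | Symplectic.

Definition admissible (f : triple) (n : nat) : bool :=
  match f with Orthogonal => (2 < n)%N | _ => (1 <= n)%N end.

Section Triples.
Variable R : realType.

Definition scalars_of (f : triple) : scalars R :=
  match f with
  | Orthogonal => real_scalars R
  | Unitary => complex_scalars R
  | Symplectic => quaternion_scalars R
  end.

Definition M_set (f : triple) (n : nat) : set 'M[scalars_of f]_n :=
  match f return set 'M[scalars_of f]_n with
  | Orthogonal => [set A : 'M[R]_n |
      unitary_set (F := real_scalars R) A /\ \det A = 1]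
  | Unitary => @unitary_set R (complex_scalars R) n
  | Symplectic => @unitary_set R (quaternion_scalars R) n
  end.

Definition G_set (f : triple) (n : nat) : set 'M[scalars_of f]_(n + n) :=
  match f return set 'M[scalars_of f]_(n + n) with
  | Orthogonal => [set A |
      connected_component
        [set mxcoord B | B in @indefinite_unitary_set R (real_scalars R) n]
        (mxcoord (1%:M : 'M[real_scalars R]_(n + n))) (mxcoord A)]
  | Unitary => [set A : 'M[R[i]]_(n + n) |
      indefinite_unitary_set (F := complex_scalars R) A /\ \det A = 1]
  | Symplectic => @indefinite_unitary_set R (quaternion_scalars R) n
  end.

(* For SU(n,n), K is S(U_n x U_n); no condition otherwise. *)
Definition K_condition (f : triple) (n : nat) :
    'M[scalars_of f]_n -> 'M[scalars_of f]_n -> Prop :=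
  match f return 'M[scalars_of f]_n -> 'M[scalars_of f]_n -> Prop with
  | Unitary => fun g h : 'M[R[i]]_n => \det g * \det h = 1
  | _ => fun _ _ => True
  end.

Definition K_set (f : triple) (n : nat) : set 'M[scalars_of f]_(n + n) :=
  [set A | exists g h, [/\ M_set g, M_set h, K_condition g h &
                           A = block_mx g 0 0 h]].

Definition M_mfd (f : triple) (n : nat) := [set mxcoord A | A in @M_set f n].
Definition G_mfd (f : triple) (n : nat) := [set mxcoord A | A in @G_set f n].
Definition K_mfd (f : triple) (n : nat) := [set mxcoord A | A in @K_set f n].

End Triples.

Arguments M_mfd R f n : clear implicits.
Arguments G_mfd R f n : clear implicits.
Arguments K_mfd R f n : clear implicits.

(* Main.v *)
From HB Require Import structures.
Require Import Defs.
From mathcomp Require Import all_boot all_order all_algebra.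
From mathcomp Require Import all_classical all_reals all_analysis.
From mathcomp Require Import complex ring lra measurable_realfun perm.

(** At g = (A, B; C, D) a tangent vector X = (X1, X2; X3, X4) of G induces on M
    the field (X1 q + X2) P - (A q + B) P (X3 q + X4) P with P = (C q + D)^-1;
    C q + D is invertible because the columns of (q, 1) span a b-isotropic
    space.  Translating g and X by elements of K only replaces q by a translate
    u q v and multiplies the field by unitary matrices, so a) and the
    bi-invariance on K reduce to the invariance of mu under q |-> u q v.  The
    latter holds because such a map preserves the trace metric, hence carries
    each Cayley chart of M to a parametrization with the same Gram matrix.

    At k = diag(g, h) in K with X = diag(X1, X2), Y = diag(Y1, Y2) the integrand
    is <X1, Y1> + <X2, Y2> minus the cross terms <Z q, q W> with
    (Z, W) = (g^* X1, h^* Y2) and (g^* Y1, h^* X2).  The integral of a cross term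
    is invariant under conjugation of W, which for skew-hermitian W forces it to
    vanish for SO_n (n > 2) and Sp_n, and to be
    vol(M) (Im tr Z) (Im tr W) / n for U_n.  Since det g det h = 1 on K, Im tr
    takes opposite values on g^* X1 and h^* X2, so that the cross terms split
    equally between the two factors. *)

Set Implicit Arguments.
Unset Strict Implicit.
Unset Printing Implicit Defensive.

Import Order.TTheory GRing.Theory Num.Theory.
Import numFieldNormedType.Exports.

Local Open Scope classical_set_scope.
Local Open Scope ring_scope.

(** * Calculus on coordinate spaces *)

(** The three triples are treated together: topology and derivatives live in real coordinates, and
    [scalar_laws] collects what R, C and H have in common. Cayley charts involve one matrix inverse
    and have an explicit inverse map, and the same formula lands in SO_n, U_n and Sp_n.

    [riemannian_volume] prescribes [mu] only on subsets of a single chart image. Finiteness and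
    invariance are therefore obtained chart by chart and glued over a finite cover of the compact
    set M. The iterated integral undergoes no change of variables: the isometry is composed with the
    parametrization, so both volumes integrate the same density over the same domain.

    For O_o(n,n), the inclusion of K in G rests on the connectedness of SO_n, shown by joining
    products of two reflections to the identity. The constant 1/n appears because i times the
    identity is a sum of n diagonal units on which the averaged functional takes equal values. *)

Section LinearFun.
Context {R : pzRingType} {V W : lmodType R}.
Variable L : V -> W.
Hypothesis lL : linear L.

Lemma linearBf a b : L (a - b) = L a - L b.
Proof. by rewrite addrC -scaleN1r lL scaleN1r addrC. Qed.

Lemma linear0f : L 0 = 0.
Proof. by rewrite -(subrr 0) linearBf subrr. Qed.

Lemma linearZf a b : L (a *: b) = a *: L b.
Proof. by rewrite -[a *: b]addr0 lL linear0f addr0. Qed.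

End LinearFun.

Lemma cvg_sumr {K : numFieldType} {V : normedModType K} (I : finType)
    T (F : set_system T) {FF : Filter F} (u : I -> T -> V) (l : I -> V) :
  (forall i, u i @ F --> l i) -> (fun t => \sum_i u i t) @ F --> \sum_i l i.
Proof. by move=> ul; apply: cvg_big => //; exact: add_continuous. Qed.

Section MatrixLinear.
Context {R : realType} {W : normedModType R}.

Lemma linear_mx_sum m n (f : 'M[R]_(m, n) -> W) (x : 'M[R]_(m, n)) : linear f ->
  f x = \sum_i \sum_j x i j *: f (delta_mx i j).
Proof.
move=> lf; pose g := HB.pack_for {linear 'M[R]_(m, n) -> W} f
  (GRing.isLinear.Build R 'M[R]_(m, n) W *:%R f lf).
rewrite -[f]/(g : _ -> _) {1}(matrix_sum_delta x) linear_sum.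
apply: eq_bigr => i _; rewrite linear_sum; apply: eq_bigr => j _.
by rewrite linearZ.
Qed.

Lemma linear_mx_cvg m n (f : 'M[R]_(m, n) -> W) T (F : set_system T)
    {FF : Filter F} (u : T -> 'M[R]_(m, n)) x : linear f ->
  u @ F --> x -> f \o u @ F --> f x.
Proof.
move=> lf ux; rewrite (linear_mx_sum x lf).
rewrite (_ : f \o u = fun t => \sum_i \sum_j u t i j *: f (delta_mx i j)); last first.
  by apply/funext => t /=; exact: linear_mx_sum.
apply: cvg_sumr => i; apply: cvg_sumr => j.
apply: cvgZr_tmp.
exact: (cvg_comp _ _ ux (@coord_continuous _ _ _ i j x)).
Qed.

Lemma linear_mx_continuous m n (f : 'M[R]_(m, n) -> W) : linear f -> continuous f.
Proof. by move=> lf x; apply: (@linear_mx_cvg _ _ f _ (nbhs x) _ id). Qed.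

Lemma bilinear_mx_cvg m n p q (B : 'M[R]_(m, n) -> 'M[R]_(p, q) -> W)
    T (F : set_system T) {FF : Filter F} (u : T -> 'M[R]_(m, n)) v x y :
  (forall y, linear (B^~ y)) -> (forall x, linear (B x)) ->
  u @ F --> x -> v @ F --> y -> (fun t => B (u t) (v t)) @ F --> B x y.
Proof.
move=> lB rB ux vy; rewrite (linear_mx_sum x (lB y)).
rewrite [X in X @ _](_ : _ =
  fun t => \sum_i \sum_j u t i j *: B (delta_mx i j) (v t)); last first.
  by apply/funext => t /=; exact: (linear_mx_sum (u t) (lB (v t))).
apply: cvg_sumr => i; apply: cvg_sumr => j.
apply: cvgZ.
  exact: (cvg_comp _ _ ux (@coord_continuous _ _ _ i j x)).
exact: (linear_mx_cvg (rB _) vy).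
Qed.

End MatrixLinear.

Section DirectionalDerivative.
Context {R : realType} {V : normedModType R}.

Lemma shift_cvg (x v : V) : (fun h : R => h *: v + x) @ 0^' --> x.
Proof.
rewrite -[X in _ --> X](add0r x) -(scale0r v).
apply: cvgD; last exact: cvg_cst.
by apply: cvgZr_tmp; exact: nbhs_dnbhs.
Qed.

Lemma is_derive_cvg (W : normedModType R) (f : V -> W) x v d :
  is_derive x v f d <->
  (fun h : R => h^-1 *: (f (h *: v + x) - f x)) @ 0^' --> d.
Proof.
split=> [[df <-]|fd]; first exact: df.
by apply: DeriveDef; [apply/cvg_ex; exists d|exact: cvg_lim fd].
Qed.

Lemma is_derive_linear (W W' : normedModType R) (L : W -> W') (f : V -> W) x v d :
  linear L -> continuous L -> is_derive x v f d -> is_derive x v (L \o f) (L d).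
Proof.
move=> lL cL /is_derive_cvg fd; apply/is_derive_cvg.
rewrite [X in X @ _](_ : _ = L \o (fun h : R => h^-1 *: (f (h *: v + x) - f x))).
  by apply: continuous_cvg => //; exact: cL.
apply/funext => h /=.
by rewrite (linearZf lL) (linearBf lL).
Qed.

(* [B (f + df) (g + dg) - B f g = B df (g + dg) + B f dg]: only [g] has to be
   continuous at [x]. *)
Lemma is_derive_bilinear m n p q (W : normedModType R)
    (B : 'M[R]_(m, n) -> 'M[R]_(p, q) -> W)
    (f : V -> 'M[R]_(m, n)) (g : V -> 'M[R]_(p, q)) x v df dg :
  (forall y, linear (B^~ y)) -> (forall x, linear (B x)) ->
  {for x, continuous g} ->
  is_derive x v f df -> is_derive x v g dg ->
  is_derive x v (fun y => B (f y) (g y)) (B df (g x) + B (f x) dg).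
Proof.
move=> lB rB cg /is_derive_cvg fd /is_derive_cvg gd; apply/is_derive_cvg.
pose g1 (h : R) := g (h *: v + x).
have gg : g1 @ 0^' --> g x.
  have cg' : g @ x --> g x by exact: cg.
  have sh : (fun h : R => h *: v + x) @ 0^' --> x by exact: shift_cvg.
  rewrite /g1; exact: (cvg_comp _ _ sh cg').
rewrite [X in X @ _](_ : _ = (fun h : R =>
   B (h^-1 *: (f (h *: v + x) - f x)) (g1 h) +
   B (f x) (h^-1 *: (g1 h - g x)))); last first.
  apply/funext => h.
  rewrite (linearZf (lB _)) (linearZf (rB _)) (linearBf (lB _)) (linearBf (rB _)).
  by rewrite -scalerDr addrA subrK.
apply: cvgD; first exact: bilinear_mx_cvg.
by apply: (linear_mx_cvg (rB _) gd).
Qed.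

End DirectionalDerivative.

Section Ck.
Context {R : realType} {V : normedModType R}.
Implicit Types (U : set V).

Lemma Ck_on_continuous (W : normedModType R) k U (f : V -> W) :
  Ck_on k U f -> forall x, U x -> {for x, continuous f}.
Proof. by case: k => [|k] []. Qed.

Lemma Ck_onS (W : normedModType R) k U (f : V -> W) :
  Ck_on k.+1 U f -> Ck_on k U f.
Proof.
elim: k f => [|k IH] f [cf df]; first by [].
by split=> // v; have [dfv /IH] := df v.
Qed.

Lemma Ck_on_derive (W : normedModType R) k U (f : V -> W) v :
  Ck_on k.+1 U f -> Ck_on k U (fun x => 'D_v f x).
Proof. by case=> _ /(_ v)[]. Qed.

Lemma Ck_on_is_derive (W : normedModType R) k U (f : V -> W) v x :
  Ck_on k.+1 U f -> U x -> is_derive x v f ('D_v f x).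
Proof. by case=> _ /(_ v)[df _] Ux; apply: derivableP; exact: df. Qed.

Lemma open_near_eq (W : normedModType R) U (f g : V -> W) : open U ->
  {in U, f =1 g} -> forall x, U x -> \near x, f x = g x.
Proof.
move=> oU fg x Ux; have := open_nbhs_nbhs (conj oU Ux).
by apply: filterS => y Uy; apply: fg; rewrite inE.
Qed.

Lemma Ck_on_ext (W : normedModType R) k U (f g : V -> W) : open U ->
  {in U, f =1 g} -> Ck_on k U f -> Ck_on k U g.
Proof.
move=> oU; elim: k f g => [|k IH] f g fg [cf df].
all: have near x (Ux : U x) := open_near_eq oU fg Ux.
all: have cg x : U x -> {for x, continuous g} by move=> Ux;
  rewrite /prop_for /continuous_at -(fg x) ?inE//;
  apply: cvg_trans (cf x Ux); apply: near_eq_cvg; exact: near.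
- by split.
split=> // v; have [dfv Dfv] := df v; split.
  by move=> x Ux; apply: near_eq_derivable (dfv x Ux); exact: near.
apply: IH Dfv => x /[!inE] Ux.
by apply: near_eq_derive; exact: near.
Qed.

(** Criterion behind the closure properties below: a closed formula [df] for the directional
    derivatives suffices, because [Ck_on] depends only on the values on an open set. *)
Lemma Ck_onW (W : normedModType R) k U (f : V -> W) (df : V -> V -> W) : open U ->
  (forall x, U x -> {for x, continuous f}) ->
  (forall x v, U x -> is_derive x v f (df v x)) ->
  (forall v, Ck_on k U (df v)) -> Ck_on k.+1 U f.
Proof.
move=> oU cf fd Cdf; split=> // v; split.
  by move=> x Ux; have [] := fd x v Ux.
apply: Ck_on_ext (Cdf v) => // x /[!inE] Ux.
by have [_ ->] := fd x v Ux.
Qed.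

Lemma Ck_on_cst (W : normedModType R) k U (c : W) : open U ->
  Ck_on k U (fun _ => c).
Proof.
move=> oU; elim: k c => [|k IH] c; first by split=> // x _; exact: cvg_cst.
apply: (@Ck_onW _ k U _ (fun _ _ => 0)) => //.
by move=> x _; exact: cvg_cst.
Qed.

Lemma Ck_on_linear (W W' : normedModType R) k U (L : W -> W') (f : V -> W) :
  open U -> linear L -> continuous L -> Ck_on k U f -> Ck_on k U (L \o f).
Proof.
move=> oU lL cL; elim: k f => [|k IH] f.
  by move=> [cf _]; split=> // x Ux; apply: continuous_comp; [exact: cf|exact: cL].
move=> Cf; apply: (@Ck_onW _ k U _ (fun v x => L ('D_v f x))) => //.
- move=> x Ux; apply: continuous_comp; [exact: (Ck_on_continuous Cf)|exact: cL].
- by move=> x v Ux; apply: is_derive_linear => //; exact: Ck_on_is_derive Cf Ux.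
- by move=> v; apply: IH; exact: Ck_on_derive.
Qed.

Lemma Ck_on_id k U : open U -> Ck_on k U (@idfun V).
Proof.
move=> oU; case: k => [|k]; first by split=> // x _; exact: cvg_id.
apply: (@Ck_onW _ k U _ (fun v _ => v)) => //.
- by move=> x _; exact: cvg_id.
- by move=> v; exact: Ck_on_cst.
Qed.

Lemma Ck_onD (W : normedModType R) k U (f g : V -> W) : open U ->
  Ck_on k U f -> Ck_on k U g -> Ck_on k U (fun x => f x + g x).
Proof.
move=> oU; elim: k f g => [|k IH] f g Cf Cg.
  by case: Cf Cg => [cf _] [cg _]; split=> // x Ux; apply: cvgD; [exact: cf|exact: cg].
apply: (@Ck_onW _ k U _ (fun v x => 'D_v f x + 'D_v g x)) => //.
- by move=> x Ux; apply: cvgD; apply: (Ck_on_continuous _ Ux); eassumption.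
- by move=> x v Ux; apply: is_deriveD; apply: Ck_on_is_derive Ux; eassumption.
- by move=> v; apply: IH; exact: Ck_on_derive.
Qed.

(** Leibniz rule. The induction on [k] keeps [f] and [g] arbitrary, since each term of the
    derivative pairs one function with a derivative of the other. *)
Lemma Ck_on_bilinear m n p q (W : normedModType R)
    (B : 'M[R]_(m, n) -> 'M[R]_(p, q) -> W) k U
    (f : V -> 'M[R]_(m, n)) (g : V -> 'M[R]_(p, q)) : open U ->
  (forall y, linear (B^~ y)) -> (forall x, linear (B x)) ->
  Ck_on k U f -> Ck_on k U g -> Ck_on k U (fun x => B (f x) (g x)).
Proof.
move=> oU lB rB; elim: k f g => [|k IH] f g Cf Cg.
  case: Cf Cg => [cf _] [cg _]; split=> // x Ux.
  by apply: bilinear_mx_cvg => //; [exact: cf|exact: cg].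
apply: (@Ck_onW _ k U _
  (fun v x => B ('D_v f x) (g x) + B (f x) ('D_v g x))) => //.
- move=> x Ux; apply: bilinear_mx_cvg => //;
    [exact: (Ck_on_continuous Cf)|exact: (Ck_on_continuous Cg)].
- move=> x v Ux; apply: is_derive_bilinear => //.
  + exact: (Ck_on_continuous Cg).
  + exact: Ck_on_is_derive Cf Ux.
  + exact: Ck_on_is_derive Cg Ux.
- move=> v; apply: Ck_onD => //; apply: IH.
  + exact: Ck_on_derive.
  + exact: Ck_onS.
  + exact: Ck_onS.
  + exact: Ck_on_derive.
Qed.

End Ck.

(** * Matrices over R, C and H *)

(** The axioms that the bare fields of [scalars] leave out. [emb] embeds R as central scalars;
    [sreC] stands in for commutativity, and [sre_dot] identifies the real inner product with the
    Euclidean one in coordinates. *)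
Record scalar_laws (R : realType) (F : scalars R) (emb : R -> F) : Prop := ScalarLaws {
  coordK : cancel (@scalar_coord R F) (@scalar_of_coord R F);
  of_coordK : cancel (@scalar_of_coord R F) (@scalar_coord R F);
  coordD : forall x y : F, scalar_coord (x + y) = scalar_coord x + scalar_coord y;
  coordZ : forall a (x : F), scalar_coord (emb a * x) = a *: scalar_coord x;
  embC : forall a (x : F), emb a * x = x * emb a;
  sconjD : forall x y : F, scalar_conj (x + y) = scalar_conj x + scalar_conj y;
  sconjM : forall x y : F, scalar_conj (x * y) = scalar_conj y * scalar_conj x;
  sconjK : involutive (@scalar_conj R F);
  sconj_emb : forall a, scalar_conj (emb a) = emb a;
  sreD : forall x y : F, scalar_re (x + y) = scalar_re x + scalar_re y;
  sre_emb : forall a (x : F), scalar_re (emb a * x) = a * scalar_re x;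
  sreC : forall x y : F, scalar_re (x * y) = scalar_re (y * x);
  sre_conj : forall x : F, scalar_re (scalar_conj x) = scalar_re x;
  sre_dot : forall x y : F, scalar_re (scalar_conj x * y) =
    \sum_k scalar_coord x 0 k * scalar_coord y 0 k }.

Definition emb_of (R : realType) (f : triple) : R -> scalars_of R f :=
  match f return R -> scalars_of R f with
  | Orthogonal => fun a : R => a
  | Unitary => fun a : R => Complex a 0 : R[i]
  | Symplectic => fun a : R => Quaternion a 0 0 0
  end.

Lemma scalars_of_laws (R : realType) (f : triple) : scalar_laws (@emb_of R f).
Proof.
case: f; split => /=.
- by move=> x; rewrite mxE.
- by move=> v; apply/rowP => k; rewrite mxE !ord1.
- by move=> x y; apply/rowP => k; rewrite !mxE.
- by move=> a x; apply/rowP => k; rewrite !mxE.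
- by move=> a x; rewrite mulrC.
- by [].
- by move=> x y; rewrite mulrC.
- by [].
- by [].
- by [].
- by [].
- by move=> x y; rewrite mulrC.
- by [].
- by move=> x y; rewrite big_ord1 !mxE.
- by case=> a b; rewrite !mxE !inordK.
- move=> v; apply/rowP => -[[|[|k]] kP] //; rewrite mxE /=;
    by congr (v _ _); apply/val_inj; rewrite /= inordK.
- by move=> [a b] [c d]; apply/rowP => -[[|[|k]] kP] //; rewrite !mxE.
- by move=> c [a b]; apply/rowP => -[[|[|k]] kP] //; rewrite !mxE /=; ring.
- by move=> a x; rewrite mulrC.
- by move=> x y; rewrite rmorphD.
- by move=> x y; rewrite rmorphM mulrC.
- exact: conjcK.
- by move=> a; rewrite /= oppr0.
- by move=> [a b] [c d].
- by move=> c [a b] /=; ring.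
- by move=> x y; rewrite mulrC.
- by case.
- move=> [a b] [c d] /=; rewrite !big_ord_recl big_ord0 !mxE /=; ring.
- by case=> a b c d; rewrite !mxE !inordK.
- move=> v; apply/rowP => -[[|[|[|[|k]]]] kP] //; rewrite mxE /=;
    by congr (v _ _); apply/val_inj; rewrite /= inordK.
- move=> [? ? ? ?] [? ? ? ?]; apply/rowP => -[[|[|[|[|k]]]] kP] //; by rewrite !mxE.
- move=> e [? ? ? ?]; apply/rowP => -[[|[|[|[|k]]]] kP] //; rewrite !mxE /=; ring.
- by move=> e [? ? ? ?]; congr Quaternion; ring.
- move=> [? ? ? ?] [? ? ? ?]; congr Quaternion => /=; ring.
- move=> [? ? ? ?] [? ? ? ?]; congr Quaternion => /=; ring.
- by move=> [? ? ? ?]; rewrite /quat_conj /= !opprK.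
- by move=> e; rewrite /quat_conj /= !oppr0.
- by move=> [? ? ? ?] [? ? ? ?].
- by move=> e [? ? ? ?] /=; ring.
- by move=> [? ? ? ?] [? ? ? ?] /=; ring.
- by case.
- move=> [? ? ? ?] [? ? ? ?] /=; rewrite !big_ord_recl big_ord0 !mxE /=; ring.
Qed.

Section ScalarMatrices.
Context {R : realType} {F : scalars R} {emb : R -> F} (FL : scalar_laws emb).
Implicit Types a b : R.

Lemma coord_inj : injective (@scalar_coord R F).
Proof. exact: can_inj (coordK FL). Qed.

Lemma emb1 : emb 1 = 1.
Proof. by apply: coord_inj; rewrite -[emb 1]mulr1 (coordZ FL) scale1r. Qed.

Lemma embD a b : emb (a + b) = emb a + emb b.
Proof.
apply: coord_inj; rewrite (coordD FL) -[emb (a + b)]mulr1 -[emb a]mulr1.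
by rewrite -[emb b]mulr1 !(coordZ FL) scalerDl.
Qed.

Lemma emb0 : emb 0 = 0.
Proof. by apply: (addrI (emb 0)); rewrite -embD !addr0. Qed.

Lemma sconj0 : scalar_conj (0 : F) = 0.
Proof. by apply: (addrI (scalar_conj 0)); rewrite -(sconjD FL) !addr0. Qed.

Lemma sconjN (x : F) : scalar_conj (- x) = - scalar_conj x.
Proof. by apply: (addrI (scalar_conj x)); rewrite -(sconjD FL) !subrr sconj0. Qed.

Lemma sconj1 : scalar_conj (1 : F) = 1.
Proof. by rewrite -emb1 (sconj_emb FL). Qed.

Lemma sconj_sum I (r : seq I) (P : pred I) (E : I -> F) :
  scalar_conj (\sum_(i <- r | P i) E i) = \sum_(i <- r | P i) scalar_conj (E i).
Proof. exact: (big_morph _ (sconjD FL) sconj0). Qed.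

Lemma sre0 : scalar_re (0 : F) = 0.
Proof. by apply: (addrI (scalar_re (0 : F))); rewrite -(sreD FL) !addr0. Qed.

Lemma sreN (x : F) : scalar_re (- x) = - scalar_re x.
Proof. by apply: (addrI (scalar_re x)); rewrite -(sreD FL) !subrr sre0. Qed.

Lemma sre_sum I (r : seq I) (P : pred I) (E : I -> F) :
  scalar_re (\sum_(i <- r | P i) E i) = \sum_(i <- r | P i) scalar_re (E i).
Proof. exact: (big_morph _ (sreD FL) sre0). Qed.

Lemma mxcoordK m p : cancel (@mxcoord R F m p) (@mx_of_coord R F m p).
Proof.
move=> A; rewrite /mx_of_coord /mxcoord -[RHS]mxvecK; congr vec_mx.
apply/rowP => k; rewrite !mxE -[RHS](coordK FL); congr scalar_of_coord.
by apply/rowP => l; rewrite !mxE.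
Qed.

Lemma mx_of_coordK m p : cancel (@mx_of_coord R F m p) (@mxcoord R F m p).
Proof.
move=> V; apply/matrixP => k l; rewrite /mx_of_coord !mxE vec_mxK mxE.
by rewrite (of_coordK FL) mxE.
Qed.

Lemma mxcoordD m p (A B : 'M[F]_(m, p)) : mxcoord (A + B) = mxcoord A + mxcoord B.
Proof. by apply/matrixP => k l; rewrite !mxE linearD mxE (coordD FL) mxE. Qed.

Lemma mxcoordZ m p a (A : 'M[F]_(m, p)) : mxcoord (emb a *: A) = a *: mxcoord A.
Proof. by apply/matrixP => k l; rewrite !mxE linearZ mxE (coordZ FL) mxE. Qed.

Lemma mx_of_coordD m p V W : mx_of_coord (V + W) =
  mx_of_coord V + mx_of_coord W :> 'M[F]_(m, p).
Proof.
by apply: (can_inj (@mxcoordK m p)); rewrite mxcoordD !mx_of_coordK.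
Qed.

Lemma mx_of_coordZ m p a V : mx_of_coord (a *: V) = emb a *: mx_of_coord V :> 'M[F]_(m, p).
Proof.
by apply: (can_inj (@mxcoordK m p)); rewrite mxcoordZ !mx_of_coordK.
Qed.

Lemma mx_of_coord0 m p : mx_of_coord 0 = 0 :> 'M[F]_(m, p).
Proof. by apply: (addrI (mx_of_coord 0 : 'M[F]_(m, p))); rewrite -mx_of_coordD !addr0. Qed.

Lemma mxcoord0 m p : mxcoord (0 : 'M[F]_(m, p)) = 0.
Proof. by rewrite -mx_of_coord0 mx_of_coordK. Qed.

Lemma mxcoordN m p (A : 'M[F]_(m, p)) : mxcoord (- A) = - mxcoord A.
Proof. by apply: (addrI (mxcoord A)); rewrite -mxcoordD !subrr mxcoord0. Qed.

Lemma mx_of_coordN m p V : mx_of_coord (- V) = - mx_of_coord V :> 'M[F]_(m, p).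
Proof. by apply: (addrI (mx_of_coord V)); rewrite -mx_of_coordD !subrr mx_of_coord0. Qed.

Lemma scale_emb_mulmxr m n p a (A : 'M[F]_(m, n)) (B : 'M[F]_(n, p)) :
  A *m (emb a *: B) = emb a *: (A *m B).
Proof.
apply/matrixP => i j; rewrite !mxE mulr_sumr; apply: eq_bigr => k _.
by rewrite !mxE !mulrA (embC FL).
Qed.

Lemma linear_mxcoord m n p q (L : 'M[F]_(m, n) -> 'M[F]_(p, q)) :
  (forall A B, L (A + B) = L A + L B) ->
  (forall a A, L (emb a *: A) = emb a *: L A) ->
  linear (fun V => mxcoord (L (mx_of_coord V))).
Proof.
by move=> LD LZ a V W; rewrite mx_of_coordD mx_of_coordZ LD LZ mxcoordD mxcoordZ.
Qed.

Lemma conj_trD m p (A B : 'M[F]_(m, p)) : conj_tr (A + B) = conj_tr A + conj_tr B.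
Proof. by apply/matrixP => i j; rewrite !mxE (sconjD FL). Qed.

Lemma conj_trN m p (A : 'M[F]_(m, p)) : conj_tr (- A) = - conj_tr A.
Proof. by apply/matrixP => i j; rewrite !mxE sconjN. Qed.

Lemma conj_trB m p (A B : 'M[F]_(m, p)) : conj_tr (A - B) = conj_tr A - conj_tr B.
Proof. by rewrite conj_trD conj_trN. Qed.

Lemma conj_trZ m p a (A : 'M[F]_(m, p)) : conj_tr (emb a *: A) = emb a *: conj_tr A.
Proof. by apply/matrixP => i j; rewrite !mxE (sconjM FL) (sconj_emb FL) (embC FL). Qed.

Lemma conj_trK m p (A : 'M[F]_(m, p)) : conj_tr (conj_tr A) = A.
Proof. by apply/matrixP => i j; rewrite !mxE (sconjK FL). Qed.

Lemma conj_trM m n p (A : 'M[F]_(m, n)) (B : 'M[F]_(n, p)) :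
  conj_tr (A *m B) = conj_tr B *m conj_tr A.
Proof.
apply/matrixP => i j; rewrite !mxE sconj_sum; apply: eq_bigr => k _.
by rewrite !mxE (sconjM FL).
Qed.

Lemma conj_tr1 n : conj_tr (1%:M : 'M[F]_n) = 1%:M.
Proof.
by apply/matrixP => i j; rewrite !mxE eq_sym; case: eqP; rewrite ?sconj1 ?sconj0.
Qed.

Lemma conj_tr0 m p : conj_tr (0 : 'M[F]_(m, p)) = 0.
Proof. by apply/matrixP => i j; rewrite !mxE sconj0. Qed.

Lemma conj_tr_block m1 m2 n1 n2 (A : 'M[F]_(m1, n1)) (B : 'M[F]_(m1, n2))
    (C : 'M[F]_(m2, n1)) (D : 'M[F]_(m2, n2)) :
  conj_tr (block_mx A B C D) =
  block_mx (conj_tr A) (conj_tr C) (conj_tr B) (conj_tr D).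
Proof. by rewrite /conj_tr map_block_mx tr_block_mx. Qed.

Definition retr n (A : 'M[F]_n) : R := scalar_re (\tr A).

Lemma retrD n (A B : 'M[F]_n) : retr (A + B) = retr A + retr B.
Proof. by rewrite /retr mxtraceD (sreD FL). Qed.

Lemma retrN n (A : 'M[F]_n) : retr (- A) = - retr A.
Proof. by rewrite /retr raddfN sreN. Qed.

Lemma retrZ n a (A : 'M[F]_n) : retr (emb a *: A) = a * retr A.
Proof. by rewrite /retr mxtraceZ (sre_emb FL). Qed.

(** Over H the trace itself is not cyclic; its real part is, because real parts of products
    commute. *)
Lemma retrC m n (A : 'M[F]_(m, n)) (B : 'M[F]_(n, m)) : retr (A *m B) = retr (B *m A).
Proof.
rewrite /retr /mxtrace !sre_sum.
under eq_bigr do rewrite mxE sre_sum.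
rewrite exchange_big; apply: eq_bigr => j _ /=.
by rewrite mxE sre_sum; apply: eq_bigr => i _; rewrite (sreC FL).
Qed.

Lemma retr_conj_tr n (A : 'M[F]_n) : retr (conj_tr A) = retr A.
Proof.
rewrite /retr /mxtrace !sre_sum; apply: eq_bigr => i _.
by rewrite !mxE (sre_conj FL).
Qed.

Definition inner m n (A B : 'M[F]_(m, n)) : R := retr (conj_tr A *m B).

Lemma trace_metricE n (p X Y : 'M[R]_(n * n, scalar_dim F)) :
  trace_metric p X Y = inner (mx_of_coord X) (mx_of_coord Y).
Proof. by []. Qed.

Lemma innerC m n (A B : 'M[F]_(m, n)) : inner A B = inner B A.
Proof. by rewrite /inner -retr_conj_tr conj_trM conj_trK. Qed.

Lemma innerDr m n (A B C : 'M[F]_(m, n)) : inner A (B + C) = inner A B + inner A C.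
Proof. by rewrite /inner mulmxDr retrD. Qed.

Lemma innerZr m n a (A B : 'M[F]_(m, n)) : inner A (emb a *: B) = a * inner A B.
Proof. by rewrite /inner scale_emb_mulmxr retrZ. Qed.

Lemma innerDl m n (A B C : 'M[F]_(m, n)) : inner (A + B) C = inner A C + inner B C.
Proof. by rewrite innerC innerDr !(innerC C). Qed.

Lemma innerZl m n a (A B : 'M[F]_(m, n)) : inner (emb a *: A) B = a * inner A B.
Proof. by rewrite innerC innerZr innerC. Qed.

Lemma innerNr m n (A B : 'M[F]_(m, n)) : inner A (- B) = - inner A B.
Proof. by rewrite /inner mulmxN retrN. Qed.

Lemma innerNl m n (A B : 'M[F]_(m, n)) : inner (- A) B = - inner A B.
Proof. by rewrite innerC innerNr innerC. Qed.

Lemma inner_coord m n (A B : 'M[F]_(m, n)) :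
  inner A B = \sum_i \sum_j \sum_k
    scalar_coord (A i j) 0 k * scalar_coord (B i j) 0 k.
Proof.
rewrite /inner /retr /mxtrace sre_sum exchange_big; apply: eq_bigr => j _ /=.
rewrite mxE sre_sum; apply: eq_bigr => i _.
by rewrite !mxE (sre_dot FL).
Qed.

(** One term of a sum of squares. It gives both the definiteness of [inner] and the boundedness of
    M. *)
Lemma sqr_coord_le_inner m n (A : 'M[F]_(m, n)) i j k :
  scalar_coord (A i j) 0 k ^+ 2 <= inner A A.
Proof.
rewrite inner_coord (bigD1 i) //= (bigD1 j) //= (bigD1 k) //= expr2 -!addrA lerDl.
by rewrite !addr_ge0 // ?sumr_ge0 // => *; rewrite ?sumr_ge0 // => *;
  rewrite ?sumr_ge0 // => *; rewrite -expr2 sqr_ge0.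
Qed.

Lemma inner_ge0 m n (A : 'M[F]_(m, n)) : 0 <= inner A A.
Proof.
rewrite inner_coord !sumr_ge0 // => i _; rewrite sumr_ge0 // => j _.
by rewrite sumr_ge0 // => k _; rewrite -expr2 sqr_ge0.
Qed.

Lemma inner_eq0 m n (A : 'M[F]_(m, n)) : inner A A = 0 -> A = 0.
Proof.
move=> A0; apply/matrixP => i j; rewrite mxE; apply: coord_inj.
rewrite -emb0 -[emb 0]mulr1 (coordZ FL) scale0r; apply/rowP => k; rewrite mxE.
have := sqr_coord_le_inner A i j k; rewrite A0.
by move=> h; apply/eqP; rewrite -sqrf_eq0 eq_le h sqr_ge0.
Qed.

Lemma inner_mull m n (u : 'M[F]_m) (A B : 'M[F]_(m, n)) :
  conj_tr u *m u = 1%:M -> inner (u *m A) (u *m B) = inner A B.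
Proof. by move=> uu; rewrite /inner conj_trM mulmxA -(mulmxA _ _ u) uu mulmx1. Qed.

Lemma inner_mulr m n (u : 'M[F]_n) (A B : 'M[F]_(m, n)) :
  u *m conj_tr u = 1%:M -> inner (A *m u) (B *m u) = inner A B.
Proof.
move=> uu; rewrite /inner conj_trM mulmxA retrC !mulmxA uu mul1mx.
by [].
Qed.

(** Moving [X] to the other side of the real inner product changes the sign, so the value equals its
    own opposite. *)
Lemma inner_skew m n (X : 'M[F]_m) (A : 'M[F]_(m, n)) :
  conj_tr X = - X -> inner A (X *m A) = 0.
Proof.
move=> sX; have : inner A (X *m A) = - inner A (X *m A).
  rewrite {1}/inner -retr_conj_tr !conj_trM conj_trK sX mulmxN mulNmx retrN.
  by rewrite /inner mulmxA.
by move/eqP; rewrite -subr_eq0 opprK -mulr2n mulrn_eq0 => /eqP.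
Qed.

Lemma is_inverse_uniq n (A B C : 'M[F]_n) : is_inverse A B -> is_inverse A C -> B = C.
Proof.
by move=> [_ BA] [AC1 _]; rewrite -[B]mulmx1 -AC1 mulmxA BA mul1mx.
Qed.

Lemma inverse_mxE n (A B : 'M[F]_n) : is_inverse A B -> inverse_mx A = B.
Proof.
move=> AB; apply: xget_unique; first exact: AB.
by move=> C AinvC; exact: is_inverse_uniq AinvC AB.
Qed.

Lemma inverse_mxP n (A : 'M[F]_n) : (exists B, is_inverse A B) ->
  is_inverse A (inverse_mx A).
Proof. by case=> B AB; rewrite (inverse_mxE AB). Qed.

Lemma is_inverseM n (A A' B B' : 'M[F]_n) :
  is_inverse A A' -> is_inverse B B' -> is_inverse (A *m B) (B' *m A').
Proof.
move=> [AA' A'A] [BB' B'B]; split.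
  by rewrite mulmxA -(mulmxA A) BB' mulmx1.
by rewrite mulmxA -(mulmxA B') A'A mulmx1.
Qed.

End ScalarMatrices.

(** * Continuity and smoothness of matrix inversion *)

Section MatrixLimits.
Context {R : realType} {T : Type} {Fl : set_system T} {FF : Filter Fl}.

Lemma mx_cvg m n (u : T -> 'M[R]_(m, n)) (x : 'M[R]_(m, n)) :
  (forall i j, (fun t => u t i j) @ Fl --> x i j) -> u @ Fl --> x.
Proof.
move=> ux; rewrite (matrix_sum_delta x).
rewrite (_ : u = fun t => \sum_i \sum_j u t i j *: delta_mx i j); last first.
  by apply/funext => t; exact: matrix_sum_delta.
apply: cvg_sumr => i; apply: cvg_sumr => j; apply: cvgZr_tmp; exact: ux.
Qed.

Lemma mx_cvg_coord m n (u : T -> 'M[R]_(m, n)) (x : 'M[R]_(m, n)) i j :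
  u @ Fl --> x -> (fun t => u t i j) @ Fl --> x i j.
Proof. by move=> ux; exact: (cvg_comp _ _ ux (@coord_continuous _ _ _ i j x)). Qed.

Lemma cvg_prodr (I : Type) (r : seq I) (u : I -> T -> R) (l : I -> R) :
  (forall i, u i @ Fl --> l i) ->
  (fun t => \prod_(i <- r) u i t) @ Fl --> \prod_(i <- r) l i.
Proof. by move=> ul; apply: cvg_big => //; exact: mul_continuous. Qed.

Lemma det_cvg n (u : T -> 'M[R]_n) (x : 'M[R]_n) :
  u @ Fl --> x -> (fun t => \det (u t)) @ Fl --> \det x.
Proof.
move=> ux; apply: cvg_sumr => s; apply: cvgM; first exact: cvg_cst.
by apply: cvg_prodr => i; exact: mx_cvg_coord.
Qed.

(** Cramer's rule: near an invertible limit the inverse is the adjugate divided by a determinant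
    that stays away from 0. *)
Lemma invmx_cvg n (u : T -> 'M[R]_n) (x : 'M[R]_n) : x \in unitmx ->
  u @ Fl --> x ->
  (\forall t \near Fl, u t \in unitmx) /\ (fun t => invmx (u t)) @ Fl --> invmx x.
Proof.
rewrite unitmxE unitfE => dx ux; have du := det_cvg ux.
have nu : \forall t \near Fl, u t \in unitmx.
  near=> t; rewrite unitmxE unitfE; near: t.
  exact: (cvgr_neq0 _ du).
split=> //; rewrite /invmx unitmxE unitfE dx.
have : (fun t => (\det (u t))^-1 *: \adj (u t)) @ Fl --> (\det x)^-1 *: \adj x.
  apply: cvgZ; first exact: cvgV.
  apply: mx_cvg => i j.
  rewrite mxE; under [X in X @ _]eq_fun do rewrite mxE.
  apply: cvgM; first exact: cvg_cst.
  apply: det_cvg; apply: mx_cvg => k l; rewrite !mxE.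
  under [X in X @ _]eq_fun do rewrite !mxE.
  exact: mx_cvg_coord.
apply: cvg_trans; apply: near_eq_cvg.
by near=> t; rewrite ifT//; near: t.
Unshelve. all: by end_near. Qed.

End MatrixLimits.

Section InverseCalculus.
Context {R : realType} {F : scalars R} {emb : R -> F} (FL : scalar_laws emb).

Definition invertible n (A : 'M[F]_n) : Prop := exists B, is_inverse A B.

Definition lmul_coord m n p (A : 'M[F]_(m, n)) (V : 'M[R]_(n * p, scalar_dim F)) :
  'M[R]_(m * p, scalar_dim F) := mxcoord (A *m mx_of_coord V).

Lemma lmul_coord_linear m n p (A : 'M[F]_(m, n)) : linear (@lmul_coord m n p A).
Proof.
apply: (linear_mxcoord FL) => [B C|a B]; first by rewrite mulmxDr.
by rewrite (scale_emb_mulmxr FL).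
Qed.

(** The real square matrix of left multiplication by [A]. It turns invertibility over F, including
    H, into invertibility of a real matrix, where determinants are available. *)
Definition lmul_mx n (A : 'M[F]_n) := lin_mx (@lmul_coord n n n A).

Lemma mul_vec_lmul n (A : 'M[F]_n) V :
  mxvec V *m lmul_mx A = mxvec (lmul_coord A V).
Proof.
pose g := HB.pack_for {linear 'M[R]_(n * n, scalar_dim F) ->
  'M[R]_(n * n, scalar_dim F)} (@lmul_coord n n n A)
  (GRing.isLinear.Build R _ _ *:%R _ (@lmul_coord_linear n n n A)).
exact: (mul_vec_lin g).
Qed.

(* Left multiplication by [A] is an injective endomorphism of a
   finite-dimensional real space, hence surjective. *)
Lemma injective_lmul_unit n (A : 'M[F]_n) :
  (forall W : 'M[F]_n, A *m W = 0 -> W = 0) -> lmul_mx A \in unitmx.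
Proof.
move=> Ainj; rewrite -row_free_unit; apply: inj_row_free => v.
rewrite -[v]vec_mxK mul_vec_lmul => /(congr1 vec_mx); rewrite mxvecK linear0.
rewrite /lmul_coord => /(congr1 (@mx_of_coord R F n n)).
rewrite (mxcoordK FL) (mx_of_coord0 FL) => /Ainj /(congr1 (@mxcoord R F n n)).
by rewrite (mx_of_coordK FL) (mxcoord0 FL) => ->; rewrite linear0.
Qed.

(** The preimage [w] of 1 under left multiplication is a right inverse; it is also a left inverse
    because [A] annihilates w A - 1 and left multiplication by [A] is injective. *)
Lemma lmul_unit_inverse n (A : 'M[F]_n) : lmul_mx A \in unitmx ->
  is_inverse A (mx_of_coord
    (vec_mx (mxvec (mxcoord (1%:M : 'M[F]_n)) *m invmx (lmul_mx A)))).
Proof.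
move=> Aunit; set w := mx_of_coord _.
have Aw : A *m w = 1%:M.
  apply: (can_inj (mxcoordK FL (p := n))); apply: (can_inj mxvecK).
  rewrite -[mxcoord _](_ : lmul_coord A (mxcoord w) = _); last first.
    by rewrite /lmul_coord (mxcoordK FL).
  by rewrite -mul_vec_lmul /w (mx_of_coordK FL) vec_mxK mulmxKV.
have Ainj (W : 'M[F]_n) : A *m W = 0 -> W = 0.
  move=> AW; apply: (can_inj (mxcoordK FL (p := n))); apply: (can_inj mxvecK).
  rewrite -[LHS](mulmxK Aunit) mul_vec_lmul /lmul_coord (mxcoordK FL) AW.
  by rewrite (mxcoord0 FL) linear0 mul0mx.
split=> //; apply/eqP; rewrite -subr_eq0; apply/eqP/Ainj.
by rewrite mulmxBr mulmxA Aw mul1mx mulmx1 subrr.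
Qed.

Lemma invertibleP n (A : 'M[F]_n) : invertible A <-> lmul_mx A \in unitmx.
Proof.
split=> [[B [AB1 BA1]]|/lmul_unit_inverse ?]; last by eexists; eassumption.
apply: injective_lmul_unit => W AW.
by rewrite -[W]mul1mx -BA1 -mulmxA AW mulmx0.
Qed.

Lemma injective_invertible n (A : 'M[F]_n) :
  (forall W : 'M[F]_n, A *m W = 0 -> W = 0) -> invertible A.
Proof. by move=> Ainj; apply/invertibleP/injective_lmul_unit. Qed.

Definition inv_coord n (V : 'M[R]_(n * n, scalar_dim F)) : 'M[R]_(n * n, scalar_dim F) :=
  mxcoord (inverse_mx (mx_of_coord V : 'M[F]_n)).

Lemma lmul_mx_linear n : linear (fun V => lmul_mx (mx_of_coord V : 'M[F]_n)).
Proof.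
move=> a V W; apply/row_matrixP => i; rewrite !rowE mulmxDr -scalemxAr.
rewrite -(vec_mxK (delta_mx 0 i)) !mul_vec_lmul -linearZ -linearD; congr mxvec.
rewrite /lmul_coord (mx_of_coordD FL) (mx_of_coordZ FL) mulmxDl -scalemxAl.
by rewrite (mxcoordD FL) (mxcoordZ FL).
Qed.

(** Wherever [lmul_mx] is invertible, [inv_coord] is a fixed linear function [L] of its real
    inverse, so the real case transfers. *)
Lemma inverse_cvg T (Fl : set_system T) {FF : Filter Fl} n
    (u : T -> 'M[R]_(n * n, scalar_dim F)) x :
  invertible (mx_of_coord x : 'M[F]_n) -> u @ Fl --> x ->
  (\forall t \near Fl, invertible (mx_of_coord (u t) : 'M[F]_n)) /\
  (fun t => inv_coord (u t)) @ Fl --> inv_coord x.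
Proof.
move=> /invertibleP ix ux.
have lu : (fun t => lmul_mx (mx_of_coord (u t) : 'M[F]_n)) @ Fl -->
          lmul_mx (mx_of_coord x : 'M[F]_n).
  exact: (linear_mx_cvg (@lmul_mx_linear n) ux).
have [nu iu] := invmx_cvg ix lu.
split; first by apply: filterS nu => t /invertibleP.
pose L (M : 'M[R]_(n * n * scalar_dim F)) : 'M[R]_(n * n, scalar_dim F) :=
  vec_mx (mxvec (mxcoord (1%:M : 'M[F]_n)) *m M).
have lL : linear L by move=> a M N; rewrite /L mulmxDr -scalemxAr linearD linearZ.
have iE (V : 'M[R]_(n * n, scalar_dim F)) : lmul_mx (mx_of_coord V : 'M[F]_n) \in unitmx ->
    inv_coord V = L (invmx (lmul_mx (mx_of_coord V : 'M[F]_n))).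
  by move=> /lmul_unit_inverse /inverse_mxE iV; rewrite /inv_coord iV (mx_of_coordK FL).
rewrite iE //; apply: cvg_trans (linear_mx_cvg lL iu); apply: near_eq_cvg.
by apply: filterS nu => t ut; rewrite iE.
Qed.

Definition mul_coord m n p (V : 'M[R]_(m * n, scalar_dim F))
    (W : 'M[R]_(n * p, scalar_dim F)) : 'M[R]_(m * p, scalar_dim F) :=
  mxcoord (mx_of_coord V *m mx_of_coord W).

Lemma mul_coord_linearl m n p W : linear ((@mul_coord m n p)^~ W).
Proof.
apply: (linear_mxcoord FL (L := fun A => A *m mx_of_coord W)) => [A B|a A].
  by rewrite mulmxDl.
by rewrite scalemxAl.
Qed.

Lemma mul_coord_linearr m n p V : linear (@mul_coord m n p V).
Proof.
apply: (linear_mxcoord FL) => [A B|a A]; first by rewrite mulmxDr.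
by rewrite (scale_emb_mulmxr FL).
Qed.

Section InverseDerivative.
Context {V : normedModType R} {n : nat}.
Implicit Types f : V -> 'M[R]_(n * n, scalar_dim F).

(** The difference quotient is rewritten by the identity S^-1 - T^-1 = - S^-1 (S - T) T^-1, which
    keeps the factors in the order required over H. *)
Lemma is_derive_inv f x v df : {for x, continuous f} ->
  invertible (mx_of_coord (f x) : 'M[F]_n) -> is_derive x v f df ->
  is_derive x v (fun y => inv_coord (f y))
    (- mul_coord (mul_coord (inv_coord (f x)) df) (inv_coord (f x))).
Proof.
move=> cf ix /is_derive_cvg fd; apply/is_derive_cvg.
have cf' : f @ x --> f x by exact: cf.
have sh : (fun h : R => h *: v + x) @ 0^' --> x by exact: shift_cvg.
have fsh : (fun h : R => f (h *: v + x)) @ 0^' --> f x by exact: (cvg_comp _ _ sh cf').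
have [ni ci] := inverse_cvg ix fsh.
have : (fun h : R => - mul_coord (mul_coord (inv_coord (f (h *: v + x)))
      (h^-1 *: (f (h *: v + x) - f x))) (inv_coord (f x))) @ 0^' -->
   - mul_coord (mul_coord (inv_coord (f x)) df) (inv_coord (f x)).
  apply: cvgN; apply: (linear_mx_cvg (@mul_coord_linearl _ _ _ _)).
  apply: bilinear_mx_cvg => //; [exact: mul_coord_linearl|exact: mul_coord_linearr].
apply: cvg_trans; apply: near_eq_cvg; apply: filterS ni => h /inverse_mxP [hr hl].
have [xr xl] := inverse_mxP ix.
rewrite (linearZf (mul_coord_linearr _)) (linearZf (mul_coord_linearl _)).
rewrite -scalerN; congr (_ *: _); apply: (can_inj (mx_of_coordK FL (m := n) (p := n))).
rewrite (mx_of_coordN FL) !(mx_of_coordD FL, mxcoordK FL, mx_of_coordN FL).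
set A := inverse_mx _ in hr hl *; set B := inverse_mx _ in xr xl *.
by rewrite mulmxBr hl mulmxBl mul1mx -mulmxA xr mulmx1 opprB.
Qed.

(** The derivative of the inverse is a polynomial in the inverse and the derivative of [f], so class
    C^k of the inverse yields class C^(k+1). *)
Lemma Ck_on_inv k (U : set V) f : open U ->
  (forall x, U x -> invertible (mx_of_coord (f x) : 'M[F]_n)) ->
  Ck_on k U f -> Ck_on k U (fun y => inv_coord (f y)).
Proof.
move=> oU iU; elim: k => [|k IH] Cf.
  by case: Cf => cf _; split=> // x Ux; have [] := inverse_cvg (iU x Ux) (cf x Ux).
apply: (@Ck_onW _ _ _ k U _ (fun v x =>
  - mul_coord (mul_coord (inv_coord (f x)) ('D_v f x)) (inv_coord (f x)))) => //.
- move=> x Ux; have [] := inverse_cvg (iU x Ux) (Ck_on_continuous Cf Ux).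
  by [].
- move=> x v Ux; apply: is_derive_inv; [exact: (Ck_on_continuous Cf)|exact: iU|].
  exact: Ck_on_is_derive Cf Ux.
- move=> v; have IHf := IH (Ck_onS Cf).
  apply: (@Ck_on_linear _ _ _ _ k U (fun W => - W)) => //.
  + by move=> a y z; rewrite opprD scalerN.
  + exact: opp_continuous.
  apply: Ck_on_bilinear => //; [exact: mul_coord_linearl|exact: mul_coord_linearr|].
  apply: Ck_on_bilinear => //; [exact: mul_coord_linearl|exact: mul_coord_linearr|].
  exact: Ck_on_derive.
Qed.

End InverseDerivative.
End InverseCalculus.

(** * The fields of the Mobius action *)

Section Mobius.
Context {R : realType} {F : scalars R} {emb : R -> F} (FL : scalar_laws emb).
Variable n : nat.
Implicit Types (g : 'M[F]_(n + n)) (q : 'M[F]_n).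

Lemma inner_colsE m p (A : 'M[F]_(m, p)) (B : 'M[F]_(m, p)) :
  inner A B = \sum_j scalar_re ((conj_tr (col j A) *m col j B) 0 0).
Proof.
rewrite /inner /retr /mxtrace (sre_sum FL); apply: eq_bigr => j _.
by congr scalar_re; rewrite !mxE; apply: eq_bigr => i _; rewrite !mxE.
Qed.

(** Invariance of [form_b] summed over the columns of [W]. Several columns are allowed because
    [injective_invertible] tests a matrix against square matrices. *)
Lemma indefinite_unitary_inner g p (W : 'M[F]_(n + n, p)) :
  indefinite_unitary_set g ->
  inner (usubmx (g *m W)) (usubmx (g *m W)) - inner (dsubmx (g *m W)) (dsubmx (g *m W)) =
  inner (usubmx W) (usubmx W) - inner (dsubmx W) (dsubmx W).
Proof.
move=> [_ gform].
have E (Z : 'M[F]_(n + n, p)) : inner (usubmx Z) (usubmx Z) - inner (dsubmx Z) (dsubmx Z) =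
    \sum_j scalar_re (form_b (col j Z) (col j Z)).
  rewrite !inner_colsE -sumrB; apply: eq_bigr => j _; rewrite /form_b.
  have sreB (A B : 'M[F]_1) : scalar_re ((A - B) 0 0) = scalar_re (A 0 0) - scalar_re (B 0 0).
    by rewrite mxE (sreD FL) mxE (sreN FL).
  have -> : col j (usubmx Z) = usubmx (col j Z) by apply/matrixP => i k; rewrite !mxE.
  have -> : col j (dsubmx Z) = dsubmx (col j Z) by apply/matrixP => i k; rewrite !mxE.
  by rewrite sreB.
rewrite !E; apply: eq_bigr => j _; congr scalar_re.
by rewrite -(gform (col j W)) !colE !mulmxA.
Qed.

Definition mobius_num g q : 'M[F]_n := ulsubmx g *m q + ursubmx g.
Definition mobius_den g q : 'M[F]_n := dlsubmx g *m q + drsubmx g.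

(* If [(C q + D) W = 0], the column [(q W, W)] is isotropic for [b] and its
   image under [g] is [((A q + B) W, 0)], which therefore vanishes. *)
Lemma mobius_den_invertible g q : indefinite_unitary_set g -> unitary_set q ->
  invertible (mobius_den g q).
Proof.
move=> Gg [_ qq]; apply: (injective_invertible FL) => W dW.
pose Z := col_mx (q *m W) W.
have gZ : g *m Z = col_mx (mobius_num g q *m W) (mobius_den g q *m W).
  rewrite -[g]submxK mul_block_col; congr col_mx.
    by rewrite mulmxA -mulmxDl submxK.
  by rewrite mulmxA -mulmxDl submxK.
have := indefinite_unitary_inner Z Gg; rewrite gZ dW.
rewrite !col_mxKu !col_mxKd (inner_mull FL _ _ qq) subrr.
rewrite /inner mulmx0 /retr mxtrace0 (sre0 FL) subr0 => /(inner_eq0 FL) nW.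
have [[h [_ hg]] _] := Gg.
have Z0 : Z = 0 by rewrite -[Z]mul1mx -hg -mulmxA gZ nW dW col_mx0 mulmx0.
by rewrite -[W](col_mxKd (q *m W)) -/Z Z0 linear0.
Qed.

Definition mobius_deriv g (X : 'M[F]_(n + n)) q : 'M[F]_n :=
  let P := inverse_mx (mobius_den g q) in
  mobius_num X q *m P - mobius_num g q *m P *m mobius_den X q *m P.

Local Notation Eg := 'M[R]_((n + n) * (n + n), scalar_dim F).

Lemma mobius_num_linear q : linear (fun V : Eg => mxcoord (mobius_num (mx_of_coord V) q)).
Proof.
apply: (linear_mxcoord FL (L := mobius_num^~ q)) => [A B|a A].
  by rewrite /mobius_num /ulsubmx /ursubmx !linearD /= mulmxDl addrACA.
by rewrite /mobius_num /ulsubmx /ursubmx !linearZ /= -scalemxAl scalerDr.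
Qed.

Lemma mobius_den_linear q : linear (fun V : Eg => mxcoord (mobius_den (mx_of_coord V) q)).
Proof.
apply: (linear_mxcoord FL (L := mobius_den^~ q)) => [A B|a A].
  by rewrite /mobius_den /dlsubmx /drsubmx !linearD /= mulmxDl addrACA.
by rewrite /mobius_den /dlsubmx /drsubmx !linearZ /= -scalemxAl scalerDr.
Qed.

Variable G : set Eg.
Hypothesis GU : forall V, G V -> indefinite_unitary_set (mx_of_coord V : 'M[F]_(n + n)).

Lemma smooth_curve_is_derive (E : normedModType R) (S : set E) (gamma : R^o -> E) :
  smooth_curve S gamma -> is_derive (0 : R^o) (1 : R^o) gamma (velocity0 gamma).
Proof. by case=> U [U0 [_ /(_ 1%N) sU] _]; exact: Ck_on_is_derive sU U0. Qed.

Lemma smooth_curve_continuous0 (E : normedModType R) (S : set E) (gamma : R^o -> E) :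
  smooth_curve S gamma -> {for (0 : R^o), continuous gamma}.
Proof. by case=> U [U0 [_ /(_ 0%N) sU] _]; exact: (Ck_on_continuous sU). Qed.

Lemma smooth_curve0 (E : normedModType R) (S : set E) (gamma : R^o -> E) :
  smooth_curve S gamma -> S (gamma 0).
Proof. by case=> U [U0 _]; apply. Qed.

Lemma mobius_velocity (gamma : R^o -> Eg) q : smooth_curve G gamma -> unitary_set q ->
  is_derive (0 : R^o) (1 : R^o) (fun t => mxcoord (mobius (mx_of_coord (gamma t)) q))
  (mxcoord (mobius_deriv (mx_of_coord (gamma 0)) (mx_of_coord (velocity0 gamma)) q)).
Proof.
move=> sg qU; have dg := smooth_curve_is_derive sg.
have cg := smooth_curve_continuous0 sg.
have iden := mobius_den_invertible (GU (smooth_curve0 sg)) qU.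
have ln := @mobius_num_linear q; have ld := @mobius_den_linear q.
have cden : {for (0 : R^o), continuous
    (fun t => mxcoord (mobius_den (mx_of_coord (gamma t)) q))}.
  exact: (linear_mx_cvg ld cg).
have dnum := is_derive_linear ln (linear_mx_continuous ln) dg.
have dden := is_derive_linear ld (linear_mx_continuous ld) dg.
have iden' : invertible (mx_of_coord (mxcoord (mobius_den (mx_of_coord (gamma 0)) q)) : 'M[F]_n).
  by rewrite (mxcoordK FL).
have dinv := is_derive_inv FL cden iden' dden.
have cinv : {for (0 : R^o), continuous
    (fun t => inv_coord (mxcoord (mobius_den (mx_of_coord (gamma t)) q)))}.
  by have [] := inverse_cvg FL iden' cden.
have := is_derive_bilinear (@mul_coord_linearl _ _ _ FL n n n)
  (@mul_coord_linearr _ _ _ FL n n n) cinv dnum dinv.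
rewrite /= (_ : (fun y => _) =
  (fun t => mxcoord (mobius (mx_of_coord (gamma t)) q))); last first.
  by apply/funext => t; rewrite /mul_coord /inv_coord !(mxcoordK FL).
move=> H; apply: (is_derive_eq H); apply: (can_inj (mx_of_coordK FL (m := n) (p := n))).
rewrite /mul_coord /inv_coord (mx_of_coordD FL) !(mxcoordK FL) (mx_of_coordN FL) !(mxcoordK FL).
by rewrite mulmxN !mulmxA.
Qed.

(** By [mobius_velocity] every admissible curve gives the same vector, so [xget] chooses from a
    singleton; tangency of [X] supplies a curve and makes it nonempty. *)
Lemma mobius_fieldE (g X : Eg) (q : 'M[R]_(n * n, scalar_dim F)) :
  unitary_set (mx_of_coord q : 'M[F]_n) -> tangent G g X ->
  mobius_field (n := n) G g X q =
  mxcoord (mobius_deriv (mx_of_coord g) (mx_of_coord X) (mx_of_coord q)).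
Proof.
move=> qU [gamma [sg g0 vX]].
apply: xget_unique => [|v [delta [sd d0 vd ->]]]; last first.
  by rewrite /velocity0; have [_ ->] := mobius_velocity sd qU; rewrite d0 vd.
exists gamma; split=> //; rewrite /velocity0.
by have [_ ->] := mobius_velocity sg qU; rewrite g0 vX.
Qed.

End Mobius.

(** * Cayley charts *)

Section Cayley.
Context {R : realType} {F : scalars R} {emb : R -> F} (FL : scalar_laws emb).
Variable n : nat.
Implicit Types (X Y p : 'M[F]_n).

Definition skew_hermitian X : Prop := conj_tr X = - X.
Definition cayley X := (1%:M + X) *m inverse_mx (1%:M - X).
Definition cayley_inv Y := inverse_mx (Y + 1%:M) *m (Y - 1%:M).

Lemma emb_half_double (C : 'M[F]_n) : emb 2^-1 *: (C + C) = C.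
Proof.
rewrite scalerDr -scalerDl -(embD FL) (_ : 2^-1 + 2^-1 = 1 :> R).
  by rewrite (emb1 FL) scale1r.
by rewrite -mulr2n -(mulr_natl (2^-1)) divff // pnatr_eq0.
Qed.

(** If W = X W, then the squared norm of W is the inner product of W with X W, which vanishes for
    skew-hermitian X. *)
Lemma skew_den_invertible X : skew_hermitian X -> invertible (1%:M - X).
Proof.
move=> sX; apply: (injective_invertible FL) => W.
rewrite mulmxBl mul1mx => /eqP; rewrite subr_eq0 => /eqP WX.
by apply: (inner_eq0 FL); rewrite {2}WX (inner_skew FL).
Qed.

Lemma cayleyK X : skew_hermitian X -> cayley X *m (1%:M - X) = 1%:M + X.
Proof.
by move=> /skew_den_invertible /inverse_mxP[_ iX]; rewrite -mulmxA iX mulmx1.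
Qed.

Lemma is_inverse_conj_tr (A B : 'M[F]_n) : is_inverse A B ->
  is_inverse (conj_tr A) (conj_tr B).
Proof. by case=> AB1 BA1; split; rewrite -(conj_trM FL) ?AB1 ?BA1 (conj_tr1 FL). Qed.

Lemma cayley_unitary X : skew_hermitian X -> unitary_set (cayley X).
Proof.
move=> sX; have iX := inverse_mxP (skew_den_invertible sX).
have := is_inverse_conj_tr iX; rewrite (conj_trB FL) (conj_tr1 FL) sX opprK => iXs.
rewrite /unitary_set /= /cayley (conj_trM FL) (conj_trD FL) (conj_tr1 FL) sX.
set I := inverse_mx _ in iX iXs *.
have comm : (1%:M + X) *m (1%:M - X) = (1%:M - X) *m (1%:M + X).
  apply: comm_mxB; first exact: comm_mx1.
  by apply: comm_mx_sym; apply: comm_mxD; [exact: comm_mx1|exact: comm_mx_refl].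
(* Both products invert (1 + X)(1 - X), whose factors commute; uniqueness of inverses gives the
   equality. *)
have Icomm : I *m conj_tr I = conj_tr I *m I.
  apply: (@is_inverse_uniq _ _ _ ((1%:M + X) *m (1%:M - X))).
    exact: is_inverseM iXs iX.
  by rewrite comm; exact: is_inverseM iX iXs.
split.
  rewrite mulmxA -(mulmxA _ I) Icomm !mulmxA (iXs.1) mul1mx.
  exact: iX.2.
by rewrite mulmxA -(mulmxA (conj_tr I)) -comm !mulmxA iXs.2 mul1mx iX.1.
Qed.

(** (1 + X)(1 - X)^-1 + 1 equals 2 (1 - X)^-1. Hence every Cayley transform lies in the domain of
    [cayley_inv]. *)
Lemma cayleyD1 X : skew_hermitian X -> is_inverse (cayley X + 1%:M) (emb 2^-1 *: (1%:M - X)).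
Proof.
move=> sX.
have two := emb_half_double 1%:M.
have iX := inverse_mxP (skew_den_invertible sX).
have E : (cayley X + 1%:M) = (1%:M + 1%:M) *m inverse_mx (1%:M - X).
  have <- : (cayley X + 1%:M) *m (1%:M - X) = 1%:M + 1%:M.
    by rewrite mulmxDl cayleyK // mul1mx addrACA subrr addr0.
  by rewrite -mulmxA iX.1 mulmx1.
rewrite E; split.
  by rewrite (scale_emb_mulmxr FL) -mulmxA iX.2 mulmx1.
by rewrite -scalemxAl mulmxA mulmxDr !mulmx1 mulmxDl iX.1.
Qed.

Lemma cayleyX X : skew_hermitian X -> (cayley X + 1%:M) *m X = cayley X - 1%:M.
Proof.
move=> /cayleyK; rewrite mulmxBr mulmx1 => /eqP; rewrite subr_eq => /eqP cX.
by rewrite mulmxDl mul1mx [in RHS]cX -[1%:M + X + _]addrA [1%:M + _]addrC addrK addrC.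
Qed.

Lemma cayley_invK X : skew_hermitian X -> cayley_inv (cayley X) = X.
Proof.
move=> sX; rewrite /cayley_inv -cayleyX // mulmxA.
have iX : invertible (cayley X + 1%:M) by eexists; exact: cayleyD1.
by rewrite (inverse_mxP iX).2 mul1mx.
Qed.

Section InverseCayley.
Variable Y : 'M[F]_n.
Hypotheses (uY : unitary_set Y) (iY : invertible (Y + 1%:M)).
Let T := cayley_inv Y.

Let mulT : (Y + 1%:M) *m T = Y - 1%:M.
Proof. by rewrite /T /cayley_inv mulmxA (inverse_mxP iY).1 mul1mx. Qed.

Let Tmul : T *m (Y + 1%:M) = Y - 1%:M.
Proof.
rewrite /T /cayley_inv -mulmxA.
have -> : (Y - 1%:M) *m (Y + 1%:M) = (Y + 1%:M) *m (Y - 1%:M).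
  apply: comm_mxD; last exact: comm_mx1.
  by apply: comm_mx_sym; apply: comm_mxB; [exact: comm_mx_refl|exact: comm_mx1].
by rewrite mulmxA (inverse_mxP iY).2 mul1mx.
Qed.

(** The adjoint of T (Y + 1) = Y - 1, multiplied on the left by the unitary Y, reads (Y + 1) T' = 1
    - Y with T' the adjoint of T. Cancelling Y + 1 gives T' = - T. *)
Lemma cayley_inv_skew : skew_hermitian T.
Proof.
have := congr1 (@conj_tr R F n n) Tmul.
rewrite (conj_trM FL) (conj_trD FL) (conj_trB FL) (conj_tr1 FL).
move/(congr1 (mulmx Y)); rewrite mulmxA mulmxDr mulmxBr mulmx1 uY.1 => YT.
have [iYr iYl] := inverse_mxP iY.
rewrite [1%:M + Y]addrC in YT.
by rewrite /skew_hermitian -[conj_tr T]mul1mx -iYl -mulmxA YT -[1%:M - Y]opprB mulmxN.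
Qed.

Lemma cayley_invKV : cayley T = Y.
Proof.
have iT := inverse_mxP (skew_den_invertible cayley_inv_skew).
rewrite /cayley (_ : 1%:M + T = Y *m (1%:M - T)); first by rewrite -mulmxA iT.1 mulmx1.
have YE : Y = Y *m T + T + 1%:M by rewrite -[X in _ + X + _]mul1mx -mulmxDl mulT subrK.
rewrite mulmxBr mulmx1 [X in _ = X - _]YE -[Y *m T + T + 1%:M]addrA.
by rewrite [RHS]addrAC subrr add0r addrC.
Qed.

End InverseCayley.
End Cayley.

Section MulCalculus.
Context {R : realType} {F : scalars R} {emb : R -> F} (FL : scalar_laws emb).
Variables m n p : nat.

Lemma mul_coord_cvg T (Fl : set_system T) {FF : Filter Fl}
    (f : T -> 'M[R]_(m * n, scalar_dim F)) (g : T -> 'M[R]_(n * p, scalar_dim F)) x y :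
  f @ Fl --> x -> g @ Fl --> y ->
  (fun t => mul_coord (f t) (g t)) @ Fl --> mul_coord x y.
Proof.
apply: (bilinear_mx_cvg (B := @mul_coord R F m n p)).
  exact: (mul_coord_linearl FL).
exact: (mul_coord_linearr FL).
Qed.

Lemma Ck_on_mul_coord (V : normedModType R) k (U : set V)
    (f : V -> 'M[R]_(m * n, scalar_dim F)) (g : V -> 'M[R]_(n * p, scalar_dim F)) :
  open U -> Ck_on k U f -> Ck_on k U g -> Ck_on k U (fun x => mul_coord (f x) (g x)).
Proof.
move=> oU; apply: (Ck_on_bilinear (B := @mul_coord R F m n p) oU).
  exact: (mul_coord_linearl FL).
exact: (mul_coord_linearr FL).
Qed.

Lemma is_derive_mul_coord (V : normedModType R)
    (f : V -> 'M[R]_(m * n, scalar_dim F)) (g : V -> 'M[R]_(n * p, scalar_dim F)) x v df dg :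
  {for x, continuous g} -> is_derive x v f df -> is_derive x v g dg ->
  is_derive x v (fun y => mul_coord (f y) (g y))
    (mul_coord df (g x) + mul_coord (f x) dg).
Proof.
apply: (is_derive_bilinear (B := @mul_coord R F m n p)).
  exact: (mul_coord_linearl FL).
exact: (mul_coord_linearr FL).
Qed.

End MulCalculus.

Section SkewCoordinates.
Context {R : realType} {F : scalars R} {emb : R -> F} (FL : scalar_laws emb).
Variable n : nat.
Local Notation E := 'M[R]_(n * n, scalar_dim F).

(** A real linear map whose kernel is the space of skew-hermitian matrices. Presenting that space as
    a kernel provides a row basis, hence the linear coordinates [skew_coord] with values in row
    vectors, as charts require. *)
Definition skew_part (V : E) : E :=
  mxcoord (conj_tr (mx_of_coord V : 'M[F]_n)) + V.

Lemma skew_part_linear : linear skew_part.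
Proof.
move=> a V W; rewrite /skew_part (mx_of_coordD FL) (mx_of_coordZ FL).
by rewrite (conj_trD FL) (conj_trZ FL) (mxcoordD FL) (mxcoordZ FL) scalerDr addrACA.
Qed.

Lemma skew_part_eq0 V : skew_part V = 0 <-> skew_hermitian (mx_of_coord V : 'M[F]_n).
Proof.
rewrite /skew_part /skew_hermitian; split=> [/eqP|sV].
  rewrite addr_eq0 => /eqP /(congr1 (@mx_of_coord R F n n)).
  by rewrite (mxcoordK FL) (mx_of_coordN FL).
by rewrite sV (mxcoordN FL) (mx_of_coordK FL) addNr.
Qed.

Definition skew_ker := kermx (lin_mx skew_part).

Lemma mul_vec_skew_part V : mxvec V *m lin_mx skew_part = mxvec (skew_part V).
Proof.
pose g := HB.pack_for {linear E -> E} skew_part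
  (GRing.isLinear.Build R _ _ *:%R _ skew_part_linear).
exact: (mul_vec_lin g).
Qed.

Lemma sub_skew_ker V : (mxvec V <= skew_ker)%MS <-> skew_hermitian (mx_of_coord V : 'M[F]_n).
Proof.
rewrite -skew_part_eq0; split=> [/sub_kermxP|V0].
  by rewrite mul_vec_skew_part => /(congr1 vec_mx); rewrite mxvecK linear0.
by apply/sub_kermxP; rewrite mul_vec_skew_part V0 linear0.
Qed.

Definition skew_dim := \rank skew_ker.

Definition skew_of (v : 'rV[R]_skew_dim) : E := vec_mx (v *m row_base skew_ker).
Definition skew_coord (V : E) : 'rV[R]_skew_dim :=
  mxvec V *m pinvmx (row_base skew_ker).

Lemma skew_of_linear : linear skew_of.
Proof. by move=> a v w; rewrite /skew_of mulmxDl -scalemxAl linearD linearZ. Qed.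

Lemma skew_coord_linear : linear skew_coord.
Proof. by move=> a v w; rewrite /skew_coord linearD linearZ mulmxDl scalemxAl. Qed.

Lemma skew_of_skew v : skew_hermitian (mx_of_coord (skew_of v) : 'M[F]_n).
Proof.
by apply/sub_skew_ker; rewrite /skew_of vec_mxK -(eq_row_base skew_ker) submxMl.
Qed.

Lemma skew_ofK : cancel skew_of skew_coord.
Proof. by move=> v; rewrite /skew_coord /skew_of vec_mxK mulmxKp // row_base_free. Qed.

Lemma skew_coordK V : skew_hermitian (mx_of_coord V : 'M[F]_n) -> skew_of (skew_coord V) = V.
Proof.
move/sub_skew_ker; rewrite -(eq_row_base skew_ker) => sV.
by rewrite /skew_of /skew_coord mulmxKpV // mxvecK.
Qed.

End SkewCoordinates.

Section Charts.
Context {R : realType} {F : scalars R} {emb : R -> F} (FL : scalar_laws emb).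
Variable n : nat.
Local Notation E := 'M[R]_(n * n, scalar_dim F).

(** What the charts, the volume and the translations use of M. With [mgroup_unitary], the field
    [mgroup_cayley] expresses that the Lie algebra of M consists of all skew-hermitian matrices. *)
Record matrix_group (M : set 'M[F]_n) : Prop := MatrixGroup {
  mgroup_unitary : forall A, M A -> unitary_set A;
  mgroup1 : M 1%:M;
  mgroupM : forall A B, M A -> M B -> M (A *m B);
  mgroupV : forall A, M A -> M (conj_tr A);
  mgroup_cayley : forall X, skew_hermitian X -> M (cayley X);
  mgroup_closed : closed [set mxcoord A | A in M] }.

Variable M : set 'M[F]_n.
Hypothesis MG : matrix_group M.
Let Mc := [set mxcoord A | A in M] : set E.

Lemma mx_of_coord_group V : Mc V -> M (mx_of_coord V).
Proof. by move=> [A MA <-]; rewrite (mxcoordK FL). Qed.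

Lemma mxcoord_group A : M A -> Mc (mxcoord A).
Proof. by move=> MA; exists A. Qed.

Local Notation so := (@skew_of R F n).
Let X v : 'M[F]_n := mx_of_coord (so v).

(** The Cayley chart at the identity, moved to [p] by right translation. Its domain is the whole
    coordinate space and its centre is the origin. *)
Definition chart (p : 'M[F]_n) (v : 'rV[R]_(@skew_dim R F n)) : E :=
  mxcoord (cayley (X v) *m p).

Lemma chart_group p v : M p -> Mc (chart p v).
Proof.
move=> Mp; apply: mxcoord_group; apply: (mgroupM MG) => //.
exact/(mgroup_cayley MG)/(skew_of_skew FL).
Qed.

Let numc v := mxcoord (1%:M : 'M[F]_n) + so v.
Let denc v := mxcoord (1%:M : 'M[F]_n) - so v.

Let numcE v : mx_of_coord (numc v) = 1%:M + X v.
Proof. by rewrite /numc (mx_of_coordD FL) (mxcoordK FL). Qed.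

Let dencE v : mx_of_coord (denc v) = 1%:M - X v.
Proof. by rewrite /denc (mx_of_coordD FL) (mxcoordK FL) (mx_of_coordN FL). Qed.

Let skewX v : skew_hermitian (X v). Proof. exact: (skew_of_skew FL). Qed.

Let so_continuous : continuous so.
Proof. exact/linear_mx_continuous/skew_of_linear. Qed.

Let Ck_so k : Ck_on k setT so.
Proof.
apply: (@Ck_on_linear _ _ _ _ k setT so idfun openT (@skew_of_linear _ _ n)) => //.
exact: (Ck_on_id k openT).
Qed.

Let Ck_num k : Ck_on k setT numc.
Proof. by apply: Ck_onD; [exact: openT|apply: Ck_on_cst; exact: openT|]. Qed.

Let Ck_den k : Ck_on k setT denc.
Proof.
apply: Ck_onD; [exact: openT|apply: Ck_on_cst; exact: openT|].
apply: (@Ck_on_linear _ _ _ _ k setT (fun W => - W)) => //; first exact: openT.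
- by move=> a y z; rewrite opprD scalerN.
- exact: opp_continuous.
Qed.

Lemma chart_smooth p : smooth_on setT (chart p).
Proof.
split; first exact: openT.
move=> k.
rewrite (_ : chart p = fun v =>
    mul_coord (mul_coord (numc v) (inv_coord (denc v))) (mxcoord p)); last first.
  apply/funext => v; rewrite /chart /mul_coord /inv_coord !(mxcoordK FL).
  by rewrite numcE dencE.
apply: (Ck_on_mul_coord FL openT).
  apply: (Ck_on_mul_coord FL openT) => //.
  apply: (Ck_on_inv FL openT) => // v _; rewrite dencE.
  exact: (skew_den_invertible FL).
by apply: Ck_on_cst; exact: openT.
Qed.

Lemma chart_inj p v w : M p -> chart p v = chart p w -> v = w.
Proof.
move=> /(mgroup_unitary MG) [pp _] /(can_inj (mxcoordK FL (p := n))).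
move/(congr1 (mulmx^~ (conj_tr p))); rewrite -!mulmxA pp !mulmx1.
move/(congr1 (@cayley_inv R F n)); rewrite !(cayley_invK FL) //.
move/(can_inj (mx_of_coordK FL (p := n))).
exact: (can_inj (@skew_ofK _ _ n)).
Qed.

(* Differentiate [chart p v p^* (1 - X v) = 1 + X v]. *)
Lemma chart_derive p v w : M p ->
  mx_of_coord ('D_w (chart p) v) *m conj_tr p *m (1%:M - X v) =
  (cayley (X v) + 1%:M) *m X w.
Proof.
move=> Mp; have [pp _] := mgroup_unitary MG Mp.
have dchart : is_derive v w (chart p) ('D_w (chart p) v).
  by apply: (Ck_on_is_derive (k := 0) (U := setT)) => //; exact: (chart_smooth p).2.
have dso : is_derive v w so (so w).
  exact: (is_derive_linear (@skew_of_linear _ _ n) so_continuous (is_derive_id v w)).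
have dnum : is_derive v w numc (so w).
  by rewrite -[so w]add0r; apply: is_deriveD.
have dden : is_derive v w denc (- so w).
  by rewrite -[- so w]add0r; apply: is_deriveD.
have d1 := is_derive_linear (mul_coord_linearl FL (mxcoord (conj_tr p)))
  (linear_mx_continuous (mul_coord_linearl FL (mxcoord (conj_tr p)))) dchart.
have := is_derive_mul_coord FL (Ck_on_continuous (Ck_den 0) I) d1 dden.
rewrite [X in is_derive _ _ X](_ : _ = numc); last first.
  apply/funext => u /=; rewrite /mul_coord /chart !(mxcoordK FL).
  by rewrite -[_ *m p *m _]mulmxA pp mulmx1 dencE (cayleyK FL) // -numcE (mx_of_coordK FL).
case=> _; case: dnum => _ -> /(congr1 (@mx_of_coord R F n n)).
rewrite (mx_of_coordD FL) /mul_coord /chart /= !(mxcoordK FL) dencE (mx_of_coordN FL).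
rewrite -[_ *m p *m _]mulmxA pp mulmx1 mulmxN => /eqP.
by rewrite eq_sym subr_eq => /eqP ->; rewrite mulmxDl mul1mx addrC.
Qed.

(** In [chart_derive] the factor [cayley (X v) + 1%:M] is invertible, so a zero derivative forces
    the skew-hermitian direction to vanish. *)
Lemma chart_immersion p v w : M p -> 'D_w (chart p) v = 0 -> w = 0.
Proof.
move=> Mp d0; have := chart_derive v w Mp; rewrite d0 (mx_of_coord0 FL) !mul0mx.
have [_ i1] := cayleyD1 FL (skewX v).
move/esym/(congr1 (mulmx (emb 2^-1 *: (1%:M - X v)))); rewrite mulmxA i1 mul1mx mulmx0.
move=> Xw; apply: (can_inj (@skew_ofK _ _ n)).
apply: (can_inj (mx_of_coordK FL (p := n))).
by rewrite -/(X w) Xw (linear0f (@skew_of_linear _ _ n)) (mx_of_coord0 FL).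
Qed.

Lemma chart_parametrization p : M p -> parametrization Mc setT (chart p).
Proof.
move=> Mp; have uP := mgroup_unitary MG Mp; have [pp pp'] := uP.
split; first exact: chart_smooth.
- by move=> v _; exact: chart_group.
- by move=> v w _ _; exact: chart_inj.
- by move=> v w _; exact: chart_immersion.
move=> V oV _.
pose Yc (H : E) := mul_coord H (mxcoord (conj_tr p)) + mxcoord (1%:M : 'M[F]_n).
pose Zc (H : E) := mul_coord H (mxcoord (conj_tr p)) - mxcoord (1%:M : 'M[F]_n).
(* The inverse chart, given by a formula that makes sense on ambient matrices [H]. *)
pose psi (H : E) := skew_coord (mul_coord (inv_coord (Yc H)) (Zc H)).
have psiE H : psi H = skew_coord (mxcoord (cayley_inv (mx_of_coord H *m conj_tr p))).
  rewrite /psi /Yc /Zc /mul_coord /inv_coord /cayley_inv.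
  by rewrite !(mxcoordK FL, mx_of_coordD FL, mx_of_coordN FL).
(* The open set is the part of the ambient space where [psi] is continuous with values in [V]; on M
   it cuts out exactly the image of [V]. *)
exists [set H | invertible (mx_of_coord (Yc H) : 'M[F]_n) /\ V (psi H)]; split.
  rewrite openE => H [iH VH].
  have cm : (fun K : E => mul_coord K (mxcoord (conj_tr p))) @ H -->
      mul_coord H (mxcoord (conj_tr p)).
    exact: (linear_mx_continuous (mul_coord_linearl FL (mxcoord (conj_tr p)))).
  have cY : Yc @ H --> Yc H by exact: (cvgD cm (cvg_cst _)).
  have cZ : Zc @ H --> Zc H by exact: (cvgB cm (cvg_cst _)).
  have [nY ciY] := inverse_cvg FL iH cY.
  have cpsi : psi @ H --> psi H.
    exact: (linear_mx_cvg (@skew_coord_linear _ _ n) (mul_coord_cvg FL ciY cZ)).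
  have nV : \forall K \near H, V (psi K) by apply: cpsi; exact: open_nbhs_nbhs.
  by apply: filterS2 nY nV => K.
apply/seteqP; split=> [_ [v Vv <-]|H [MH [iH VH]]].
  split; first exact: chart_group.
  have E : mx_of_coord (chart p v) *m conj_tr p = cayley (X v).
    by rewrite /chart (mxcoordK FL) -mulmxA pp mulmx1.
  split.
    rewrite /Yc (mx_of_coordD FL) /mul_coord !(mxcoordK FL) -mulmxA pp mulmx1.
    by eexists; exact: (cayleyD1 FL).
  by rewrite psiE E (cayley_invK FL) // (mx_of_coordK FL) (@skew_ofK _ _ n).
exists (psi H) => //.
have MY : M (mx_of_coord H *m conj_tr p).
  by apply: (mgroupM MG); [exact: mx_of_coord_group|exact: (mgroupV MG)].
have uY := mgroup_unitary MG MY.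
have iY : invertible (mx_of_coord H *m conj_tr p + 1%:M).
  by move: iH; rewrite /Yc (mx_of_coordD FL) /mul_coord !(mxcoordK FL).
have sT := cayley_inv_skew FL uY iY.
rewrite psiE /chart /X (skew_coordK FL) ?(mxcoordK FL) // (cayley_invKV FL) //.
by rewrite -mulmxA pp' mulmx1 (mx_of_coordK FL).
Qed.

End Charts.

(** * Volume and integration on M *)

Section PositiveDefinite.
Context {R : realType}.

(* The segment from the identity to [A] avoids the zeros of the determinant. *)
Lemma det_posdef_gt0 d (A : 'M[R]_d) :
  (forall v : 'rV_d, v != 0 -> 0 < (v *m A *m v^T) 0 0) -> 0 < \det A.
Proof.
move=> Apos; pose B (t : R) := (1 - t) *: 1%:M + t *: A.
have dotE (v : 'rV[R]_d) : (v *m v^T) 0 0 = \sum_i v 0 i ^+ 2.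
  by rewrite mxE; apply: eq_bigr => i _; rewrite mxE expr2.
have Bpos (t : R) (v : 'rV[R]_d) : 0 <= t <= 1 -> v != 0 -> 0 < (v *m B t *m v^T) 0 0.
  move=> /andP[t0 t1] v0; rewrite /B mulmxDr mulmxDl -!scalemxAr -!scalemxAl mulmx1.
  rewrite [X in 0 < X]mxE [X in X + _]mxE [X in _ + X]mxE.
  have vv : 0 <= (v *m v^T) 0 0 by rewrite dotE sumr_ge0 // => i _; exact: sqr_ge0.
  have [->|tn0] := eqVneq t 0; last first.
    apply: ltr_wpDl; first by rewrite mulr_ge0 // subr_ge0.
    by rewrite mulr_gt0 ?Apos // lt0r tn0.
  rewrite subr0 mul1r mul0r addr0 lt0r vv andbT dotE psumr_eq0; last first.
    by move=> i _; exact: sqr_ge0.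
  apply: contra v0 => /allP vi; apply/eqP/rowP => i; rewrite mxE; apply/eqP.
  by rewrite -sqrf_eq0; apply: vi; rewrite mem_index_enum.
have Bn0 (t : R) : 0 <= t <= 1 -> \det (B t) != 0.
  move=> t01; apply/det0P => -[v v0 vB].
  by have := Bpos t v t01 v0; rewrite vB mul0mx mxE ltxx.
have cB : continuous (fun t : R => \det (B t)).
  move=> t; apply: det_cvg; apply: cvgD.
    by apply: cvgZr_tmp; apply: cvgB; [exact: cvg_cst|exact: cvg_id].
  by apply: cvgZr_tmp; exact: cvg_id.
rewrite ltNge; apply/negP => A0.
have B1 : B 1 = A by rewrite /B subrr scale0r add0r scale1r.
have B0 : \det (B 0) = 1 by rewrite /B subr0 scale0r addr0 scale1r det1.
have [||t /[!in_itv] /= t01 Bt] := @IVT R (fun t => \det (B t)) 0 1 0 ler01.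
- exact: continuous_subspaceT.
- by rewrite B1 B0 ge_min A0 orbT le_max ler01.
by have := Bn0 t t01; rewrite Bt eqxx.
Qed.

End PositiveDefinite.

Section IteratedIntegral.
Context {R : realType}.
Local Open Scope ereal_scope.

(** The integral of a nonnegative function is a supremum over simple functions below it, so
    monotonicity holds without measurability. This matters for the inner integrals of [lebesgue_rV],
    whose measurability is never established. *)
Lemma ge0_le_integralT d (T : measurableType d) (mu : {measure set T -> \bar R})
    (f g : T -> \bar R) : (forall x, 0 <= f x) -> (forall x, f x <= g x) ->
  \int[mu]_x f x <= \int[mu]_x g x.
Proof.
move=> f0 fg; rewrite !ge0_integralTE //; last by move=> x; exact: le_trans (fg x).
apply: le_ereal_sup => _ [h hf <-]; exists h => // x.
exact: le_trans (fg x).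
Qed.

Lemma lebesgue_rV_ge0 d (f : 'rV[R]_d -> \bar R) : (forall v, 0 <= f v) ->
  0 <= lebesgue_rV f.
Proof.
elim: d f => [|d IH] f f0 /=; first exact: f0.
by apply: integral_ge0 => x _; apply: IH => v.
Qed.

Lemma le_lebesgue_rV d (f g : 'rV[R]_d -> \bar R) :
  (forall v, 0 <= f v) -> (forall v, f v <= g v) -> lebesgue_rV f <= lebesgue_rV g.
Proof.
elim: d f g => [|d IH] f g f0 fg /=; first exact: fg.
by apply: ge0_le_integralT => x; [exact: lebesgue_rV_ge0|exact: IH].
Qed.

Definition cube d (r : R) : set 'rV[R]_d := [set v | forall i, (`|v 0%R i| < r)%R].

Lemma cube_row_mx d r (x : R) (v : 'rV[R]_d) :
  @cube d.+1 r (row_mx (x%:M : 'rV[R]_1) v : 'rV[R]_(1 + d)) <->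
  (`|x| < r)%R /\ cube r v.
Proof.
pose M : 'rV[R]_(1 + d) := row_mx (x%:M : 'rV[R]_1) v.
have Ml j : M 0%R (lshift d j) = x by rewrite /M row_mxEl ord1 mxE eqxx.
have Mr j : M 0%R (rshift 1 j) = v 0%R j by rewrite /M row_mxEr.
split=> [c|[xr vr] i].
  split=> [|i]; first by rewrite -(Ml 0%R); exact: c.
  by rewrite -(Mr i); exact: c.
rewrite -/M; case: (@split_ordP 1 d i) => j ->; first by rewrite Ml.
by rewrite Mr.
Qed.

Lemma lebesgue_rV_cube d (r c : R) : (0 < r)%R -> (0 <= c)%R ->
  lebesgue_rV (fun v : 'rV[R]_d => if v \in cube r then c%:E else 0) =
  (c * (r *+ 2) ^+ d)%:E.
Proof.
move=> r0; elim: d c => [|d IH] c c0.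
  by rewrite /= mem_set ?expr0 ?mulr1 //= => -[].
rewrite /=; pose D : set R := [set x | (`|x| < r)%R].
have DE : D = `](- r)%R, r[%classic.
  by apply/seteqP; split=> x; rewrite /D /= in_itv /= ltr_norml.
transitivity (\int[@lebesgue_measure R]_(x in D) (cst (c * (r *+ 2) ^+ d)%:E) x).
  rewrite [RHS]integral_mkcond; apply: eq_integral => x _; rewrite patchE.
  case: ifPn; rewrite ?notin_setE ?inE => xr.
    rewrite -IH //; congr lebesgue_rV; apply/funext => v; congr (if _ then _ else _).
    apply/idP/idP; rewrite !inE => h; last exact/(cube_row_mx r x v).
    by have [] := (cube_row_mx r x v).1 h.
  transitivity (lebesgue_rV (fun v : 'rV[R]_d => if v \in cube r then 0%:E else 0));
    last by rewrite IH // mul0r.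
  congr lebesgue_rV; apply/funext => v; rewrite if_same; case: ifPn => //; rewrite inE => h.
  by case: xr; exact: ((cube_row_mx r x v).1 h).1.
have muD : lebesgue_measure D = (r *+ 2)%:E.
  by rewrite DE lebesgue_measure_itv /= lte_fin gtrN // -EFinB opprK -mulr2n.
rewrite integral_cst; last by rewrite DE; exact: measurable_itv.
by transitivity ((c * (r *+ 2) ^+ d)%:E * lebesgue_measure D); rewrite // muD -EFinM exprSr mulrA.
Qed.

End IteratedIntegral.

Lemma linear_row_sum (R : realType) (W : normedModType R) d (L : 'rV[R]_d -> W) w :
  linear L -> L w = \sum_i w 0 i *: L 'e_i.
Proof. by move=> lL; rewrite (linear_mx_sum w lL) big_ord1. Qed.

Section InnerCalculus.
Context {R : realType} {F : scalars R} {emb : R -> F} (FL : scalar_laws emb).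
Variables m n : nat.
Local Notation E := 'M[R]_(m * n, scalar_dim F).

Definition inner_form (V W : E) : R^o :=
  inner (mx_of_coord V : 'M[F]_(m, n)) (mx_of_coord W).

Lemma inner_form_linearl W : linear (inner_form^~ W).
Proof.
by move=> a U V; rewrite /inner_form (mx_of_coordD FL) (mx_of_coordZ FL)
  (innerDl FL) (innerZl FL).
Qed.

Lemma inner_form_linearr V : linear (inner_form V).
Proof.
by move=> a U W; rewrite /inner_form (mx_of_coordD FL) (mx_of_coordZ FL)
  (innerDr FL) (innerZr FL).
Qed.

Lemma inner_form_cvg T (Fl : set_system T) {FF : Filter Fl} (f g : T -> E) x y :
  f @ Fl --> x -> g @ Fl --> y ->
  (fun t => inner_form (f t) (g t)) @ Fl --> inner_form x y.
Proof. exact: bilinear_mx_cvg inner_form_linearl inner_form_linearr. Qed.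

Lemma Ck_on_inner_form (V : normedModType R) k (U : set V) (f g : V -> E) :
  open U -> Ck_on k U f -> Ck_on k U g -> Ck_on k U (fun x => inner_form (f x) (g x)).
Proof.
by move=> oU; exact: Ck_on_bilinear oU inner_form_linearl inner_form_linearr.
Qed.

Lemma inner_sumr I (r : seq I) (A : 'M[F]_(m, n)) (B : I -> 'M[F]_(m, n)) :
  inner A (\sum_(i <- r) B i) = \sum_(i <- r) inner A (B i).
Proof.
elim: r => [|i r IH]; last by rewrite !big_cons (innerDr FL) IH.
by rewrite !big_nil /inner mulmx0 /retr mxtrace0 (sre0 FL).
Qed.

Lemma inner_suml I (r : seq I) (A : I -> 'M[F]_(m, n)) (B : 'M[F]_(m, n)) :
  inner (\sum_(i <- r) A i) B = \sum_(i <- r) inner (A i) B.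
Proof. by rewrite (innerC FL) inner_sumr; apply: eq_bigr => i _; rewrite (innerC FL). Qed.

End InnerCalculus.

Section ChartGram.
Context {R : realType} {F : scalars R} {emb : R -> F} (FL : scalar_laws emb).

Lemma mx_of_coord_sumZ m p I (r : seq I) (a : I -> R) (V : I -> 'M[R]_(m * p, scalar_dim F)) :
  mx_of_coord (\sum_(i <- r) a i *: V i) =
  \sum_(i <- r) emb (a i) *: mx_of_coord (V i) :> 'M[F]_(m, p).
Proof.
elim: r => [|i r IH]; first by rewrite !big_nil (mx_of_coord0 FL).
by rewrite !big_cons (mx_of_coordD FL) (mx_of_coordZ FL) IH.
Qed.

Variables (n : nat) (M : set 'M[F]_n).
Hypothesis MG : matrix_group M.
Local Notation E := 'M[R]_(n * n, scalar_dim F).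
Let Mc := [set mxcoord A | A in M] : set E.

(** Solving [chart_derive] for the derivative gives an explicit expression, linear in the direction
    [w]; directional derivatives alone carry no such linearity. *)
Lemma chart_derive_linear p v : M p -> linear (fun w => 'D_w (@chart R F n p) v).
Proof.
move=> Mp; have [pp pp'] := mgroup_unitary MG Mp.
have iX := inverse_mxP (skew_den_invertible FL (skew_of_skew FL v)).
set X := mx_of_coord (skew_of v) in iX.
suff h (L : 'rV[R]_(@skew_dim R F n) -> E) : (forall u, mx_of_coord (L u) =
    (cayley X + 1%:M) *m mx_of_coord (skew_of u) *m inverse_mx (1%:M - X) *m p) -> linear L.
  apply: h => u; rewrite -(chart_derive FL MG v u Mp) -[_ *m inverse_mx _]mulmxA iX.1.
  by rewrite mulmx1 -mulmxA pp' mulmx1.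
move: (cayley X + 1%:M) => C LE a w w'; apply: (can_inj (mx_of_coordK FL (p := n))).
rewrite (mx_of_coordD FL) (mx_of_coordZ FL) !LE (@skew_of_linear _ _ n).
rewrite (mx_of_coordD FL) (mx_of_coordZ FL) mulmxDr (scale_emb_mulmxr FL).
by rewrite !mulmxDl -!scalemxAl.
Qed.

(** The quadratic form of the Gram matrix at [w] is the squared norm of [L w], positive by
    injectivity. *)
Lemma gram_linear_gt0 d (L : 'rV[R]_d -> E) : linear L ->
  (forall w, L w = 0 -> w = 0) ->
  0 < \det (\matrix_(i, j) inner_form (m := n) (n := n) (L 'e_i) (L 'e_j) : 'M[R]_d).
Proof.
move=> lL Linj; apply: det_posdef_gt0 => w w0.
pose D u : 'M[F]_n := mx_of_coord (L u).
have DE : D w = \sum_i emb (w 0 i) *: D 'e_i.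
  by rewrite /D (linear_row_sum w lL) mx_of_coord_sumZ.
set A := \matrix_(i, j) _; have -> : (w *m A *m w^T) 0 0 = inner (D w) (D w).
  rewrite [in RHS]DE (inner_sumr FL) mxE; apply: eq_bigr => j _.
  rewrite (innerZr FL) -DE {1}DE (inner_suml FL) mulrC !mxE; congr (_ * _).
  by apply: eq_bigr => i _; rewrite (innerZl FL) mxE.
rewrite lt0r (inner_ge0 FL) andbT; apply: contra w0 => /eqP /(inner_eq0 FL) Dw.
apply/eqP/Linj; apply: (can_inj (mx_of_coordK FL (p := n))).
by rewrite -/(D w) Dw (mx_of_coord0 FL).
Qed.

Lemma gram_chart_gt0 p v : M p ->
  0 < \det (gram (trace_metric (F := F) (n := n)) (chart p) v).
Proof.
move=> Mp; apply: (gram_linear_gt0 (chart_derive_linear v Mp)) => w.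
exact: (chart_immersion FL MG Mp).
Qed.

Lemma det_inner_form_cvg (V : topologicalType) d (g : V -> 'M[R]_d) (D : 'I_d -> V -> E) v :
  (forall u i j, g u i j = inner_form (m := n) (n := n) (D i u) (D j u)) ->
  (forall i, D i @ v --> D i v) -> (fun u => \det (g u)) @ v --> \det (g v).
Proof.
move=> gE cD; apply: (det_cvg (Fl := nbhs v)); apply: mx_cvg => i j.
have h : (fun t => inner_form (m := n) (n := n) (D i t) (D j t)) @ v --> g v i j.
  by rewrite gE; exact: (inner_form_cvg FL (cD i) (cD j)).
apply: cvg_trans h; apply: near_eq_cvg.
by apply: nearW => u; rewrite gE.
Qed.

Lemma gram_chart_continuous p : continuous
  (fun v => Num.sqrt (\det (gram (trace_metric (F := F) (n := n)) (chart p) v))).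
Proof.
move=> v; set g := gram _ (chart p).
suff gv : (fun u => \det (g u)) @ v --> \det (g v).
  exact: (cvg_comp _ _ gv (@sqrt_continuous _ (\det (g v)))).
apply: (@det_inner_form_cvg _ _ g (fun i u => 'D_'e_i (chart p) u)).
  by move=> u i j; apply: mxE.
move=> i.
exact: (Ck_on_continuous (Ck_on_derive ('e_i) ((chart_smooth FL p).2 1%N)) I).
Qed.

End ChartGram.

Lemma cube_ball (R : realType) d (r : R) : 0 < r -> @cube R d r = ball (0 : 'rV[R]_d) r.
Proof.
move=> r0; apply/seteqP; split=> [v vr|v [_ vr] i].
  by split=> // i j; rewrite ord1 mxE /ball /= sub0r normrN.
by have := vr 0 i; rewrite mxE /ball /= sub0r normrN.
Qed.

Lemma open_cube (R : realType) d (r : R) : 0 < r -> open (@cube R d r).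
Proof. by move=> r0; rewrite cube_ball //; exact: ball_open. Qed.

Lemma cube_nbhs (R : realType) d (P : set 'rV[R]_d) : nbhs (0 : 'rV[R]_d) P ->
  exists2 r : R, 0 < r & cube r `<=` P.
Proof.
by move=> /nbhs_ballP [r /= r0 rP]; exists r => //; rewrite cube_ball.
Qed.

Section GroupVolume.
Context {R : realType} {F : scalars R} {emb : R -> F} (FL : scalar_laws emb).
Variables (n : nat) (M : set 'M[F]_n).
Hypothesis MG : matrix_group M.
Local Notation E := 'M[R]_(n * n, scalar_dim F).
Let Mc := [set mxcoord A | A in M] : set E.
Local Notation tm := (trace_metric (F := F) (n := n)).

Lemma borel_open (A : set E) : open A -> measurable (A : set (borel E)).
Proof. exact: sub_sigma_algebra. Qed.

Lemma group_mx_closed : closed Mc.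
Proof. exact: (mgroup_closed MG). Qed.

Lemma borel_group : measurable (Mc : set (borel E)).
Proof.
rewrite -[Mc]setCK; apply: measurableC; apply: borel_open.
by rewrite openC; exact: group_mx_closed.
Qed.

(** All elements of M have the same squared norm, the real trace of the identity, so M is bounded as
    well as closed. *)
Lemma compact_group : compact Mc.
Proof.
have vec_cont : continuous (vec_mx : 'rV[R]_(n * n * scalar_dim F) -> E).
  by apply: linear_mx_continuous; exact: linearP.
have -> : Mc = vec_mx @` [set v | Mc (vec_mx v)].
  apply/seteqP; split=> [V MV|_ [v Mv <-]//].
  by exists (mxvec V); rewrite /= mxvecK.
apply: continuous_compact; first exact: continuous_subspaceT.
apply: bounded_closed_compact; last first.
  by apply: (@preimage_closed _ _ vec_mx) => //; exact: group_mx_closed.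
pose c : R := retr (1%:M : 'M[F]_n).
(* Coordinates satisfy x^2 <= c, and c <= (c + 1)^2, so [c + 1] bounds them without taking a square
   root. *)
exists (c + 1); split; first exact: num_real.
move=> N cN v [A MA vA]; rewrite /= [leLHS]/Num.norm /= mx_normrE.
have [_ AA] := mgroup_unitary MG MA.
have c0 : 0 <= c by rewrite /c -AA; exact: (inner_ge0 FL).
apply/bigmax_leP; split=> [|[i k] _ /=]; first by rewrite (le_trans _ (ltW cN)) ?addr_ge0.
apply: le_trans (ltW cN); rewrite ord1 -[v]vec_mxK -vA.
case/mxvec_indexP: k => k l; rewrite mxvecE mxE; case/mxvec_indexP: k => k j.
rewrite mxvecE; set x := scalar_coord _ _ _.
have xc : x ^+ 2 <= c by rewrite /c -AA; exact: (sqr_coord_le_inner FL).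
rewrite -ler_sqr ?nnegrE ?addr_ge0 // real_normK ?num_real // (le_trans xc) //.
by nra.
Qed.

(* On a small cube the density [sqrt (det gram)] is within a factor 2 of its
   value at the centre. *)
Lemma group_piece (mu : {measure set (borel E) -> \bar R}) p :
  riemannian_volume Mc tm mu -> M p ->
  exists W : set E, exists V : set 'rV[R]_(@skew_dim R F n),
    [/\ open W, W (mxcoord p), open V, chart p @` V = Mc `&` W &
     (0 < mu (Mc `&` W) < +oo)%E].
Proof.
move=> hmu Mp; have pP := chart_parametrization FL MG Mp.
pose s v := Num.sqrt (\det (gram tm (@chart R F n p) v)).
have s0 : 0 < s 0 by rewrite sqrtr_gt0 (gram_chart_gt0 FL MG).
have cs : s @ (0 : 'rV[R]_(@skew_dim R F n)) --> s 0.
  exact: (gram_chart_continuous FL).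
have ns : \forall v \near (0 : 'rV[R]_(@skew_dim R F n)), s 0 / 2 <= s v <= s 0 * 2.
  have h1 : \forall v \near (0 : 'rV[R]_(@skew_dim R F n)), s 0 / 2 < s v.
    by apply: (cvgr_gt _ cs); rewrite ltr_pdivrMr // ltr_pMr // ltr1n.
  have h2 : \forall v \near (0 : 'rV[R]_(@skew_dim R F n)), s v < s 0 * 2.
    by apply: (cvgr_lt _ cs); rewrite ltr_pMr // ltr1n.
  by apply: filterS2 h1 h2 => v /ltW -> /ltW ->.
have [r r0 rs] := cube_nbhs ns.
have [_ _ _ _ /(_ _ (open_cube r0) (@subsetT _ _)) [W [oW cW]]] := pP.
exists W, (cube r); split=> //.
- have : (chart p @` cube r) (mxcoord p).
    exists 0; first by move=> i; rewrite mxE normr0.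
    rewrite /chart (linear0f (@skew_of_linear _ _ n)) (mx_of_coord0 FL) /cayley.
    rewrite addr0 subr0 (@inverse_mxE _ _ n 1%:M 1%:M) ?mulmx1 ?mul1mx //.
    by split; rewrite mulmx1.
  by rewrite cW => -[].
- exact: open_cube.
have mW : measurable (Mc `&` W : set (borel E)).
  by apply: measurableI; [exact: borel_group|exact: borel_open].
have muW : mu (Mc `&` W) = lebesgue_rV (fun v : 'rV[R]_(@skew_dim R F n) =>
    if v \in cube r then (s v)%:E else 0%E).
  rewrite (hmu _ _ _ pP) //; last by rewrite -cW => _ [v _ <-]; exists v.
  congr lebesgue_rV; apply/funext => v; rewrite patchE; congr (if _ then _ else _).
  apply/idP/idP; rewrite !inE setTI -cW.
    by move=> [w wr /(chart_inj FL MG Mp) <-].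
  by move=> vr; exists v.
have s_ge0 v : 0 <= s v by exact: sqrtr_ge0.
clearbody s.
have d0 : 0 < (r *+ 2) ^+ (@skew_dim R F n) by rewrite exprn_gt0 // mulrn_wgt0.
apply/andP; split.
  apply: (@lt_le_trans _ _ (lebesgue_rV (fun v : 'rV[R]_(@skew_dim R F n) =>
      if v \in cube r then (s 0 / 2)%:E else 0%E))).
    rewrite lebesgue_rV_cube // ?lte_fin ?mulr_gt0 // ?divr_gt0 //.
    by rewrite divr_ge0 // ltW.
  rewrite muW; apply: le_lebesgue_rV => v; case: ifPn => //; rewrite ?inE => vr; rewrite lee_fin.
    by rewrite divr_ge0 // ltW.
  by have /andP[] := rs v vr.
apply: (@le_lt_trans _ _ (lebesgue_rV (fun v : 'rV[R]_(@skew_dim R F n) =>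
    if v \in cube r then (s 0 * 2)%:E else 0%E))).
  rewrite muW; apply: le_lebesgue_rV => v; case: ifPn => //; rewrite ?inE => vr; rewrite lee_fin.
    exact: s_ge0.
  by have /andP[] := rs v vr.
by rewrite lebesgue_rV_cube ?ltry // mulr_ge0 // ltW.
Qed.

Lemma eq_restrict_on (aT : Type) (rT : pointedType) (A : set aT) (f g : aT -> rT) :
  (forall x, A x -> f x = g x) -> f \_ A = g \_ A.
Proof.
by move=> fg; apply/funext => x; rewrite !patchE; case: ifPn => //; rewrite inE; exact: fg.
Qed.

Section Isometry.
Variables L L' : E -> E.
Hypotheses (lL : linear L) (lL' : linear L').
Hypotheses (LK : cancel L L') (LK' : cancel L' L).
Hypotheses (LM : forall V, Mc V -> Mc (L V)) (LM' : forall V, Mc V -> Mc (L' V)).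
Hypothesis isoL' : forall p q X Y, tm p (L' X) (L' Y) = tm q X Y.

Let cL : continuous L. Proof. exact: linear_mx_continuous. Qed.
Let cL' : continuous L'. Proof. exact: linear_mx_continuous. Qed.

Lemma isometry_parametrization d (U : set 'rV[R]_d) (phi : 'rV[R]_d -> E) :
  parametrization Mc U phi -> parametrization Mc U (L' \o phi).
Proof.
move=> [[oU sphi] phiM phi_inj phi_imm phi_open]; split.
- by split=> // k; apply: Ck_on_linear.
- by move=> x Ux; apply: LM'; exact: phiM.
- by move=> x y Ux Uy /(can_inj LK'); exact: phi_inj.
- move=> x v Ux.
  have [_ ->] := is_derive_linear lL' cL' (Ck_on_is_derive v (sphi 1%N) Ux).
  rewrite -[RHS](linear0f lL') => /(can_inj LK'); exact: phi_imm.
- move=> V oV VU; have [W [oW WE]] := phi_open V oV VU.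
  exists (L @^-1` W); split; first by apply: open_comp => // x _; exact: cL.
  apply/seteqP; split=> [_ [v Vv <-]|H [MH WH]].
    have : (phi @` V) (phi v) by exists v.
    by rewrite WE => -[MP WP]; split; [exact: LM'|rewrite /= LK'].
  have : (Mc `&` W) (L H) by split=> //; exact: LM.
  by rewrite -WE => -[v Vv vH]; exists v => //=; rewrite vH LK.
Qed.

Lemma borel_measurable_linear : measurable_fun setT (L : borel E -> borel E).
Proof.
move=> _; apply: (@measurability _ _ (borel E) (borel E) setT L (@open E)) => //.
move=> _ [B oB <-]; rewrite setTI; apply: borel_open.
by apply: open_comp => // x _; exact: cL.
Qed.

Variable mu : {measure set (borel E) -> \bar R}.
Hypothesis hmu : riemannian_volume Mc tm mu.

Lemma measurable_preimage_isometry (B : set (borel E)) : measurable B ->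
  measurable (L @^-1` B : set (borel E)).
Proof. by move=> mB; rewrite -[_ @^-1` _]setTI; exact: borel_measurable_linear. Qed.

(* [phi] and [L' \o phi] have the same Gram matrices, and they parametrize [B]
   and [L @^-1` B] over the same domain. *)
Lemma volume_isometry_chart d (U : set 'rV[R]_d) (phi : 'rV[R]_d -> E) (B : set (borel E)) :
  parametrization Mc U phi -> measurable B -> B `<=` phi @` U ->
  mu (L @^-1` B) = mu B.
Proof.
move=> pphi mB BU; have [[_ sphi] _ _ _ _] := pphi.
have B'U : L @^-1` B `<=` (L' \o phi) @` U.
  by move=> V /BU [v Uv vV]; exists v => //=; rewrite vV LK.
have mB' := measurable_preimage_isometry mB.
rewrite (hmu (isometry_parametrization pphi) mB' B'U) (hmu pphi mB BU).
apply: congr1.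
have -> : (L' \o phi) @^-1` (L @^-1` B) = phi @^-1` B.
  by apply/seteqP; split=> w; rewrite /= LK'.
apply: eq_restrict_on => v [Uv _].
have D w : 'D_w (L' \o phi) v = L' ('D_w phi v).
  by have [_ ->] := is_derive_linear lL' cL' (Ck_on_is_derive w (sphi 1%N) Uv).
suff -> : gram tm (L' \o phi) v = gram tm phi v by [].
apply/matrixP => i j; rewrite mxE [RHS]mxE (D 'e_i) (D 'e_j).
exact: isoL'.
Qed.

(** A piece of M on which the chart formula determines [mu] and on which [mu] is finite. *)
Definition small_piece (W : set E) : Prop :=
  [/\ open W, exists2 p, M p & Mc `&` W `<=` chart p @` setT &
      (mu (Mc `&` W) < +oo)%E].

(** Induction on the cover: the part of [B] in the first piece lies in one chart image, and the rest
    is covered by the remaining pieces. Finiteness is carried along because it comes from the same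
    decomposition. *)
Lemma volume_isometry_pieces (s : seq (set E)) (B : set (borel E)) :
  (forall W, W \in s -> small_piece W) -> measurable B -> B `<=` Mc ->
  B `<=` [set V | exists2 W, W \in s & W V] ->
  (mu B < +oo)%E /\ mu (L @^-1` B) = mu B.
Proof.
elim: s B => [|W s IH] B sP mB BM Bs.
  have -> : B = set0 by apply/seteqP; split=> // V /Bs [].
  by rewrite preimage_set0 measure0.
have [oW [p Mp Wp] fW] := sP W (mem_head _ _).
have mW : measurable (W : set (borel E)) by exact: borel_open.
have [||||fD eD] := IH (B `\` W).
- by move=> W' W's; apply: sP; rewrite inE W's orbT.
- exact: measurableD.
- by move=> V [/BM].
- move=> V [/Bs [W' + W'V] nW]; rewrite inE => /orP[/eqP W'W|W's].
    by rewrite -W'W in nW.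
  by exists W'.
have mBW : measurable (B `&` W) by exact: measurableI.
have BWM : B `&` W `<=` Mc `&` W by move=> V [/BM].
have eI := volume_isometry_chart (chart_parametrization FL MG Mp) mBW (subset_trans BWM Wp).
split; rewrite (measureDI mu mB mW).
  apply: lte_add_pinfty => //; apply: le_lt_trans fW; apply: le_measure => //.
  - by rewrite inE.
  - by rewrite inE; apply: measurableI => //; exact: borel_group.
transitivity (mu (L @^-1` (B `\` W)) + mu (L @^-1` (B `&` W)))%E.
  exact: (measureDI mu (measurable_preimage_isometry mB) (measurable_preimage_isometry mW)).
by congr (_ + _)%E.
Qed.

Lemma group_cover : exists2 s : seq (set E), (forall W, W \in s -> small_piece W) &
  Mc `<=` [set V | exists2 W, W \in s & W V].
Proof.
(* The statement is made vacuous off M so that [choice] yields a function on the whole space. *)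
have pieces V : exists W, Mc V -> W V /\ small_piece W.
  have [[A MA <-]|nV] := pselect (Mc V); last by exists set0.
  have [W [V' [oW WA oV' VW /andP[_ fW]]]] := group_piece hmu MA.
  exists W => _; split=> //; split=> //; exists A => //.
  by rewrite -VW => _ [v _ <-]; exists v.
have [f fP] := choice pieces.
have := compact_group; rewrite compact_cover => /(_ _ Mc f) [].
- by move=> V /fP [_ []].
- by move=> V MV; exists V => //; have [] := fP V MV.
move=> D DM MD; exists [seq (f V : set E) | V <- finmap.enum_fset D].
  by move=> _ /mapP [V VD ->]; have /DM := VD; rewrite inE => /fP [].
move=> V /MD [V' V'D fV]; exists (f V') => //.
by apply/mapP; exists V'.
Qed.

Lemma group_volume_fin : (mu Mc < +oo)%E.
Proof.
have [s sP sc] := group_cover.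
by have [] := volume_isometry_pieces sP borel_group (@subset_refl _ _) sc.
Qed.

Lemma volume_isometry (B : set (borel E)) : measurable B -> B `<=` Mc ->
  mu (L @^-1` B) = mu B.
Proof.
move=> mB BM; have [s sP sc] := group_cover.
by have [] := volume_isometry_pieces sP mB BM (subset_trans BM sc).
Qed.

End Isometry.
End GroupVolume.

Section GroupIntegral.
Context {R : realType} {F : scalars R} {emb : R -> F} (FL : scalar_laws emb).
Variables (n : nat) (M : set 'M[F]_n).
Hypothesis MG : matrix_group M.
Local Notation E := 'M[R]_(n * n, scalar_dim F).
Let Mc := [set mxcoord A | A in M] : set E.
Local Notation tm := (trace_metric (F := F) (n := n)).
Variable mu : {measure set (borel E) -> \bar R}.
Hypothesis hmu : riemannian_volume Mc tm mu.

(** Continuity at the points of [D] puts them in the interior of the preimage of any open interval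
    containing their value, so on [D] this preimage is the trace of an open set. *)
Lemma continuous_at_measurable (D : set (borel E)) (f : E -> R) : measurable D ->
  (forall x, D x -> {for (x : E), continuous f}) ->
  measurable_fun D (f : borel E -> R).
Proof.
move=> mD cf _; apply: (measurability _ (measurable_realfun.RGenOpens.measurableE R)) => //.
move=> _ [_ [a [b ->] <-]].
rewrite (_ : D `&` f @^-1` _ = D `&` interior (f @^-1` `]a, b[%classic : set E)).
  by apply: measurableI => //; apply: borel_open; exact: open_interior.
apply/seteqP; split=> x [Dx fx]; split=> //; last exact: interior_subset fx.
by apply: (cf x Dx); apply: open_nbhs_nbhs; split => //; exact: interval_open.
Qed.

Let id_linear : linear (@idfun E). Proof. by []. Qed.

(** Finiteness was obtained in the setting of a linear isometry of M; the identity is taken as that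
    isometry. *)
Lemma group_volume_lty : (mu Mc < +oo)%E.
Proof.
by apply: (group_volume_fin FL MG id_linear id_linear _ _ _ _ _ hmu).
Qed.

Lemma group_volume_gt0 : 0 < fine (mu Mc).
Proof.
have [W [V [oW _ _ _ /andP[W0 _]]]] := group_piece FL MG hmu (mgroup1 MG).
apply: fine_gt0; rewrite group_volume_lty andbT (lt_le_trans W0) //.
apply: le_measure => //; rewrite ?inE; last exact: borel_group.
by apply: measurableI; [exact: borel_group|exact: borel_open].
Qed.

(** A function continuous at every point of the compact set M is bounded there, and M has finite
    volume. *)
Lemma group_integrable (f : E -> R) : (forall x, Mc x -> {for x, continuous f}) ->
  mu.-integrable Mc (EFin \o f).
Proof.
move=> cf; apply: measurable_bounded_integrable.
- exact: borel_group.
- exact: group_volume_lty.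
- by apply: continuous_at_measurable => //; exact: borel_group.
have : compact (f @` Mc : set R^o).
  apply: continuous_compact; last exact: (compact_group FL MG).
  by apply: continuous_in_subspaceT => x; rewrite inE; exact: cf.
move/compact_bounded => [N [rN bN]]; exists N; split=> // K NK x Mx.
by apply: bN => //; exists x.
Qed.

Lemma Rintegral_group_cst c : \int[mu]_(_ in (Mc : set (borel E))) c = c * fine (mu Mc).
Proof. by rewrite Rintegral_cst //; exact: borel_group. Qed.

Section Translation.
Variables L L' : E -> E.
Hypotheses (lL : linear L) (lL' : linear L').
Hypotheses (LK : cancel L L') (LK' : cancel L' L).
Hypotheses (LM : forall V, Mc V -> Mc (L V)) (LM' : forall V, Mc V -> Mc (L' V)).
Hypothesis isoL' : forall p q X Y, tm p (L' X) (L' Y) = tm q X Y.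

(** By [volume_isometry] the push-forward of [mu] under [L] agrees with [mu] on measurable subsets
    of M, so both give the same integral over M. *)
Lemma Rintegral_isometry (f : E -> R) : (forall x, Mc x -> {for x, continuous f}) ->
  \int[mu]_(x in (Mc : set (borel E))) f (L x) =
  \int[mu]_(x in (Mc : set (borel E))) f x.
Proof.
move=> cf; have mL := borel_measurable_linear lL.
pose Lp := HB.pack_for {mfun borel E >-> borel E} (L : borel E -> borel E)
  (isMeasurableFun.Build _ _ (borel E) (borel E) _ mL).
have mM : measurable (Mc : set (borel E)) by exact: borel_group.
have LMc : L @^-1` Mc = Mc.
  by apply/seteqP; split=> V; [move=> /LM' /=; rewrite LK|exact: LM].
(* Extension by 0 off M makes the integrand measurable on the whole space, as the push-forward
   formula requires. *)
pose g : borel E -> R := f \_ Mc.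
have gE x : Mc x -> g x = f x by move=> Mx; rewrite /g patchE mem_set.
pose ge : borel E -> \bar R := fun x => (g x)%:E.
have mg : measurable_fun (setT : set (borel E)) ge.
  apply/measurable_EFinP/(measurable_restrictT _ mM).
  exact: continuous_at_measurable.
have cL : continuous L by exact: linear_mx_continuous.
have cfL x : Mc x -> {for x, continuous (f \o L)}.
  by move=> Mx; apply: continuous_comp; [exact: cL|apply: cf; exact: LM].
rewrite /Rintegral; congr fine.
pose geL : borel E -> \bar R := fun x => ge (L x).
transitivity (\int[mu]_(x in (L @^-1` Mc : set (borel E))) geL x)%E.
  rewrite LMc; apply: eq_integral => x; rewrite inE => Mx.
  by rewrite /geL /ge gE //; exact: LM.
have intg : mu.-integrable (L @^-1` Mc : set (borel E)) geL.
  rewrite LMc; apply: eq_integrable (group_integrable cfL) => // x.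
  by rewrite inE => Mx /=; rewrite /geL /ge gE //; exact: LM.
transitivity (\int[pushforward mu Lp]_(x in (Mc : set (borel E))) ge x)%E.
  by rewrite (integral_pushforward (phi := Lp) mL mg intg).
transitivity (\int[mu]_(x in (Mc : set (borel E))) ge x)%E; last first.
  by apply: eq_integral => x; rewrite inE => Mx; rewrite /ge gE.
apply: eq_measure_integral => A mA AM.
exact: (volume_isometry FL MG lL lL' LK LK' LM LM' isoL' hmu).
Qed.

End Translation.
End GroupIntegral.

(** * K as a subset of G *)

Section BlockDiagonal.
Context {R : realType} {F : scalars R} {emb : R -> F} (FL : scalar_laws emb).
Variable n : nat.
Implicit Types (u v : 'M[F]_n) (g : 'M[F]_(n + n)).

Lemma unitaryM u v : unitary_set u -> unitary_set v -> unitary_set (u *m v).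
Proof. by rewrite /unitary_set /= (conj_trM FL); exact: is_inverseM. Qed.

Lemma unitaryV u : unitary_set u -> unitary_set (conj_tr u).
Proof. by rewrite /unitary_set /= (conj_trK FL) => -[]. Qed.

Lemma unitary1 : unitary_set (1%:M : 'M[F]_n).
Proof. by rewrite /unitary_set /= (conj_tr1 FL); split; rewrite mulmx1. Qed.

Lemma mul_block_diag (a b c d : 'M[F]_n) :
  block_mx a 0 0 b *m block_mx c 0 0 d = block_mx (a *m c) 0 0 (b *m d).
Proof. by rewrite mulmx_block !mul0mx !mulmx0 !addr0 !add0r. Qed.

Lemma block_diag_inverse u v : unitary_set u -> unitary_set v ->
  is_inverse (block_mx u 0 0 v) (block_mx (conj_tr u) 0 0 (conj_tr v)).
Proof.
by move=> [uu uu'] [vv vv']; split; rewrite mul_block_diag ?uu ?uu' ?vv ?vv' -scalar_mx_block.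
Qed.

Lemma block_diag_indefinite u v : unitary_set u -> unitary_set v ->
  indefinite_unitary_set (block_mx u 0 0 v : 'M[F]_(n + n)).
Proof.
move=> uU vU; split; first by eexists; exact: block_diag_inverse.
have bE (x : 'cV[F]_(n + n)) : block_mx u 0 0 v *m x =
    col_mx (u *m usubmx x) (v *m dsubmx x).
  by rewrite -{1}[x]vsubmxK mul_block_col !mul0mx addr0 add0r.
move=> x y; rewrite !bE /form_b !col_mxKu !col_mxKd !(conj_trM FL).
by rewrite -!mulmxA (mulmxA _ u) (mulmxA _ v) uU.2 vU.2 !mul1mx.
Qed.

Lemma indefinite_unitaryM g1 g2 : indefinite_unitary_set g1 ->
  indefinite_unitary_set g2 -> indefinite_unitary_set (g1 *m g2).
Proof.
move=> [[h1 i1] f1] [[h2 i2] f2]; split; first by eexists; exact: is_inverseM i1 i2.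
by move=> x y; rewrite -!mulmxA f1 f2.
Qed.

End BlockDiagonal.

(** * Reflections and the connectedness of the special orthogonal group *)

Section Reflections.
Context {R : realType} {n : nat}.
Implicit Types (w x y : 'cV[R]_n) (A : 'M[R]_n).

Definition dotv x y : R := (x^T *m y) 0 0.

Lemma dotvE x y : dotv x y = \sum_i x i 0 * y i 0.
Proof. by rewrite /dotv mxE; apply: eq_bigr => i _; rewrite mxE. Qed.

Lemma dotvC x y : dotv x y = dotv y x.
Proof. by rewrite !dotvE; apply: eq_bigr => i _; rewrite mulrC. Qed.

Lemma dotvBr x y w : dotv x (y - w) = dotv x y - dotv x w.
Proof. by rewrite /dotv mulmxBr !mxE. Qed.

Lemma dotvBl x y w : dotv (y - w) x = dotv y x - dotv w x.
Proof. by rewrite dotvC dotvBr !(dotvC x). Qed.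

Lemma dotv_eq0 x : (dotv x x == 0) = (x == 0).
Proof.
apply/eqP/eqP => [|->]; last by rewrite /dotv mulmx0 mxE.
rewrite dotvE => /eqP; rewrite psumr_eq0 => [/allP xi|i _]; last by rewrite -expr2 sqr_ge0.
apply/colP => i; rewrite mxE; have := xi i (mem_index_enum _).
by rewrite /= mulf_eq0 orbb => /eqP.
Qed.

Definition reflection w : 'M[R]_n := 1%:M - (2 / dotv w w) *: (w *m w^T).

Lemma reflection_mul w x : reflection w *m x = x - (2 / dotv w w * dotv w x) *: w.
Proof.
rewrite /reflection mulmxBl mul1mx -scalemxAl -mulmxA; congr (_ - _).
by rewrite [w^T *m x]mx11_scalar mul_mx_scalar scalerA.
Qed.

Lemma reflection_tr w : (reflection w)^T = reflection w.
Proof. by rewrite /reflection linearB /= linearZ /= trmx_mul trmxK trmx1. Qed.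

Lemma reflectionK w : w != 0 -> reflection w *m reflection w = 1%:M.
Proof.
rewrite -dotv_eq0 => w0; rewrite {2}/reflection mulmxBr mulmx1 -scalemxAr mulmxA.
rewrite reflection_mul divfK // /reflection.
by rewrite scaler_nat mulr2n opprD addrA subrr add0r mulNmx scalerN opprK subrK.
Qed.

(** The bordered matrix with rows (1, u) and (v, 1) has two block triangular factorizations, one
    through each Schur complement; their determinants are compared. *)
Lemma det_rank1_update (u : 'cV[R]_n) (v : 'rV[R]_n) :
  \det (1%:M - u *m v) = 1 - (v *m u) 0 0.
Proof.
pose A : 'M[R]_(n + 1) := block_mx 1%:M u v 1%:M.
have E1 : A = block_mx 1%:M 0 v 1%:M *m block_mx 1%:M u 0 (1%:M - v *m u).
  by rewrite mulmx_block !(mul1mx, mulmx1, mul0mx, addr0) [v *m u + _]addrC subrK.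
have E2 : A = block_mx 1%:M u 0 1%:M *m block_mx (1%:M - u *m v) 0 v 1%:M.
  by rewrite mulmx_block !(mul1mx, mulmx1, mul0mx, add0r) subrK.
have := congr1 (fun B => \det B) E1; rewrite {1}E2 !det_mulmx !det_ublock !det_lblock.
by rewrite !det1 !mul1r !mulr1 => ->; rewrite det_mx11 !mxE eqxx.
Qed.

Lemma det_reflection w : w != 0 -> \det (reflection w) = -1.
Proof.
rewrite -dotv_eq0 => w0; rewrite /reflection scalemxAl det_rank1_update -scalemxAr.
by rewrite mxE -/(dotv w w) divfK // opprD addrA subrr add0r.
Qed.

Lemma reflection_scale (c : R) w : c != 0 -> reflection (c *: w) = reflection w.
Proof.
move=> c0; rewrite /reflection; congr (_ - _).
have -> : dotv (c *: w) (c *: w) = c * c * dotv w w.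
  by rewrite !dotvE mulr_sumr; apply: eq_bigr => i _; rewrite !mxE; ring.
rewrite [(c *: w)^T]linearZ /= -scalemxAl -scalemxAr !scalerA.
have [->|] := eqVneq w 0; first by rewrite mul0mx !scaler0.
by rewrite -dotv_eq0 => w0; congr (_ *: _); field; rewrite w0 c0.
Qed.

Definition word (s : seq 'cV[R]_n) : 'M[R]_n := foldr (fun w A => reflection w *m A) 1%:M s.

Lemma word_rcons s w : word (rcons s w) = word s *m reflection w.
Proof. by elim: s => [|x s IH] /=; rewrite ?mul1mx ?mulmx1 // IH mulmxA. Qed.

Lemma det_word s : all (fun w => w != 0) s -> \det (word s) = (-1) ^+ size s.
Proof.
elim: s => [|w s IH] /=; first by rewrite det1.
by move=> /andP[w0 s0]; rewrite det_mulmx det_reflection // IH // exprS.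
Qed.

(* Cartan-Dieudonne: if [A] fixes the first [k] basis vectors, reflecting along
   [A e_k - e_k] makes it fix the next one as well. *)
Lemma orthogonal_word A k : A^T *m A = 1%:M -> (k <= n)%N ->
  exists s B, [/\ all (fun w => w != 0) s, A = word s *m B, B^T *m B = 1%:M &
    forall j : 'I_n, (j < k)%N -> col j B = delta_mx j 0].
Proof.
move=> AA; elim: k => [_|k IH kn]; first by exists [::], A; split=> //=; rewrite mul1mx.
have [s [B [s0 AE BB Bk]]] := IH (ltnW kn); pose i := Ordinal kn.
have BBij (p q : 'I_n) : dotv (col p B) (col q B) = (p == q)%:R.
  have <- : (B^T *m B) p q = (p == q)%:R by rewrite BB mxE.
  by rewrite dotvE mxE; apply: eq_bigr => l _; rewrite !mxE.
have e_dot x (p : 'I_n) : dotv x (delta_mx p 0) = x p 0.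
  by rewrite /dotv -colE !mxE.
have eq_lt (p : 'I_n) : (p < k.+1)%N -> p = i \/ (p < k)%N.
  by rewrite ltnS leq_eqVlt => /orP[/eqP pk|]; [left; exact: val_inj|right].
have [xe|xe] := eqVneq (col i B) (delta_mx i 0).
  by exists s, B; split=> // j /eq_lt [->|/Bk].
pose w := col i B - delta_mx i 0.
have w0 : w != 0 by rewrite subr_eq0.
have ww : dotv w (col i B) * 2 = dotv w w.
  rewrite /w [RHS]dotvBr !dotvBl !e_dot (dotvC (delta_mx _ _)) !e_dot BBij eqxx.
  by rewrite [delta_mx i 0 i 0]mxE !eqxx /=; ring.
exists (rcons s w), (reflection w *m B); split.
- by rewrite all_rcons w0.
- by rewrite word_rcons -mulmxA (mulmxA (reflection w)) reflectionK // mul1mx.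
- by rewrite trmx_mul reflection_tr -mulmxA (mulmxA (reflection w)) reflectionK // mul1mx.
move=> j /eq_lt jk; rewrite colE -mulmxA -colE reflection_mul; case: jk => [->|jk].
  have -> : 2 / dotv w w * dotv w (col i B) = 1.
    by rewrite mulrAC [2 * _]mulrC ww divff // dotv_eq0.
  by rewrite scale1r /w opprB addrC subrK.
rewrite Bk // e_dot (_ : w j 0 = 0) ?mulr0 ?scale0r ?subr0 //.
have ji : j != i by rewrite -val_eqE /= neq_ltn jk.
rewrite -(e_dot w j) /w dotvBl [X in _ - X]e_dot -(Bk j jk) BBij [i == j]eq_sym.
by rewrite mxE (negbTE ji) subrr.
Qed.

Lemma orthogonal_wordE A : A^T *m A = 1%:M ->
  exists2 s, all (fun w => w != 0) s & A = word s.
Proof.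
move=> /orthogonal_word /(_ (leqnn n)) [s [B [s0 -> _ Bn]]]; exists s => //.
rewrite (_ : B = 1%:M) ?mulmx1 //; apply/matrixP => i j.
have := congr1 (fun x : 'cV[R]_n => x i 0) (Bn j (ltn_ord j)).
by rewrite !mxE andbT.
Qed.

End Reflections.

Lemma reflection_cvg (R : realType) n T (Fl : set_system T) {FF : Filter Fl}
    (w : T -> 'cV[R]_n) (x : 'cV[R]_n) : w @ Fl --> x -> x != 0 ->
  (fun t => reflection (w t)) @ Fl --> reflection x.
Proof.
move=> wx x0; have cw i : (fun s => w s i 0) @ Fl --> x i 0 by exact: mx_cvg_coord.
have cd : (fun s => dotv (w s) (w s)) @ Fl --> dotv x x.
  rewrite dotvE; under [X in X @ _]eq_fun do rewrite dotvE.
  by apply: cvg_sumr => i; apply: cvgM; exact: cw.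
apply: cvgB; first exact: cvg_cst.
apply: cvgZ.
  apply: cvgM; first exact: cvg_cst.
  by apply: cvgV => //; rewrite dotv_eq0.
apply: mx_cvg => i j.
rewrite !mxE big_ord1 !mxE; under [X in X @ _]eq_fun do rewrite !mxE big_ord1 !mxE.
by apply: cvgM; exact: cw.
Qed.

Lemma connected_component_image (T : topologicalType) (X : set T) (f : T -> T) x y :
  continuous f -> (forall z, X z -> X (f z)) ->
  connected_component X x y -> connected_component X (f x) (f y).
Proof.
move=> cf fX [C [Cx CX cC] Cy].
have fC : f @` C `<=` X by move=> _ [z Cz <-]; exact/fX/CX.
apply: (connected_component_max _ fC); last by exists y.
  by exists x.
exact: (connected_continuous_connected cC (continuous_subspaceT cf)).
Qed.

Lemma connected_component_path (R : realType) (T : topologicalType) (X : set T) (f : R -> T) :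
  (forall t, 0 <= t <= 1 -> {for t, continuous f}) ->
  (forall t, 0 <= t <= 1 -> X (f t)) -> connected_component X (f 0) (f 1).
Proof.
move=> cf fX.
have fI : f @` `[0, 1] `<=` X by move=> _ [t + <-]; rewrite /= in_itv /= => /fX.
apply: (connected_component_max _ fI).
- by exists 0 => //=; rewrite in_itv /= lexx ler01.
- apply: connected_continuous_connected; first exact: segment_connected.
  by apply: continuous_in_subspaceT => t; rewrite inE /= in_itv /=; exact: cf.
- by exists 1 => //=; rewrite in_itv /= lexx ler01.
Qed.

Section OrthogonalComponent.
Context {R : realType} {n : nat}.
Local Notation F := (real_scalars R).
Local Notation E := 'M[R]_((n + n) * (n + n), scalar_dim F).
Let FL : @scalar_laws R F _ := scalars_of_laws R Orthogonal.
Let X := [set mxcoord B | B in @indefinite_unitary_set R F n] : set E.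
Let o : E := mxcoord (1%:M : 'M[F]_(n + n)).

Lemma conj_tr_real m p (A : 'M[F]_(m, p)) : conj_tr A = (A : 'M[R]_(m, p))^T.
Proof. by apply/matrixP => i j; rewrite !mxE. Qed.

Lemma unitary_realP (A : 'M[R]_n) : A^T *m A = 1%:M -> unitary_set (A : 'M[F]_n).
Proof. by move=> AA; split; rewrite conj_tr_real //; exact: (mulmx1C AA). Qed.

Lemma indefinite_unitary_mul_comp (g : 'M[F]_(n + n)) : indefinite_unitary_set g ->
  forall x y, connected_component X x y -> connected_component X
    (mxcoord (g *m mx_of_coord x)) (mxcoord (g *m mx_of_coord y)).
Proof.
move=> gU x y; apply: (@connected_component_image _ X (fun V => mxcoord (g *m mx_of_coord V))).
  exact: (linear_mx_continuous (lmul_coord_linear FL g)).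
move=> _ [A AU <-]; exists (g *m A); first exact: (indefinite_unitaryM gU).
by rewrite (mxcoordK FL).
Qed.

Section Embedding.
Variable iota : 'M[R]_n -> 'M[F]_(n + n).
Hypothesis iotaM : forall A B, iota (A *m B) = iota A *m iota B.
Hypothesis iota1 : iota 1%:M = 1%:M.
Hypothesis iotaU : forall A : 'M[R]_n, A^T *m A = 1%:M -> indefinite_unitary_set (iota A).
Variables (L : 'M[R]_n -> E) (c : E).
Hypotheses (lL : linear L) (iotaE : forall A, mxcoord (iota A) = L A + c).

(** Moving [u] to [v] along the segment deforms the product into the square of one reflection, which
    is 1. If the segment meets 0, then [u] is a multiple of [v] and the two reflections coincide.
    The abstract [iota] stands for either diagonal embedding of the orthogonal group. *)
Lemma component_reflection2 (u v : 'cV[R]_n) : u != 0 -> v != 0 ->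
  connected_component X o (mxcoord (iota (reflection u *m reflection v))).
Proof.
move=> u0 v0; pose w (t : R) := (1 - t) *: v + t *: u.
have w0 : w 0 = v by rewrite /w subr0 scale1r scale0r addr0.
have w1 : w 1 = u by rewrite /w subrr scale0r scale1r add0r.
have rU x y : x != 0 -> y != 0 -> (reflection x *m reflection y : 'M[R]_n)^T *m
    (reflection x *m reflection y) = 1%:M.
  move=> x0 y0; rewrite trmx_mul !reflection_tr mulmxA -(mulmxA (reflection y)).
  by rewrite reflectionK // mulmx1 reflectionK.
have oE : o = mxcoord (iota (reflection v *m reflection v)).
  by rewrite reflectionK // iota1.
have [[t t01 wt]|wn] := pselect (exists2 t, 0 <= t <= 1 & w t = 0).
  have tn0 : t != 0.
    by apply: contra_neq v0 => t0; rewrite -w0 -t0.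
  have uE : u = (- (1 - t) / t) *: v.
    move/eqP: wt; rewrite /w addrC addr_eq0 => /eqP /(congr1 (fun x => t^-1 *: x)).
    by rewrite scalerA mulVf // scale1r => ->; rewrite -scaleNr scalerA mulrC.
  have cn0 : - (1 - t) / t != 0.
    by apply: contra_neq u0 => c0; rewrite uE c0 scale0r.
  rewrite uE reflection_scale // -oE; apply: connected_component_refl.
  by rewrite oE; eexists; [exact: iotaU (rU _ _ v0 v0)|].
have wn0 t : 0 <= t <= 1 -> w t != 0.
  by move=> t01; apply/eqP => wt; apply: wn; exists t.
pose f (t : R) := mxcoord (iota (reflection (w t) *m reflection v)).
rewrite oE -{1}w0 -{1}w1.
apply: (@connected_component_path R _ X f) => t t01; last first.
  by eexists; [exact: iotaU (rU _ _ (wn0 t t01) v0)|].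
have cw : w @ t --> w t.
  apply: cvgD; apply: cvgZr_tmp; last exact: cvg_id.
  by apply: cvgB; [exact: cvg_cst|exact: cvg_id].
have cr : (fun s => reflection (w s)) @ t --> reflection (w t).
  exact: (reflection_cvg cw (wn0 t t01)).
have fE : f = (fun s => L (reflection (w s) *m reflection v) + c).
  by apply/funext => s; rewrite /f iotaE.
have lm : linear (fun A : 'M[R]_n => L (A *m reflection v)).
  by move=> a A B; rewrite mulmxDl -scalemxAl lL.
have cL : (fun s => L (reflection (w s) *m reflection v)) @ t -->
    L (reflection (w t) *m reflection v) by exact: (linear_mx_cvg lm cr).
suff : f @ t --> f t by [].
by rewrite fE; exact: (cvgD cL (cvg_cst c)).
Qed.

(** Reflections are removed two at a time: left multiplication by a pair maps the component of 1 to
    the component of that pair, which is again that of 1. *)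
Lemma component_word (s : seq 'cV[R]_n) : all (fun w => w != 0) s -> ~~ odd (size s) ->
  connected_component X o (mxcoord (iota (word s))).
Proof.
have [k] := ubnP (size s); elim: k s => // k IH [|u [|v s]] //= sk.
  move=> _ _; rewrite iota1; apply: connected_component_refl.
  by exists (1%:M : 'M[F]_(n + n)) => //; rewrite -iota1; apply: iotaU; rewrite trmx1 mulmx1.
move=> /and3P[u0 v0 s0]; rewrite negbK => os.
rewrite mulmxA iotaM.
have rU : indefinite_unitary_set (iota (reflection u *m reflection v)).
  apply: iotaU; rewrite trmx_mul !reflection_tr mulmxA -(mulmxA (reflection v)).
  by rewrite reflectionK // mulmx1 reflectionK.
have := indefinite_unitary_mul_comp rU (IH s (ltnW sk) s0 os).
rewrite /o !(mxcoordK FL) mulmx1; apply: connected_component_trans.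
exact: component_reflection2.
Qed.

(** Each reflection has determinant -1, so determinant 1 means an even number of reflections. *)
Lemma component_special_orthogonal (A : 'M[R]_n) : A^T *m A = 1%:M -> \det A = 1 ->
  connected_component X o (mxcoord (iota A)).
Proof.
move=> /orthogonal_wordE [s s0 ->]; rewrite det_word // => ds.
apply: component_word => //; move: ds; rewrite -signr_odd; case: odd => //=.
by rewrite expr1 => /eqP; rewrite -subr_eq0 -opprD oppr_eq0 paddr_eq0 ?oner_eq0.
Qed.

End Embedding.

(** diag(g, h) = diag(g, 1) diag(1, h), and each factor is reached through its own embedding of the
    orthogonal group. *)
Lemma component_block_diag (g h : 'M[R]_n) : g^T *m g = 1%:M -> \det g = 1 ->
  h^T *m h = 1%:M -> \det h = 1 ->
  connected_component X o (mxcoord (block_mx g 0 0 h : 'M[F]_(n + n))).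
Proof.
move=> gg dg hh dh.
have lb (a b : 'M[R]_n -> 'M[R]_n) : linear a -> linear b -> linear (fun A =>
    mxcoord (block_mx (a A) 0 0 (b A) : 'M[F]_(n + n))).
  move=> la lb x A B; rewrite la lb.
  rewrite -(mxcoordZ FL) -(mxcoordD FL) scale_block_mx add_block_mx.
  by rewrite !scaler0 !addr0.
have l0 : linear (fun _ : 'M[R]_n => 0 : 'M[R]_n) by move=> a A B /=; rewrite scaler0 addr0.
have lid : linear (@idfun 'M[R]_n) by [].
have c1 := @component_special_orthogonal (fun A => block_mx A 0 0 1%:M) _ _ _
  _ (mxcoord (block_mx 0 0 0 1%:M : 'M[F]_(n + n))) (lb _ _ lid l0) _ g gg dg.
have c2 := @component_special_orthogonal (fun A => block_mx 1%:M 0 0 A) _ _ _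
  _ (mxcoord (block_mx 1%:M 0 0 0 : 'M[F]_(n + n))) (lb _ _ l0 lid) _ h hh dh.
have gU : indefinite_unitary_set (block_mx g 0 0 1%:M : 'M[F]_(n + n)).
  by apply: (block_diag_indefinite FL); [exact: unitary_realP|exact: (unitary1 FL)].
have : connected_component X o (mxcoord (block_mx g 0 0 1%:M : 'M[F]_(n + n))).
  apply: c1.
  - by move=> A B; rewrite mul_block_diag mulmx1.
  - by rewrite -scalar_mx_block.
  - by move=> A AA; apply: (block_diag_indefinite FL); [exact: unitary_realP|exact: (unitary1 FL)].
  - by move=> A; rewrite -(mxcoordD FL) add_block_mx !addr0 !add0r.
move/connected_component_trans; apply.
have : connected_component X o (mxcoord (block_mx 1%:M 0 0 h : 'M[F]_(n + n))).
  apply: c2.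
  - by move=> A B; rewrite mul_block_diag mulmx1.
  - by rewrite -scalar_mx_block.
  - by move=> A AA; apply: (block_diag_indefinite FL); [exact: (unitary1 FL)|exact: unitary_realP].
  - by move=> A; rewrite -(mxcoordD FL) add_block_mx !addr0 !add0r.
move/(indefinite_unitary_mul_comp gU).
by rewrite /o !(mxcoordK FL) mulmx1 mul_block_diag mulmx1 mul1mx.
Qed.

End OrthogonalComponent.

(** * Group properties of M, K and G for the three triples *)

Section TripleGroups.
Context {R : realType}.

Lemma closed_level (V W : normedModType R) (f : V -> W) (c : W) :
  continuous f -> closed [set x | f x = c].
Proof.
move=> cf; have -> : [set x | f x = c] = f @^-1` [set c] by [].
apply: preimage_closed; first by move=> x _; exact: cf.
apply: accessible_closed_set1; exact: hausdorff_accessible.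
Qed.

Lemma unitary_closed (F : scalars R) emb (FL : @scalar_laws R F emb) n :
  closed [set V | unitary_set (mx_of_coord V : 'M[F]_n)].
Proof.
pose cj (V : 'M[R]_(n * n, scalar_dim F)) := mxcoord (conj_tr (mx_of_coord V : 'M[F]_n)).
have lcj : linear cj.
  apply: (linear_mxcoord FL (L := @conj_tr R F n n)) => [A B|a A].
    by rewrite (conj_trD FL).
  by rewrite (conj_trZ FL).
have ccj : continuous cj by exact: linear_mx_continuous.
pose o : 'M[R]_(n * n, scalar_dim F) := mxcoord (1%:M : 'M[F]_n).
have -> : [set V | unitary_set (mx_of_coord V : 'M[F]_n)] =
    [set V | mul_coord V (cj V) = o] `&` [set V | mul_coord (cj V) V = o].
  apply/seteqP; split=> V; rewrite /mul_coord /cj /o /=.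
    by move=> [A1 A2]; split; rewrite (mxcoordK FL) ?A1 ?A2.
  by move=> [/(can_inj (mxcoordK FL (p := n))) + /(can_inj (mxcoordK FL (p := n)))];
    rewrite (mxcoordK FL).
have c1 : continuous (fun V => mul_coord V (cj V)).
  move=> V; have h1 : (fun W : 'M[R]_(n * n, scalar_dim F) => W) @ V --> V by exact: cvg_id.
  have h2 : cj @ V --> cj V by exact: ccj.
  have h : (fun W => mul_coord W (cj W)) @ V --> mul_coord V (cj V).
    by have := mul_coord_cvg FL (Fl := nbhs V) h1 h2; apply; exact: _.
  exact: h.
have c2 : continuous (fun V => mul_coord (cj V) V).
  move=> V; have h1 : (fun W : 'M[R]_(n * n, scalar_dim F) => W) @ V --> V by exact: cvg_id.
  have h2 : cj @ V --> cj V by exact: ccj.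
  have h : (fun W => mul_coord (cj W) W) @ V --> mul_coord (cj V) V.
    by have := mul_coord_cvg FL (Fl := nbhs V) h2 h1; apply; exact: _.
  exact: h.
by apply: closedI; exact: closed_level.
Qed.

Lemma unitary_matrix_group (F : scalars R) emb (FL : @scalar_laws R F emb) n :
  matrix_group (@unitary_set R F n).
Proof.
split=> //.
- exact: (unitary1 FL).
- exact: (unitaryM FL).
- exact: (unitaryV FL).
- exact: (cayley_unitary FL).
rewrite (_ : [set mxcoord A | A in _] = [set V | unitary_set (mx_of_coord V : 'M[F]_n)]).
  exact: (unitary_closed FL).
apply/seteqP; split=> [_ [A UA <-]|V UV]; first by rewrite /= (mxcoordK FL).
by exists (mx_of_coord V) => //; rewrite (mx_of_coordK FL).
Qed.

Lemma M_set_matrix_group f n : matrix_group (@M_set R f n).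
Proof.
case: f; last 2 first.
- exact: (unitary_matrix_group (scalars_of_laws R Unitary)).
- exact: (unitary_matrix_group (scalars_of_laws R Symplectic)).
have FL := scalars_of_laws R Orthogonal.
have [_ U1 UM UV UC Ucl] := unitary_matrix_group FL n.
split.
- by move=> A [].
- by split=> //; exact: det1.
- by move=> A B [UA dA] [UB dB]; split; [exact: UM|rewrite det_mulmx dA dB mulr1].
- move=> A [UA dA]; split; first exact: UV.
  by rewrite conj_tr_real det_tr.
- move=> X sX; split; first exact: UC.
  (* The Cayley transform has determinant det(1 + X) / det(1 - X), which is 1 because 1 - X is the
     transpose of 1 + X for skew-symmetric X. *)
  have /(congr1 (fun A : 'M[R]_n => \det A)) := cayleyK FL sX.
  rewrite det_mulmx -[in RHS]det_tr linearD /= trmx1 -(conj_tr_real X) sX.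
  have iX := inverse_mxP (skew_den_invertible FL sX).
  have d0 : \det (1%:M - X : 'M[R]_n) != 0.
    have /(congr1 (fun A : 'M[R]_n => \det A)) := iX.1.
    rewrite det_mulmx det1 => dd; apply/eqP => d0.
    by move: dd; rewrite d0 mul0r => /eqP; rewrite eq_sym oner_eq0.
  by move=> dd; apply: (mulIf d0); rewrite mul1r.
rewrite (_ : [set mxcoord A | A in _] = [set mxcoord A | A in @unitary_set R (real_scalars R) n] `&`
   [set V | \det (@mx_of_coord R (real_scalars R) n n V : 'M[R]_n) = 1]).
  apply: closedI => //.
  apply: (@closed_level _ R^o (fun V => \det (@mx_of_coord R (real_scalars R) n n V : 'M[R]_n))) => V.
  have lD : linear (fun W => @mx_of_coord R (real_scalars R) n n W : 'M[R]_n).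
    by move=> a W W'; rewrite (mx_of_coordD FL) (mx_of_coordZ FL).
  have := det_cvg (linear_mx_continuous lD (x := V)).
  by apply; exact: _.
apply/seteqP; split=> [_ [A [UA dA] <-]|_ [[A UA <-]]].
  by split; [exists A|rewrite /= (mxcoordK FL)].
by rewrite /= (mxcoordK FL) => dA; exists A.
Qed.

Section GK.
Variables (f : triple) (n : nat).
Local Notation F := (scalars_of R f).
Let FL := scalars_of_laws R f.
Let MG := M_set_matrix_group f n.

Lemma G_set_indefinite g : @G_set R f n g -> indefinite_unitary_set g.
Proof.
rewrite /G_set; case: f g => g; [|by case|by []].
move=> /connected_component_sub [B BU].
by move=> /(can_inj (mxcoordK (scalars_of_laws R Orthogonal) (p := n + n))) <-.
Qed.

Lemma G_mfd_indefinite V : G_mfd R f n V ->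
  indefinite_unitary_set (mx_of_coord V : 'M[F]_(n + n)).
Proof. by move=> [g Gg <-]; rewrite (mxcoordK FL); exact: G_set_indefinite. Qed.

Lemma K_conditionV (g h : 'M[F]_n) : K_condition g h ->
  K_condition (conj_tr g) (conj_tr h).
Proof.
case: f g h => //= g h gh.
have dconj (A : 'M[R[i]]_n) : \det (@conj_tr R (complex_scalars R) n n A) = (\det A)^*%C.
  by rewrite /conj_tr det_tr; exact: (det_map_mx (@conjc R)).
by rewrite !dconj -rmorphM gh rmorph1.
Qed.

Lemma K_conditionM (g h g' h' : 'M[F]_n) : K_condition g h -> K_condition g' h' ->
  K_condition (g *m g') (h *m h').
Proof.
case: f g h g' h' => //= g h g' h' gh gh'.
by rewrite !det_mulmx mulrACA gh gh' mulr1.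
Qed.

Lemma K_setV (k : 'M[F]_(n + n)) : K_set k -> K_set (inverse_mx k).
Proof.
move=> [g [h [Mg Mh gh ->]]].
rewrite (inverse_mxE (block_diag_inverse (mgroup_unitary MG Mg) (mgroup_unitary MG Mh))).
exists (conj_tr g), (conj_tr h); split=> //; try exact: (mgroupV MG).
exact: K_conditionV.
Qed.

Lemma K_setM (k k' : 'M[F]_(n + n)) : K_set k -> K_set k' -> K_set (k *m k').
Proof.
move=> [g [h [Mg Mh gh ->]]] [g' [h' [Mg' Mh' gh' ->]]].
exists (g *m g'), (h *m h'); split; try exact: (mgroupM MG).
  exact: K_conditionM.
by rewrite mul_block_diag.
Qed.

Lemma K_set1 : K_set (1%:M : 'M[F]_(n + n)).
Proof.
exists 1%:M, 1%:M; split; try exact: (mgroup1 MG); last by rewrite -scalar_mx_block.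
by case: f => //=; rewrite det1 mulr1.
Qed.

Lemma K_set_inverse (k : 'M[F]_(n + n)) : K_set k -> is_inverse k (inverse_mx k).
Proof.
move=> [g [h [Mg Mh gh ->]]]; apply: inverse_mxP.
by eexists; exact: (block_diag_inverse (mgroup_unitary MG Mg) (mgroup_unitary MG Mh)).
Qed.

Lemma K_set_indefinite (k : 'M[F]_(n + n)) : K_set k -> indefinite_unitary_set k.
Proof.
by move=> [g [h [Mg Mh gh ->]]]; apply: (block_diag_indefinite FL); exact: (mgroup_unitary MG).
Qed.

End GK.

(** In the orthogonal case membership in G means lying in the identity component, and the
    connectedness of SO_n is used; for SU(n,n) it is the determinant condition defining K. *)
Lemma K_set_G f n (k : 'M[scalars_of R f]_(n + n)) : K_set k -> G_set k.
Proof.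
move=> Kk; have := K_set_indefinite Kk; move: Kk.
case: f k => k /= [g [h [Mg Mh gh kE]]] // kU; last first.
  by split=> //; rewrite kE (det_ublock (R := R[i])).
have [Ug dg] := Mg; have [Uh dh] := Mh.
rewrite kE; apply: component_block_diag => //.
  by have := Ug.2; rewrite conj_tr_real.
by have := Uh.2; rewrite conj_tr_real.
Qed.

(** For O_o(n,n), left multiplication by [k] maps the component of 1 to the component of [k], and
    these coincide since [k] lies in G. *)
Lemma G_setMl f n (k g : 'M[scalars_of R f]_(n + n)) : K_set k -> G_set g -> G_set (k *m g).
Proof.
move=> Kk Gg; have kU := K_set_indefinite Kk; have Gk := K_set_G Kk.
have gU := G_set_indefinite Gg; move: k g Kk Gg kU Gk gU.
case: f => k g Kk Gg kU Gk gU /=.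
- have := indefinite_unitary_mul_comp kU Gg.
  rewrite !(mxcoordK (scalars_of_laws R Orthogonal)) mulmx1.
  exact: connected_component_trans.
- split; first exact: (indefinite_unitaryM kU).
  by rewrite (det_mulmx (R := R[i])) Gk.2 Gg.2 mulr1.
- exact: (indefinite_unitaryM kU).
Qed.

Lemma indefinite_unitary_comp_mul n (g : 'M[real_scalars R]_(n + n)) :
  indefinite_unitary_set g -> forall x y,
  connected_component [set mxcoord B | B in @indefinite_unitary_set R (real_scalars R) n] x y ->
  connected_component [set mxcoord B | B in @indefinite_unitary_set R (real_scalars R) n]
    (mxcoord (mx_of_coord x *m g)) (mxcoord (mx_of_coord y *m g)).
Proof.
move=> gU x y; have FL := scalars_of_laws R Orthogonal.
apply: (connected_component_image (f := fun V => mxcoord (mx_of_coord V *m g))).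
  apply: linear_mx_continuous.
  apply: (linear_mxcoord FL (L := fun A => A *m g)) => [A B|a A]; first by rewrite mulmxDl.
  by rewrite scalemxAl.
move=> _ [A AU <-]; exists (A *m g); first exact: (indefinite_unitaryM _ gU).
by rewrite (mxcoordK FL).
Qed.

Lemma G_setMr f n (k g : 'M[scalars_of R f]_(n + n)) : K_set k -> G_set g -> G_set (g *m k).
Proof.
move=> Kk Gg; have kU := K_set_indefinite Kk; have Gk := K_set_G Kk.
have gU := G_set_indefinite Gg; move: k g Kk Gg kU Gk gU.
case: f => k g Kk Gg kU Gk gU /=.
- have := indefinite_unitary_comp_mul kU Gg.
  rewrite !(mxcoordK (scalars_of_laws R Orthogonal)) mul1mx.
  exact: connected_component_trans.
- split; first exact: (indefinite_unitaryM gU).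
  by rewrite (det_mulmx (R := R[i])) Gk.2 Gg.2 mulr1.
- exact: (indefinite_unitaryM gU).
Qed.

End TripleGroups.

(** * Translations *)

Section LinearIsometry.
Context {R : realType} {E : normedModType R}.
Variables (S : set E).

Lemma smooth_curve_tangent (gamma : R^o -> E) : smooth_curve S gamma ->
  tangent S (gamma 0) (velocity0 gamma).
Proof. by exists gamma. Qed.

Section Curve.
Variable T : E -> E.
Hypotheses (lT : linear T) (cT : continuous T) (ST : forall x, S x -> S (T x)).

Lemma smooth_curve_linear (gamma : R^o -> E) : smooth_curve S gamma ->
  smooth_curve S (T \o gamma).
Proof.
move=> [U [U0 [oU sU] SU]]; exists U; split=> //; last by move=> t /SU /ST.
by split=> // k; exact: Ck_on_linear.
Qed.

Lemma velocity0_linear (gamma : R^o -> E) : smooth_curve S gamma ->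
  velocity0 (T \o gamma) = T (velocity0 gamma).
Proof.
by move=> /smooth_curve_is_derive dg; rewrite {1}/velocity0;
  have [_ ->] := is_derive_linear lT cT dg.
Qed.

Lemma smooth_map_linear : smooth_map S T.
Proof.
move=> p Sp; exists setT, T; split=> //; split; first exact: openT.
move=> k; apply: (Ck_on_linear (f := @idfun E)) => //; first exact: openT.
by apply: Ck_on_id; exact: openT.
Qed.

End Curve.

(** A linear map commutes with taking velocities, so the condition on pairs of curves reduces to an
    identity between tangent vectors. *)
Lemma linear_isometry (m : metric_tensor E) (T T' : E -> E) :
  linear T -> linear T' -> continuous T -> continuous T' ->
  (forall x, S x -> S (T x)) -> (forall x, S x -> S (T' x)) ->
  (forall x, S x -> T' (T x) = x) -> (forall x, S x -> T (T' x) = x) ->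
  (forall p X Y, S p -> tangent S p X -> tangent S p Y -> m (T p) (T X) (T Y) = m p X Y) ->
  riemannian_isometry S m T.
Proof.
move=> lT lT' cT cT' ST ST' TK TK' mT; split.
  by exists T'; split=> //; exact: smooth_map_linear.
move=> c1 c2 s1 s2 c12.
rewrite !velocity0_linear // mT //; first exact: smooth_curve0 s1.
  exact: smooth_curve_tangent.
by rewrite c12; exact: smooth_curve_tangent.
Qed.

Lemma tangent_linear (T : E -> E) p X : linear T -> continuous T ->
  (forall x, S x -> S (T x)) -> tangent S p X -> tangent S (T p) (T X).
Proof.
move=> lT cT ST [c [sc <- <-]]; exists (T \o c).
by split; [exact: smooth_curve_linear| |rewrite velocity0_linear].
Qed.

Lemma tangentS (S' : set E) p : S `<=` S' -> tangent S p `<=` tangent S' p.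
Proof.
move=> SS' X [c [[U [U0 sU SU]] c0 vc]]; exists c; split=> //.
by exists U; split=> // t /SU /SS'.
Qed.

End LinearIsometry.

Section MobiusTranslation.
Context {R : realType} {F : scalars R} {emb : R -> F} (FL : scalar_laws emb).
Variable n : nat.
Implicit Types (g X : 'M[F]_(n + n)) (q u v : 'M[F]_n).

(** Inserting the product of [conj_tr v2] and [v2] pulls [v2] out on the right and turns the
    argument into [u2 *m q *m conj_tr v2], the image of q under the Möbius action of the right
    factor. *)
Lemma mobius_num_translation u1 v1 u2 v2 X q : unitary_set v2 ->
  mobius_num (block_mx u1 0 0 v1 *m X *m block_mx u2 0 0 v2) q =
  u1 *m mobius_num X (u2 *m q *m conj_tr v2) *m v2.
Proof.
move=> [_ v2v]; rewrite -{1}[X]submxK !mulmx_block !mul0mx !mulmx0 !addr0 !add0r.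
rewrite /mobius_num block_mxKul block_mxKur mulmxDr mulmxDl !mulmxA.
by rewrite -(mulmxA _ (conj_tr v2)) v2v mulmx1.
Qed.

Lemma mobius_den_translation u1 v1 u2 v2 X q : unitary_set v2 ->
  mobius_den (block_mx u1 0 0 v1 *m X *m block_mx u2 0 0 v2) q =
  v1 *m mobius_den X (u2 *m q *m conj_tr v2) *m v2.
Proof.
move=> [_ v2v]; rewrite -{1}[X]submxK !mulmx_block !mul0mx !mulmx0 !addr0 !add0r.
rewrite /mobius_den block_mxKdl block_mxKdr mulmxDr mulmxDl !mulmxA.
by rewrite -(mulmxA _ (conj_tr v2)) v2v mulmx1.
Qed.

Lemma mobius_deriv_translation u1 v1 u2 v2 g X q :
  indefinite_unitary_set g -> unitary_set q ->
  unitary_set v1 -> unitary_set u2 -> unitary_set v2 ->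
  mobius_deriv (block_mx u1 0 0 v1 *m g *m block_mx u2 0 0 v2)
    (block_mx u1 0 0 v1 *m X *m block_mx u2 0 0 v2) q =
  u1 *m mobius_deriv g X (u2 *m q *m conj_tr v2) *m conj_tr v1.
Proof.
move=> gU qU v1U u2U v2U.
have q'U : unitary_set (u2 *m q *m conj_tr v2).
  by apply: (unitaryM FL); [exact: (unitaryM FL)|exact: (unitaryV FL)].
rewrite /mobius_deriv !mobius_num_translation // !mobius_den_translation //.
set q' := u2 *m q *m conj_tr v2.
set P := inverse_mx (mobius_den g q').
have iP : is_inverse (mobius_den g q') P.
  exact: inverse_mxP (mobius_den_invertible FL gU q'U).
have -> : inverse_mx (v1 *m mobius_den g q' *m v2) = conj_tr v2 *m P *m conj_tr v1.
  apply: inverse_mxE; rewrite -[conj_tr v2 *m P *m _]mulmxA.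
  by apply: is_inverseM v2U; exact: is_inverseM v1U iP.
have [v1l v1r] := v1U; have [v2l v2r] := v2U.
have kill (A : 'M[F]_n) B : A *m v2 *m (conj_tr v2 *m B) = A *m B.
  by rewrite mulmxA -(mulmxA A) v2l mulmx1.
have kill1 (A : 'M[F]_n) B : A *m conj_tr v1 *m (v1 *m B) = A *m B.
  by rewrite mulmxA -(mulmxA A) v1r mulmx1.
rewrite -![conj_tr v2 *m P *m _]mulmxA !kill mulmxBr mulmxBl !mulmxA; congr (_ - _).
by rewrite -(mulmxA _ (conj_tr v1)) v1r mulmx1 -(mulmxA _ v2) v2l mulmx1.
Qed.

End MobiusTranslation.

Section Kinetic.
Context {R : realType} {F : scalars R} {emb : R -> F} (FL : scalar_laws emb).
Variables (n : nat) (M : set 'M[F]_n).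
Hypothesis MG : matrix_group M.
Local Notation E := 'M[R]_(n * n, scalar_dim F).
Local Notation Eg := 'M[R]_((n + n) * (n + n), scalar_dim F).
Let Mc := [set mxcoord A | A in M] : set E.
Variable mu : {measure set (borel E) -> \bar R}.
Hypothesis hmu : riemannian_volume Mc (trace_metric (F := F) (n := n)) mu.

Lemma unitary_coord q : Mc q -> unitary_set (mx_of_coord q : 'M[F]_n).
Proof. by move=> [A MA <-]; rewrite (mxcoordK FL); exact: (mgroup_unitary MG). Qed.

Lemma group_integral_translation (u v : 'M[F]_n) (f : E -> R) : M u -> M v ->
  (forall x, Mc x -> {for x, continuous f}) ->
  \int[mu]_(q in (Mc : set (borel E))) f (mxcoord (u *m mx_of_coord (q : E) *m v)) =
  \int[mu]_(q in (Mc : set (borel E))) f q.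
Proof.
move=> Mu Mv cf; have uU := mgroup_unitary MG Mu; have vU := mgroup_unitary MG Mv.
pose L (u v : 'M[F]_n) (V : E) : E := mxcoord (u *m mx_of_coord V *m v).
have lL u' v' : linear (L u' v').
  apply: (linear_mxcoord FL (L := fun A => u' *m A *m v')) => [A B|a A].
    by rewrite mulmxDr mulmxDl.
  by rewrite (scale_emb_mulmxr FL) -scalemxAl.
have LK u' v' V : unitary_set u' -> unitary_set v' ->
    L (conj_tr u') (conj_tr v') (L u' v' V) = V.
  move=> [_ uu] [vv _]; rewrite /L (mxcoordK FL) !mulmxA uu mul1mx -mulmxA vv mulmx1.
  by rewrite (mx_of_coordK FL).
have LM u' v' V : M u' -> M v' -> Mc V -> Mc (L u' v' V).
  move=> Mu' Mv' [A MA <-]; rewrite /L (mxcoordK FL); exists (u' *m A *m v') => //.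
  by apply: (mgroupM MG) => //; exact: (mgroupM MG).
apply: (Rintegral_isometry FL MG hmu (L := L u v) (L' := L (conj_tr u) (conj_tr v))) => //.
- by move=> V; exact: LK.
- move=> V; rewrite -{1}(conj_trK FL u) -{1}(conj_trK FL v).
  by apply: LK; exact: (unitaryV FL).
- by move=> V; exact: LM.
- by move=> V; apply: LM; exact: (mgroupV MG).
move=> p q X Y; rewrite !trace_metricE /L !(mxcoordK FL).
rewrite (inner_mulr FL); last by rewrite (conj_trK FL); exact: vU.2.
by rewrite (inner_mull FL) // (conj_trK FL); exact: uU.1.
Qed.

Definition kinetic_density (g X Y : 'M[F]_(n + n)) (q : E) : R :=
  inner (mobius_deriv g X (mx_of_coord q)) (mobius_deriv g Y (mx_of_coord q)).

Lemma mobius_num_cvg (X : 'M[F]_(n + n)) (q : E) :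
  (fun p : E => mxcoord (mobius_num X (mx_of_coord p))) @ q -->
  mxcoord (mobius_num X (mx_of_coord q)).
Proof.
have l : linear (@lmul_coord R F n n n (ulsubmx X)) by exact: (lmul_coord_linear FL).
have c : lmul_coord (ulsubmx X) @ q --> lmul_coord (ulsubmx X) q.
  exact: linear_mx_continuous.
have h (p : E) : mxcoord (mobius_num X (mx_of_coord p)) =
  lmul_coord (ulsubmx X) p + mxcoord (ursubmx X) by rewrite -(mxcoordD FL).
rewrite h (_ : (fun p : E => mxcoord (mobius_num X (mx_of_coord p))) =
  fun p : E => lmul_coord (ulsubmx X) p + mxcoord (ursubmx X)); last exact/funext.
exact: cvgD c (cvg_cst _).
Qed.

Lemma mobius_den_cvg (X : 'M[F]_(n + n)) (q : E) :
  (fun p : E => mxcoord (mobius_den X (mx_of_coord p))) @ q -->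
  mxcoord (mobius_den X (mx_of_coord q)).
Proof.
have := @mobius_num_cvg (block_mx (dlsubmx X) (drsubmx X) 0 0) q.
by rewrite /mobius_num block_mxKul block_mxKur.
Qed.

Lemma mobius_deriv_cvg (g X : 'M[F]_(n + n)) (q : E) :
  indefinite_unitary_set g -> unitary_set (mx_of_coord q : 'M[F]_n) ->
  (fun p : E => mxcoord (mobius_deriv g X (mx_of_coord p))) @ q -->
  mxcoord (mobius_deriv g X (mx_of_coord q)).
Proof.
move=> gU qU; have iden := mobius_den_invertible FL gU qU.
pose num X p := mxcoord (mobius_num X (mx_of_coord p : 'M[F]_n)).
pose den X p := mxcoord (mobius_den X (mx_of_coord p : 'M[F]_n)).
have cn Y : num Y @ q --> num Y q by exact: mobius_num_cvg.
have cd Y : den Y @ q --> den Y q by exact: mobius_den_cvg.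
have ci : (fun p => inv_coord (den g p)) @ q --> inv_coord (den g q).
  have iden' : invertible (mx_of_coord (den g q) : 'M[F]_n) by rewrite /den (mxcoordK FL).
  by have [] := inverse_cvg FL iden' (cd g).
have E1 (p : E) : mxcoord (mobius_deriv g X (mx_of_coord p)) =
    mul_coord (num X p) (inv_coord (den g p)) -
    mul_coord (mul_coord (mul_coord (num g p) (inv_coord (den g p))) (den X p))
      (inv_coord (den g p)).
  by rewrite /mul_coord /inv_coord /num /den !(mxcoordK FL) -(mxcoordN FL) -(mxcoordD FL).
rewrite E1 (_ : (fun p : E => mxcoord (mobius_deriv g X (mx_of_coord p))) = fun p =>
    mul_coord (num X p) (inv_coord (den g p)) -
    mul_coord (mul_coord (mul_coord (num g p) (inv_coord (den g p))) (den X p))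
      (inv_coord (den g p))); last exact/funext.
have c1 := mul_coord_cvg FL (cn X) ci.
have c2 := mul_coord_cvg FL (mul_coord_cvg FL (mul_coord_cvg FL (cn g) ci) (cd X)) ci.
exact: (cvgB (c1 _) (c2 _ _ _)).
Qed.

Lemma kinetic_density_continuous (g X Y : 'M[F]_(n + n)) :
  indefinite_unitary_set g -> forall q, Mc q ->
  {for q, continuous (kinetic_density g X Y)}.
Proof.
move=> gU q /unitary_coord qU.
have c := inner_form_cvg FL (@mobius_deriv_cvg g X q gU qU) (@mobius_deriv_cvg g Y q gU qU).
have h p : inner_form (mxcoord (mobius_deriv g X (mx_of_coord p)))
  (mxcoord (mobius_deriv g Y (mx_of_coord p))) = kinetic_density g X Y p.
  by rewrite /inner_form !(mxcoordK FL).
have {}c : kinetic_density g X Y @ q --> kinetic_density g X Y q.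
  rewrite -h (_ : kinetic_density g X Y = fun p =>
    inner_form (mxcoord (mobius_deriv g X (mx_of_coord p)))
      (mxcoord (mobius_deriv g Y (mx_of_coord p)))); last by apply/funext => p; rewrite -h.
  exact: (c _).
exact: c.
Qed.

Variable G : set Eg.
Hypothesis GU : forall V, G V -> indefinite_unitary_set (mx_of_coord V : 'M[F]_(n + n)).

Lemma kinetic_metricE g X Y : tangent G g X -> tangent G g Y ->
  kinetic_metric G Mc mu g X Y =
  \int[mu]_(q in (Mc : set (borel E)))
    kinetic_density (mx_of_coord g) (mx_of_coord X) (mx_of_coord Y) q.
Proof.
move=> tX tY; apply: eq_Rintegral => q; rewrite inE => /unitary_coord qU.
by rewrite !(mobius_fieldE FL GU qU) // trace_metricE !(mxcoordK FL).
Qed.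

Lemma kinetic_metric_translation (u1 v1 u2 v2 : 'M[F]_n) g X Y :
  let T := translation (block_mx u1 0 0 v1) (block_mx u2 0 0 v2) in
  M u1 -> M v1 -> M u2 -> M v2 -> G g ->
  tangent G g X -> tangent G g Y -> tangent G (T g) (T X) -> tangent G (T g) (T Y) ->
  kinetic_metric G Mc mu (T g) (T X) (T Y) = kinetic_metric G Mc mu g X Y.
Proof.
move=> T Mu1 Mv1 Mu2 Mv2 Gg tX tY tTX tTY.
rewrite (kinetic_metricE tTX tTY) (kinetic_metricE tX tY).
have cf := @kinetic_density_continuous _ (mx_of_coord X) (mx_of_coord Y) (GU Gg).
(* The integral at the untranslated point is transformed by the substitution of
   [u2 *m q *m conj_tr v2] for q; the integrands then differ only by unitary factors. *)
rewrite -(group_integral_translation Mu2 (mgroupV MG Mv2) cf).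
apply: eq_Rintegral => q; rewrite inE => /unitary_coord qU.
have [u1U v1U] := (mgroup_unitary MG Mu1, mgroup_unitary MG Mv1).
have [u2U v2U] := (mgroup_unitary MG Mu2, mgroup_unitary MG Mv2).
rewrite /kinetic_density /T /translation !(mxcoordK FL).
rewrite !(mobius_deriv_translation FL) //; try exact: GU.
rewrite (inner_mulr FL); last by rewrite (conj_trK FL); exact: v1U.2.
by rewrite (inner_mull FL) //; exact: u1U.2.
Qed.

End Kinetic.

Section Translations.
Context {R : realType}.
Variables (f : triple) (n : nat).
Local Notation F := (scalars_of R f).
Let FL := scalars_of_laws R f.
Let MG := @M_set_matrix_group R f n.
Local Notation E := 'M[R]_(n * n, scalar_dim F).
Local Notation Eg := 'M[R]_((n + n) * (n + n), scalar_dim F).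
Variable mu : {measure set (borel E) -> \bar R}.
Hypothesis hmu : riemannian_volume (M_mfd R f n) (trace_metric (F := F) (n := n)) mu.
Local Notation kin := (kinetic_metric (G_mfd R f n) (M_mfd R f n) mu).

Lemma translation_linear (k1 k2 : 'M[F]_(n + n)) : linear (translation k1 k2).
Proof.
apply: (linear_mxcoord FL (L := fun A => k1 *m A *m k2)) => [A B|a A].
  by rewrite mulmxDr mulmxDl.
by rewrite (scale_emb_mulmxr FL) -scalemxAl.
Qed.

Lemma translationK (k1 k2 l1 l2 : 'M[F]_(n + n)) :
  is_inverse k1 l1 -> is_inverse k2 l2 ->
  cancel (translation k1 k2) (translation l1 l2).
Proof.
move=> [_ lk] [kl _] V; rewrite /translation (mxcoordK FL) !mulmxA lk mul1mx.
by rewrite -mulmxA kl mulmx1 (mx_of_coordK FL).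
Qed.

(** Stated for any translation-stable part [S] of G, so that it applies to both G and K. Vectors
    tangent to [S] are tangent to G, where the kinetic metric has its integral formula. *)
Lemma K_translation_isometry (S : set Eg) k1 k2 : S `<=` G_mfd R f n ->
  (forall a b V, @K_set R f n a -> K_set b -> S V -> S (translation a b V)) ->
  K_set k1 -> K_set k2 -> riemannian_isometry S kin (translation k1 k2).
Proof.
move=> SG ST K1 K2; have [i1 i2] := (K_set_inverse K1, K_set_inverse K2).
have K1' := K_setV K1; have K2' := K_setV K2.
apply: (linear_isometry (T' := translation (inverse_mx k1) (inverse_mx k2))).
- exact: translation_linear.
- exact: translation_linear.
- exact: linear_mx_continuous (translation_linear k1 k2).
- exact: linear_mx_continuous (translation_linear _ _).
- by move=> V; exact: ST.
- by move=> V; exact: ST.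
- by move=> V _; exact: translationK.
- by move=> V _; apply: translationK; split; [exact: i1.2|exact: i1.1|exact: i2.2|exact: i2.1].
move=> p X Y Sp tX tY.
have T12 V : S V -> S (translation k1 k2 V) by exact: ST.
have cT := linear_mx_continuous (translation_linear k1 k2).
have tTX := tangent_linear (translation_linear k1 k2) cT T12 tX.
have tTY := tangent_linear (translation_linear k1 k2) cT T12 tY.
have [u1 [v1 [Mu1 Mv1 _ E1]]] := K1; have [u2 [v2 [Mu2 Mv2 _ E2]]] := K2.
have GU := @G_mfd_indefinite R f n.
move: (tangentS SG tX) (tangentS SG tY) (tangentS SG tTX) (tangentS SG tTY).
by rewrite E1 E2; exact: (kinetic_metric_translation FL MG hmu GU Mu1 Mv1 Mu2 Mv2 (SG _ Sp)).
Qed.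

Lemma G_mfd_translation a b V : @K_set R f n a -> K_set b -> G_mfd R f n V ->
  G_mfd R f n (translation a b V).
Proof.
move=> Ka Kb [g Gg <-]; rewrite /translation (mxcoordK FL); exists (a *m g *m b) => //.
by apply: G_setMr => //; exact: G_setMl.
Qed.

Lemma K_mfd_translation a b V : @K_set R f n a -> K_set b -> K_mfd R f n V ->
  K_mfd R f n (translation a b V).
Proof.
move=> Ka Kb [g Gg <-]; rewrite /translation (mxcoordK FL); exists (a *m g *m b) => //.
by apply: K_setM => //; exact: K_setM.
Qed.

Lemma K_mfd_G : K_mfd R f n `<=` G_mfd R f n.
Proof. by move=> _ [k Kk <-]; exists k => //; exact: K_set_G. Qed.

End Translations.

(** * Averages over M *)

Section ConjugationInvariance.
Context {R : realType} {F : scalars R} {emb : R -> F} (FL : scalar_laws emb).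
Variable n : nat.

(** Conjugation by such a diagonal sign matrix negates exactly the entries whose row and column
    indices are separated by [s]. *)
Definition sign_mx (s : pred 'I_n) : 'M[F]_n := diag_mx (\row_k (-1) ^+ s k).

Lemma sign_mx_conj_tr s : conj_tr (sign_mx s) = sign_mx s.
Proof.
apply/matrixP => i j; rewrite !mxE eq_sym; case: eqP => [->|_]; last first.
  by rewrite (sconj0 FL).
by rewrite mulr1n; case: (s j); rewrite ?expr1 ?expr0 ?(sconjN FL) (sconj1 FL).
Qed.

Lemma sign_mx_conjE s (A : 'M[F]_n) :
  sign_mx s *m A *m conj_tr (sign_mx s) = \matrix_(i, j) ((-1) ^+ s i * A i j * (-1) ^+ s j).
Proof.
rewrite sign_mx_conj_tr; apply/matrixP => i j.
by rewrite mul_mx_diag mul_diag_mx !mxE.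
Qed.

Lemma sign_mx_unitary s : unitary_set (sign_mx s).
Proof.
have SS : sign_mx s *m sign_mx s = 1%:M.
  have := sign_mx_conjE s 1%:M; rewrite mulmx1 sign_mx_conj_tr => ->.
  apply/matrixP => i j; rewrite !mxE; case: eqP => [->|_]; last by rewrite mulr0 mul0r.
  by rewrite mulr1 -expr2 sqrr_sign.
by split; rewrite sign_mx_conj_tr.
Qed.

Variables (M : set 'M[F]_n) (J : 'M[F]_n -> R).
Hypothesis JD : forall A B, J (A + B) = J A + J B.
Hypothesis JM : forall u A, M u -> J (u *m A *m conj_tr u) = J A.

Lemma invariant0 : J 0 = 0.
Proof. by apply: (addrI (J 0)); rewrite -JD !addr0. Qed.

Lemma invariantN A : J (- A) = - J A.
Proof. by apply: (addrI (J A)); rewrite -JD !subrr invariant0. Qed.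

(** Invariance gives J(-A) = J(A), and additivity gives J(-A) = - J(A). Here [J] stands for the
    cross integral as a function of its second argument. *)
Lemma invariant_eq0 u A : M u -> u *m A *m conj_tr u = - A -> J A = 0.
Proof.
move=> Mu uA; have := JM A Mu; rewrite uA invariantN => /eqP.
by rewrite eq_sym -subr_eq0 opprK -mulr2n mulrn_eq0 => /eqP.
Qed.

Lemma invariant_offdiag (s : pred 'I_n) k l x : M (sign_mx s) -> s k != s l ->
  J (x *: delta_mx k l) = 0.
Proof.
move=> Ms skl; apply: (invariant_eq0 Ms); rewrite sign_mx_conjE.
apply/matrixP => i j; rewrite !mxE; case: eqP => [->|_] /=; last by rewrite !mulr0 mul0r oppr0.
case: eqP => [->|_] /=; last by rewrite !mulr0 mul0r oppr0.
move: skl; case: (s k); case: (s l) => // _; rewrite ?expr0 ?expr1 ?mulr1 ?mul1r ?mulN1r //.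
by rewrite mulrN1.
Qed.

Lemma invariant_diag : (forall k l x, k != l -> J (x *: delta_mx k l) = 0) ->
  forall A, J A = \sum_k J (A k k *: delta_mx k k).
Proof.
move=> Joff A; rewrite {1}(matrix_sum_delta A) (big_morph J JD invariant0).
apply: eq_bigr => k _; rewrite (big_morph J JD invariant0) (bigD1 k) //= big1 ?addr0 //.
by move=> l lk; apply: Joff; rewrite eq_sym.
Qed.

End ConjugationInvariance.
Section InvariantSkew.
Context {R : realType}.

(* Its real multiples of the identity form the centre of the Lie algebra of [M]. *)
Definition central_unit (f : triple) : scalars_of R f :=
  match f return scalars_of R f with
  | Unitary => Complex 0 1 : R[i]
  | _ => 0
  end.

Lemma central_unitC f (x : scalars_of R f) : central_unit f * x = x * central_unit f.
Proof. by case: f x => x /=; rewrite ?mul0r ?mulr0 // mulrC. Qed.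

Lemma skew_diag f n (W : 'M[scalars_of R f]_n) k : skew_hermitian W -> scalar_conj (W k k) = - W k k.
Proof. by move/matrixP/(_ k k); rewrite !mxE. Qed.

Lemma sign_mx_det n (k j : 'I_n) : k != j ->
  \det (sign_mx (pred2 k j) : 'M[real_scalars R]_n) = 1 :> R.
Proof.
move=> kj; rewrite /sign_mx det_diag (bigD1 k) //= (bigD1 j) ?(eq_sym j) //=.
rewrite !mxE /= !eqxx orbT !expr1 mulrA mulrNN !mul1r big1 // => i /andP[ik ij].
by rewrite mxE /= (negbTE ik) (negbTE ij) expr0.
Qed.

Lemma third_index n (k l : 'I_n) : (2 < n)%N -> exists j : 'I_n, (j != k) && (j != l).
Proof.
move=> n2; have /card_gt0P[j] : (0 < #|~: [set k; l]|)%N.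
  rewrite cardsCs finset.setCK card_ord cards2 subn_gt0.
  by apply: leq_ltn_trans n2; case: eqP.
by rewrite !inE negb_or; exists j.
Qed.

Variables (f : triple) (n : nat) (hn : admissible f n).
Local Notation F := (scalars_of R f).
Let FL := scalars_of_laws R f.
Variable J : 'M[F]_n -> R.
Hypothesis JD : forall A B, J (A + B) = J A + J B.
Hypothesis JM : forall u A, M_set u -> J (u *m A *m conj_tr u) = J A.

(* For [SO_n] two signs have to be changed, at [k] and at some index other than
   [k] and [l]: this is where [2 < n] is used. *)
Lemma invariant_offdiag_eq0 k l x : k != l -> J (x *: delta_mx k l) = 0.
Proof.
move=> kl.
have [s Ms skl] : exists2 s : pred 'I_n, M_set (sign_mx s : 'M[F]_n) & s k != s l.
  have U s := @sign_mx_unitary _ F _ FL n s.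
  case: f hn U => /= [n2|_|_] U.
  - have [j /andP[jk jl]] := third_index k l n2.
    exists (pred2 k j); last by rewrite /= eqxx ![l == _]eq_sym (negbTE kl) (negbTE jl).
    by split; [exact: U|rewrite sign_mx_det // eq_sym].
  - by exists (pred1 k) => //=; rewrite eqxx (eq_sym l) (negbTE kl).
  - by exists (pred1 k) => //=; rewrite eqxx (eq_sym l) (negbTE kl).
exact: (invariant_offdiag FL JD JM x Ms skl).
Qed.

End InvariantSkew.

Section Diagonal.
Context {R : realType}.
Variables (n : nat).

Lemma conj_tr_scalar (F : scalars R) emb (FL : @scalar_laws R F emb) (u : F) :
  conj_tr (u%:M : 'M[F]_n) = (scalar_conj u)%:M.
Proof.
by apply/matrixP => i j; rewrite !mxE eq_sym; case: eqP; rewrite ?mulr1n ?mulr0n ?(sconj0 FL).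
Qed.

Lemma scalar_conjugation (F : scalars R) emb (FL : @scalar_laws R F emb) (u x : F) (k : 'I_n) :
  u%:M *m (x *: delta_mx k k) *m conj_tr u%:M = (u * x * scalar_conj u) *: delta_mx k k.
Proof.
rewrite (conj_tr_scalar FL); apply/matrixP => i j.
rewrite mul_scalar_mx mxE (bigD1 j) //= big1 ?addr0; last first.
  by move=> l lj; rewrite !mxE (negbTE lj) mulr0n mulr0.
rewrite !mxE eqxx mulr1n; case: eqP => _ /=; last by rewrite !mulr0 mul0r.
by case: eqP => _ /=; rewrite ?mulr0 ?mul0r // !mulr1.
Qed.

Lemma scalar_unitary (F : scalars R) emb (FL : @scalar_laws R F emb) (u : F) :
  u * scalar_conj u = 1 -> scalar_conj u * u = 1 -> unitary_set (u%:M : 'M[F]_n).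
Proof. by move=> uc cu; split; rewrite (conj_tr_scalar FL) -scalar_mxM ?uc ?cu. Qed.

(** The diagonal entry is purely imaginary. Conjugation by the scalar j negates its i-component, and
    conjugation by the scalar i negates its j- and k-components, so [J] kills both parts. *)
Lemma invariant_quaternion_diag (J : 'M[quaternion_scalars R]_n -> R) :
  (forall A B, J (A + B) = J A + J B) ->
  (forall u A, unitary_set u -> J (u *m A *m conj_tr u) = J A) ->
  forall (x : quaternion_scalars R) k, scalar_conj x = - x -> J (x *: delta_mx k k) = 0.
Proof.
move=> JD JM [a b c d] k [] a0.
have FL := scalars_of_laws R Symplectic.
have {a0} -> : a = 0 by apply/eqP; move/eqP: a0; rewrite -subr_eq0 opprK -mulr2n mulrn_eq0.
pose qi : quaternion_scalars R := Quaternion 0 1 0 0.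
pose qj : quaternion_scalars R := Quaternion 0 0 1 0.
have kill (u x : quaternion_scalars R) : u * scalar_conj u = 1 -> scalar_conj u * u = 1 ->
    u * x * scalar_conj u = - x -> J (x *: delta_mx k k) = 0.
  move=> uc cu ux; apply: (invariant_eq0 JD JM (scalar_unitary FL uc cu)).
  by rewrite (scalar_conjugation FL) ux scaleNr.
have -> : Quaternion 0 b c d = (Quaternion 0 b 0 0 : quaternion_scalars R) +
    (Quaternion 0 0 c d : quaternion_scalars R) by congr Quaternion; rewrite /= ?addr0 ?add0r.
rewrite scalerDl JD (kill qj (Quaternion 0 b 0 0)) ?(kill qi (Quaternion 0 0 c d)) ?addr0 //;
  by congr Quaternion => /=; ring.
Qed.

(** Conjugation by the transposition matrix of [k] and [l], which is unitary, exchanges the two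
    diagonal positions. *)
Lemma invariant_complex_diag (J : 'M[complex_scalars R]_n -> R) k l :
  (forall u A, unitary_set u -> J (u *m A *m conj_tr u) = J A) ->
  forall x : complex_scalars R, J (x *: delta_mx k k) = J (x *: delta_mx l l).
Proof.
move=> JM x; have FL := scalars_of_laws R Unitary.
pose P : 'M[complex_scalars R]_n := tperm_mx k l.
have cP : conj_tr P = tperm_mx k l.
  rewrite /conj_tr (_ : map_mx _ P = P); first by rewrite /P tr_tperm_mx.
  by apply/matrixP => i j; rewrite !mxE; case: (_ == _); rewrite ?mulr1n ?mulr0n /= oppr0.
have PP : P *m P = 1%:M by rewrite /P -perm_mxM tperm2 perm_mx1.
have PU : unitary_set P by split; rewrite cP.
rewrite -(JM P (x *: delta_mx k k) PU) cP; congr J.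
have tE i : (tperm k l i == k) = (i == l).
  by rewrite -[X in _ == X](tpermR k l) (inj_eq perm_inj).
rewrite /P -xrowE -xcolE; apply/matrixP => i j; rewrite !mxE.
by rewrite !tE.
Qed.

End Diagonal.

Definition central_mx (R : realType) f n : 'M[scalars_of R f]_n := (@central_unit R f)%:M.
(** The coordinate along the centre of the Lie algebra: the imaginary part of the trace for U_n, and
    0 for SO_n and Sp_n. *)
Definition central_part (R : realType) f n (A : 'M[scalars_of R f]_n) : R :=
  inner (central_mx R f n) A.

Lemma central_part_complex (R : realType) n (A : 'M[scalars_of R Unitary]_n) :
  central_part A = complex.Im (\tr A : R[i]).
Proof.
rewrite /central_part /inner /central_mx (conj_tr_scalar _ (scalars_of_laws R Unitary)).
by rewrite mul_scalar_mx /retr mxtraceZ; case: (\tr A) => a b /=; ring.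
Qed.

Section CentralUnit.
Context {R : realType} (f : triple) (n : nat).
Local Notation F := (scalars_of R f).
Let FL := scalars_of_laws R f.

Lemma central_mxC (A : 'M[F]_n) : central_mx R f n *m A = A *m central_mx R f n.
Proof.
apply/matrixP => i j; rewrite /central_mx mul_scalar_mx !mxE (bigD1 j) //= big1.
  by rewrite !mxE eqxx mulr1n addr0 central_unitC.
by move=> l lj; rewrite !mxE (negbTE lj) mulr0n mulr0.
Qed.

Hypothesis hn : admissible f n.
Variable J : 'M[F]_n -> R.
Hypothesis JD : forall A B, J (A + B) = J A + J B.
Hypothesis JZ : forall a A, J (emb_of f a *: A) = a * J A.
Hypothesis JM : forall u A, M_set u -> J (u *m A *m conj_tr u) = J A.

(** Only the diagonal of [W] contributes. It vanishes for SO_n and is killed for Sp_n. For U_n, [J]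
    takes one value c at i times each diagonal unit, so J(W) is c times the imaginary trace of W,
    while i times the identity gives n c; hence the factor n on the left. *)
Lemma invariant_skewE (W : 'M[F]_n) : skew_hermitian W ->
  n%:R * J W = central_part W * J (central_mx R f n).
Proof.
move=> sW; have := invariant_diag JD (invariant_offdiag_eq0 hn JD JM) W.
have dW k := skew_diag k sW; move: W sW dW JD JZ JM hn.
rewrite /central_part /central_mx; case: f J => J' W sW dW JD' JZ' JM' hn' ->.
- have J0 := invariant0 JD'.
  have -> : @central_unit R Orthogonal = 0 by [].
  rewrite raddf0 J0 mulr0 big1 ?mulr0 // => k _.
  have W0 : W k k = 0 :> R.
    by have /eqP := dW k; rewrite /= -subr_eq0 opprK -mulr2n mulrn_eq0 => /eqP.
  by rewrite W0 scale0r J0.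
- have dWE k : W k k = (@emb_of R Unitary (complex.Im (W k k : R[i]))) * @central_unit R Unitary.
    have := dW k; case: (W k k : R[i]) => a b [] /eqP; rewrite -subr_eq0 opprK -mulr2n mulrn_eq0 /=.
    by move/eqP => ->; congr Complex; ring.
  have [k0 _] : exists k0 : 'I_n, true by exists (Ordinal hn').
  pose c := J' (@central_unit R Unitary *: delta_mx k0 k0).
  have Jd k : J' (@central_unit R Unitary *: delta_mx k k) = c.
    exact: invariant_complex_diag JM' _.
  have -> : \sum_k J' (W k k *: delta_mx k k) = complex.Im (\tr W : R[i]) * c.
    rewrite /mxtrace (big_morph (@complex.Im R) (id1 := 0) (op1 := +%R)) //; last by case=> ? ? [].
    rewrite mulr_suml; apply: eq_bigr => k _.
    by rewrite {1}dWE -scalerA JZ' Jd.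
  have -> : J' (@central_unit R Unitary)%:M = n%:R * c.
    rewrite (invariant_diag JD' (invariant_offdiag_eq0 (f := Unitary) hn' JD' JM')).
    rewrite (eq_bigr (fun=> c)) ?sumr_const ?card_ord ?mulr_natl // => k _.
    by rewrite mxE eqxx mulr1n Jd.
  rewrite -[inner _ W]/(central_part (f := Unitary) W) central_part_complex.
  by rewrite mulrCA.
- have J0 := invariant0 JD'.
  have -> : @central_unit R Symplectic = 0 by [].
  rewrite raddf0 J0 mulr0 big1 ?mulr0 // => k _.
  by apply: invariant_quaternion_diag.
Qed.

End CentralUnit.

Section CrossIntegral.
Context {R : realType} (f : triple) (n : nat).
Local Notation F := (scalars_of R f).
Let FL := scalars_of_laws R f.
Let MG := @M_set_matrix_group R f n.
Local Notation E := 'M[R]_(n * n, scalar_dim F).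
Variable mu : {measure set (borel E) -> \bar R}.
Hypothesis hmu : riemannian_volume (M_mfd R f n) (trace_metric (F := F) (n := n)) mu.

Definition cross_density (Z W : 'M[F]_n) (q : E) : R :=
  inner (Z *m mx_of_coord q) (mx_of_coord q *m W).

Definition cross_integral (Z W : 'M[F]_n) : R :=
  \int[mu]_(q in (M_mfd R f n : set (borel E))) cross_density Z W q.

Lemma cross_density_continuous Z W (q : E) : {for q, continuous (cross_density Z W)}.
Proof.
have l1 : linear (@lmul_coord R F n n n Z) by exact: (lmul_coord_linear FL).
have l2 : linear (fun p : E => mul_coord p (mxcoord W)) by exact: (mul_coord_linearl FL).
have c1 : lmul_coord Z @ q --> lmul_coord Z q by exact: linear_mx_continuous.
have c2 : (fun p : E => mul_coord p (mxcoord W)) @ q --> mul_coord q (mxcoord W).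
  exact: (linear_mx_continuous l2 (x := q)).
have c := inner_form_cvg FL c1 c2.
have h p : inner_form (lmul_coord Z p) (mul_coord p (mxcoord W)) = cross_density Z W p.
  by rewrite /inner_form /lmul_coord /mul_coord !(mxcoordK FL).
have {}c : cross_density Z W @ q --> cross_density Z W q.
  rewrite -h (_ : cross_density Z W = fun p =>
    inner_form (lmul_coord Z p) (mul_coord p (mxcoord W))); last by apply/funext => p; rewrite -h.
  exact: (c _).
exact: c.
Qed.

Let mM : measurable (M_mfd R f n : set (borel E)).
Proof. exact: (borel_group MG). Qed.

Let iM (h : E -> R) : (forall x, M_mfd R f n x -> {for x, continuous h}) ->
  mu.-integrable (M_mfd R f n) (EFin \o h).
Proof. exact: (group_integrable FL MG hmu). Qed.

Lemma cross_integralD Z W W' :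
  cross_integral Z (W + W') = cross_integral Z W + cross_integral Z W'.
Proof.
rewrite /cross_integral -RintegralD //; try (by apply: iM => x _; exact: cross_density_continuous).
by apply: eq_Rintegral => q _; rewrite /cross_density mulmxDr (innerDr FL).
Qed.

Lemma cross_integralZ Z a W :
  cross_integral Z (emb_of f a *: W) = a * cross_integral Z W.
Proof.
rewrite /cross_integral -RintegralZl //; try (by apply: iM => x _; exact: cross_density_continuous).
by apply: eq_Rintegral => q _; rewrite /cross_density (scale_emb_mulmxr FL) (innerZr FL).
Qed.

(** The substitution of q u for q replaces [W] by its conjugate, once the common right factor is
    removed by unitarity. *)
Lemma cross_integral_conj Z u W : M_set u ->
  cross_integral Z (u *m W *m conj_tr u) = cross_integral Z W.
Proof.
move=> Mu; rewrite /cross_integral.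
rewrite -[RHS](group_integral_translation FL MG hmu (mgroup1 MG) Mu); last first.
  by move=> x _; exact: cross_density_continuous.
apply: eq_Rintegral => q _; rewrite /cross_density (mxcoordK FL) mul1mx.
have [uu u'u] := mgroup_unitary MG Mu.
rewrite -[RHS](inner_mulr FL (u := conj_tr u)) ?(conj_trK FL) //.
by rewrite !mulmxA -(mulmxA _ u (conj_tr u)) uu mulmx1.
Qed.

(** The central matrix moves past q, after which q cancels from both sides of the inner product and
    the integrand is constant. *)
Lemma cross_integral_central Z :
  cross_integral Z (central_mx R f n) = fine (mu (M_mfd R f n)) * central_part Z.
Proof.
rewrite mulrC -(Rintegral_group_cst MG) /cross_integral.
apply: eq_Rintegral => q; rewrite inE => Mq.
have [qq q'q] := unitary_coord FL MG Mq.
by rewrite /cross_density -central_mxC (inner_mulr FL) // (innerC FL).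
Qed.

Lemma cross_integralE (hn : admissible f n) Z W : skew_hermitian W ->
  n%:R * cross_integral Z W = fine (mu (M_mfd R f n)) * (central_part Z * central_part W).
Proof.
move=> sW; rewrite (invariant_skewE hn _ _ _ sW).
- by rewrite cross_integral_central mulrCA [central_part W * _]mulrC.
- exact: cross_integralD.
- exact: cross_integralZ.
- by move=> u A; exact: cross_integral_conj.
Qed.

End CrossIntegral.

(** * Tangent vectors of K *)

Section ComplexDerivative.
Context {R : realType}.
Implicit Types (c : R^o -> R[i]) (d : R[i]).

(* [R[i]] is a normed module over itself, not over [R]. *)
Definition is_cderive0 c d : Prop :=
  is_derive (0 : R^o) (1 : R^o) (fun t => complex.Re (c t) : R^o) (complex.Re d) /\
  is_derive (0 : R^o) (1 : R^o) (fun t => complex.Im (c t) : R^o) (complex.Im d).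

Lemma is_cderive0_cst a : is_cderive0 (fun=> a) 0.
Proof. by split; exact: is_derive_cst. Qed.

Lemma is_cderive0D c1 c2 d1 d2 : is_cderive0 c1 d1 -> is_cderive0 c2 d2 ->
  is_cderive0 (fun t => c1 t + c2 t) (d1 + d2).
Proof.
move=> [a1 b1] [a2 b2]; split.
  rewrite (_ : (fun t => _) = (fun t => complex.Re (c1 t) : R^o) + (fun t => complex.Re (c2 t) : R^o)).
    by apply: is_derive_eq (is_deriveD a1 a2) _; case: (d1) (d2) => ? ? [].
  by apply/funext => t /=; rewrite fctE; case: (c1 t) (c2 t) => ? ? [].
rewrite (_ : (fun t => _) = (fun t => complex.Im (c1 t) : R^o) + (fun t => complex.Im (c2 t) : R^o)).
  by apply: is_derive_eq (is_deriveD b1 b2) _; case: (d1) (d2) => ? ? [].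
by apply/funext => t /=; rewrite fctE; case: (c1 t) (c2 t) => ? ? [].
Qed.

Lemma is_cderive0M c1 c2 d1 d2 : is_cderive0 c1 d1 -> is_cderive0 c2 d2 ->
  is_cderive0 (fun t => c1 t * c2 t) (d1 * c2 0 + c1 0 * d2).
Proof.
move=> [a1 b1] [a2 b2]; split.
  rewrite (_ : (fun t => _) = (fun t => complex.Re (c1 t) : R^o) * (fun t => complex.Re (c2 t) : R^o)
    - (fun t => complex.Im (c1 t) : R^o) * (fun t => complex.Im (c2 t) : R^o)).
    apply: is_derive_eq (is_deriveB (is_deriveM a1 a2) (is_deriveM b1 b2)) _.
    case: (d1) (d2) (c1 0) (c2 0) => ? ? [? ?] [? ?] [? ?] /=; rewrite /GRing.scale /=; ring.
  by apply/funext => t /=; rewrite !fctE; case: (c1 t) (c2 t) => ? ? [].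
rewrite (_ : (fun t => _) = (fun t => complex.Re (c1 t) : R^o) * (fun t => complex.Im (c2 t) : R^o)
    + (fun t => complex.Im (c1 t) : R^o) * (fun t => complex.Re (c2 t) : R^o)).
  apply: is_derive_eq (is_deriveD (is_deriveM a1 b2) (is_deriveM b1 a2)) _.
  case: (d1) (d2) (c1 0) (c2 0) => ? ? [? ?] [? ?] [? ?] /=; rewrite /GRing.scale /=; ring.
by apply/funext => t /=; rewrite !fctE; case: (c1 t) (c2 t) => ? ? [].
Qed.

Lemma is_cderive0_sum (I : Type) (r : seq I) (c : I -> R^o -> R[i]) (d : I -> R[i]) :
  (forall i, is_cderive0 (c i) (d i)) ->
  is_cderive0 (fun t => \sum_(i <- r) c i t) (\sum_(i <- r) d i).
Proof.
move=> cd; elim: r => [|i r IH].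
  rewrite big_nil (_ : (fun t => _) = fun=> 0); first exact: is_cderive0_cst.
  by apply/funext => t; rewrite big_nil.
rewrite big_cons (_ : (fun t => _) = fun t => c i t + \sum_(j <- r) c j t).
  exact: is_cderive0D.
by apply/funext => t; rewrite big_cons.
Qed.

Lemma is_cderive0_prod (I : eqType) (r : seq I) (c : I -> R^o -> R[i]) (d : I -> R[i]) :
  uniq r -> (forall i, is_cderive0 (c i) (d i)) ->
  is_cderive0 (fun t => \prod_(i <- r) c i t)
    (\sum_(i <- r) d i * \prod_(j <- r | j != i) c j 0).
Proof.
move=> + cd; elim: r => [_|a r IH /= /andP[ar /IH{}IH]].
  rewrite big_nil (_ : (fun t => _) = fun=> 1); first exact: is_cderive0_cst.
  by apply/funext => t; rewrite big_nil.
rewrite (_ : (fun t => _) = fun t => c a t * \prod_(j <- r) c j t); last first.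
  by apply/funext => t; rewrite big_cons.
have := is_cderive0M (cd a) IH; congr (is_cderive0 _ _).
rewrite big_cons big_cons eqxx /=; congr (_ * _ + _).
  rewrite [LHS]big_seq [RHS]big_seq_cond; apply: eq_bigl => j.
  by case: (boolP (j \in r)) => //= jr; apply/esym; apply: contraNneq ar => <-.
rewrite mulr_sumr [LHS]big_seq [RHS]big_seq; apply: eq_bigr => i ir.
rewrite big_cons; case: eqP => [ai|_] /=; first by rewrite ai ir in ar.
by rewrite mulrCA.
Qed.

(** Jacobi's formula at the identity, from the Leibniz expansion. A permutation other than 1 moves
    at least two indices, so each term of the derivative of its product still contains a vanishing
    factor. *)
Lemma is_cderive0_det1 n (c : 'I_n -> 'I_n -> R^o -> R[i]) (D : 'M[R[i]]_n) :
  (forall i j, is_cderive0 (c i j) (D i j)) -> (forall i j, c i j 0 = (i == j)%:R) ->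
  is_cderive0 (fun t => \det (\matrix_(i, j) c i j t)) (\tr D).
Proof.
move=> cD c0.
have -> : \tr D = \sum_(s : 'S_n) ((-1) ^+ s * \sum_i (D i (s i) * \prod_(j | j != i) c j (s j) 0)).
  rewrite (bigD1 (1%g : 'S_n)) //= [X in _ + X]big1 ?addr0 => [|s s1].
    rewrite odd_perm1 expr0 mul1r; apply: eq_bigr => i _.
    by rewrite perm1 big1 ?mulr1 // => j _; rewrite perm1 c0 eqxx.
  rewrite big1 ?mulr0 // => i _.
  (* If [s] fixed every index other than [i], injectivity would make it fix [i] too, so [s] would be
     the identity. *)
  have [j /andP[ji sj]] : exists j, (j != i) && (s j != j).
    apply/existsP; apply: contraNT s1; rewrite negb_exists => /forallP fixs.
    have fix1 j : j != i -> s j = j.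
      by move=> ji; have := fixs j; rewrite ji /= negbK => /eqP.
    apply/eqP/permP => j; rewrite perm1; have [->|/fix1//] := eqVneq j i.
    apply/eqP; apply/negPn/negP => ne; have /perm_inj si := fix1 _ ne.
    by rewrite si eqxx in ne.
  by rewrite (bigD1 j) //= c0 eq_sym (negbTE sj) mul0r mulr0.
have -> : (fun t => \det (\matrix_(i, j) c i j t)) =
    (fun t => \sum_(s : 'S_n) ((-1) ^+ s * \prod_i c i (s i) t)).
  apply/funext => t; apply: eq_bigr => s _; congr (_ * _); apply: eq_bigr => i _.
  by rewrite mxE.
apply: is_cderive0_sum => s.
have := is_cderive0M (is_cderive0_cst ((-1) ^+ s))
  (is_cderive0_prod (index_enum_uniq _) (fun i => cD i (s i))).
by rewrite mul0r add0r.
Qed.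

End ComplexDerivative.

Section ConstantAlongCurves.
Context {R : realType} {E W : normedModType R}.

Lemma derive_constant_on (S : set E) (gamma : R^o -> E) (L : E -> W) d w :
  smooth_curve S gamma -> (forall x, S x -> L x = w) ->
  is_derive (0 : R^o) (1 : R^o) (L \o gamma) d -> d = 0.
Proof.
move=> [U [U0 [oU _] SU]] Lw [_ <-].
have -> : 'D_(1 : R^o) (L \o gamma) (0 : R^o) = 'D_(1 : R^o) (fun=> w) (0 : R^o).
  apply: near_eq_derive.
  by apply: filterS (open_nbhs_nbhs (conj oU U0)) => t /SU /Lw.
exact: derive_val.
Qed.

End ConstantAlongCurves.

Section KTangent.
Context {R : realType} (f : triple) (n : nat).
Local Notation F := (scalars_of R f).
Let FL := scalars_of_laws R f.
Let MG := @M_set_matrix_group R f n.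
Local Notation Eg := 'M[R]_((n + n) * (n + n), scalar_dim F).
Implicit Types k X : Eg.

Lemma K_mfd_block V : K_mfd R f n V -> exists g h : 'M[F]_n,
  [/\ mx_of_coord V = block_mx g 0 0 h, unitary_set g & unitary_set h].
Proof.
move=> [_ [g [h [Mg Mh _ ->]]] <-]; exists g, h.
by rewrite (mxcoordK FL); split=> //; exact: (mgroup_unitary MG).
Qed.

Lemma K_tangent_linear0 (L : 'M[F]_(n + n) -> 'M[F]_n) k X :
  (forall A B, L (A + B) = L A + L B) -> (forall a A, L (emb_of f a *: A) = emb_of f a *: L A) ->
  (forall V, K_mfd R f n V -> L (mx_of_coord V) = 0) ->
  tangent (K_mfd R f n) k X -> L (mx_of_coord X) = 0.
Proof.
move=> LD LZ L0 [c [sc _ <-]].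
have lL := linear_mxcoord FL LD LZ; have cL := linear_mx_continuous lL.
have L0' V : K_mfd R f n V -> mxcoord (L (mx_of_coord V)) = 0.
  by move=> /L0 ->; rewrite (mxcoord0 FL).
have := derive_constant_on sc L0' (is_derive_linear lL cL (smooth_curve_is_derive sc)).
by rewrite -(mxcoord0 FL) => /(can_inj (mxcoordK FL (p := n))).
Qed.

Lemma K_tangent_block k X : tangent (K_mfd R f n) k X ->
  mx_of_coord X = block_mx (ulsubmx (mx_of_coord X)) 0 0 (drsubmx (mx_of_coord X)) :> 'M[F]_(n + n).
Proof.
move=> tX; rewrite -{1}[mx_of_coord X]submxK; congr block_mx.
  apply: (K_tangent_linear0 (L := @ursubmx F n n n n)) tX => [A B|a A|V].
  - by rewrite /ursubmx !linearD.
  - by rewrite /ursubmx !linearZ.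
  by move/K_mfd_block => [g [h [-> _ _]]]; rewrite block_mxKur.
apply: (K_tangent_linear0 (L := @dlsubmx F n n n n)) tX => [A B|a A|V].
- by rewrite /dlsubmx !linearD.
- by rewrite /dlsubmx !linearZ.
by move/K_mfd_block => [g [h [-> _ _]]]; rewrite block_mxKdl.
Qed.

(** Differentiating the unitarity relation along a curve in K. The linear map [L] stands for the
    extraction of either diagonal block. *)
Lemma K_tangent_skew_of (L : 'M[F]_(n + n) -> 'M[F]_n) k X :
  (forall A B, L (A + B) = L A + L B) -> (forall a A, L (emb_of f a *: A) = emb_of f a *: L A) ->
  (forall V, K_mfd R f n V -> unitary_set (L (mx_of_coord V))) ->
  tangent (K_mfd R f n) k X ->
  skew_hermitian (conj_tr (L (mx_of_coord k)) *m L (mx_of_coord X)).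
Proof.
move=> LD LZ LU [c [sc c0 vc]].
have lL := linear_mxcoord FL LD LZ; have cL := linear_mx_continuous lL.
pose L' (A : 'M[F]_(n + n)) := conj_tr (L A).
have LD' A B : L' (A + B) = L' A + L' B by rewrite /L' LD (conj_trD FL).
have LZ' a A : L' (emb_of f a *: A) = emb_of f a *: L' A by rewrite /L' LZ (conj_trZ FL).
have lL' := linear_mxcoord FL LD' LZ'; have cL' := linear_mx_continuous lL'.
have dc := smooth_curve_is_derive sc.
have d1 := is_derive_linear lL cL dc; have d2 := is_derive_linear lL' cL' dc.
have cc : {for (0 : R^o), continuous ((fun V => mxcoord (L (mx_of_coord V))) \o c)}.
  apply: continuous_comp; first exact: smooth_curve_continuous0 sc.
  exact: cL.
have d := is_derive_mul_coord FL cc d2 d1.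
have K1 V : K_mfd R f n V ->
    mul_coord (mxcoord (L' (mx_of_coord V))) (mxcoord (L (mx_of_coord V))) =
    mxcoord (1%:M : 'M[F]_n).
  by move=> /LU [_ UV]; rewrite /mul_coord !(mxcoordK FL) UV.
have := derive_constant_on sc K1 d.
rewrite /= c0 vc /mul_coord !(mxcoordK FL) -(mxcoordD FL) -(mxcoord0 FL) /L'.
move/(can_inj (mxcoordK FL (p := n))) => /eqP; rewrite addr_eq0 => /eqP E.
by rewrite /skew_hermitian (conj_trM FL) (conj_trK FL).
Qed.

Lemma K_tangent_skew k X : tangent (K_mfd R f n) k X ->
  skew_hermitian (conj_tr (ulsubmx (mx_of_coord k)) *m ulsubmx (mx_of_coord X) : 'M[F]_n) /\
  skew_hermitian (conj_tr (drsubmx (mx_of_coord k)) *m drsubmx (mx_of_coord X) : 'M[F]_n).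
Proof.
move=> tX; split.
  apply: (K_tangent_skew_of (L := @ulsubmx F n n n n)) tX => [A B|a A|V].
  - by rewrite /ulsubmx !linearD.
  - by rewrite /ulsubmx !linearZ.
  by move/K_mfd_block => [g [h [-> gU _]]]; rewrite block_mxKul.
apply: (K_tangent_skew_of (L := @drsubmx F n n n n)) tX => [A B|a A|V].
- by rewrite /drsubmx !linearD.
- by rewrite /drsubmx !linearZ.
by move/K_mfd_block => [g [h [-> _ hU]]]; rewrite block_mxKdr.
Qed.

End KTangent.

Section KTangentTrace.
Context {R : realType} (n : nat).
Local Notation F := (complex_scalars R).
Let FL := scalars_of_laws R Unitary.
Local Notation Eg := 'M[R]_((n + n) * (n + n), scalar_dim F).

(** With [A] the adjoint of the base point k, these entries at a curve through k form a matrix equal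
    to 1 at time 0, which is the situation of [is_cderive0_det1]. *)
Definition complex_entry (A : 'M[F]_(n + n)) i j (V : Eg) : R[i] :=
  (A *m mx_of_coord V) i j.

Lemma complex_entry_linear A i j a (V W : Eg) :
  complex_entry A i j (a *: V + W) = (a%:C)%C * complex_entry A i j V + complex_entry A i j W.
Proof.
rewrite /complex_entry (mx_of_coordD FL) (mx_of_coordZ FL) mulmxDr.
by rewrite (scale_emb_mulmxr FL) mxE [in LHS]mxE.
Qed.

Lemma complex_entry_cderive0 A i j (S : set Eg) (gamma : R^o -> Eg) :
  smooth_curve S gamma ->
  is_cderive0 (fun t => complex_entry A i j (gamma t)) (complex_entry A i j (velocity0 gamma)).
Proof.
move=> /smooth_curve_is_derive dg; split.
  have l : linear (fun V => complex.Re (complex_entry A i j V) : R^o).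
    move=> a V W; rewrite complex_entry_linear.
    by case: (complex_entry _ _ _ V) (complex_entry _ _ _ W) => b c [d e] /=; rewrite mul0r subr0.
  exact: (is_derive_linear l (linear_mx_continuous l) dg).
have l : linear (fun V => complex.Im (complex_entry A i j V) : R^o).
  move=> a V W; rewrite complex_entry_linear.
  by case: (complex_entry _ _ _ V) (complex_entry _ _ _ W) => b c [d e] /=; rewrite mul0r addr0.
exact: (is_derive_linear l (linear_mx_continuous l) dg).
Qed.

Lemma K_mfd_det V : K_mfd R Unitary n V -> \det (mx_of_coord V : 'M[R[i]]_(n + n)) = 1.
Proof.
move=> [_ [g [h [Mg Mh gh ->]]] <-]; rewrite (mxcoordK FL).
by rewrite (det_ublock (R := R[i])).
Qed.

(** The determinant of [A *m mx_of_coord V] is constant on K, and its derivative at time 0 along a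
    curve through k is the trace; real and imaginary parts vanish separately. *)
Lemma K_tangent_trace (k X : Eg) : K_mfd R Unitary n k -> tangent (K_mfd R Unitary n) k X ->
  \tr (conj_tr (mx_of_coord k) *m mx_of_coord X : 'M[R[i]]_(n + n)) = 0.
Proof.
move=> Kk [c [sc c0 vc]]; pose A : 'M[F]_(n + n) := conj_tr (mx_of_coord k).
have kA : A *m mx_of_coord k = 1%:M.
  by have [g [h [E [_ gg] [_ hh]]]] := K_mfd_block Kk; rewrite /A E conj_tr_block
    ?(conj_tr0 FL) mul_block_diag gg hh -scalar_mx_block.
have c0A i j : complex_entry A i j (c 0) = (i == j)%:R.
  by rewrite /complex_entry c0 kA mxE.
have [dR dI] := is_cderive0_det1 (fun i j => complex_entry_cderive0 A i j sc) c0A.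
have detK V : K_mfd R Unitary n V ->
    \det (\matrix_(i, j) complex_entry A i j V) = \det (A : 'M[R[i]]_(n + n)).
  move=> /K_mfd_det dV; rewrite (_ : \matrix_(i, j) _ = (A : 'M[R[i]]_(n + n)) *m mx_of_coord V).
    by rewrite det_mulmx dV mulr1.
  by apply/matrixP => i j; rewrite mxE.
rewrite -/A -vc; apply/eqP; rewrite eq_complex.
have -> : complex.Re (\tr (A *m mx_of_coord (velocity0 c)) : R[i]) = 0.
  apply: (derive_constant_on sc (L := fun V => complex.Re
    (\det (\matrix_(i, j) complex_entry A i j V)) : R^o) _ dR) => V /detK ->.
  reflexivity.
have -> : complex.Im (\tr (A *m mx_of_coord (velocity0 c)) : R[i]) = 0.
  apply: (derive_constant_on sc (L := fun V => complex.Im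
    (\det (\matrix_(i, j) complex_entry A i j V)) : R^o) _ dI) => V /detK ->.
  reflexivity.
by rewrite eqxx.
Qed.

End KTangentTrace.

Lemma central_part_eq0 (R : realType) f n (A : 'M[scalars_of R f]_n) :
  @central_unit R f = 0 -> central_part A = 0.
Proof.
move=> f0; have FL := scalars_of_laws R f; rewrite /central_part /central_mx f0 raddf0 /inner.
by rewrite (conj_tr0 FL) mul0mx /retr mxtrace0 (sre0 FL).
Qed.

(** For SU(n,n) the vanishing trace splits over the two diagonal blocks; for the other triples the
    central part is identically 0. *)
Lemma K_tangent_central (R : realType) f n (k X : 'M[R]_((n + n) * (n + n), scalar_dim (scalars_of R f))) :
  K_mfd R f n k -> tangent (K_mfd R f n) k X ->
  central_part (conj_tr (ulsubmx (mx_of_coord k)) *m ulsubmx (mx_of_coord X)) +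
  central_part (conj_tr (drsubmx (mx_of_coord k)) *m drsubmx (mx_of_coord X)) = 0.
Proof.
case: f k X => k X Kk tX; [by rewrite !central_part_eq0 ?addr0| |by rewrite !central_part_eq0 ?addr0].
have := K_tangent_trace Kk tX; rewrite (K_tangent_block tX).
have [g [h [-> _ _]]] := K_mfd_block Kk; rewrite !central_part_complex.
rewrite conj_tr_block ?(conj_tr0 (scalars_of_laws R Unitary)) mul_block_diag mxtrace_block.
rewrite !block_mxKul !block_mxKdr.
by move/(congr1 (@complex.Im R)); rewrite raddfD.
Qed.

(** * The metric on K *)

Section FactorMetric.
Context {R : realType} (f : triple) (n : nat).
Local Notation F := (scalars_of R f).
Let FL := scalars_of_laws R f.
Local Notation E := 'M[R]_(n * n, scalar_dim F).

(** The central part of the tangent vector [X] translated back from [p] to the identity. Written as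
    an inner product it is visibly linear in [p] too, which gives smoothness in the base point. *)
Definition central_form (p X : E) : R^o :=
  inner_form (mxcoord (mx_of_coord p *m central_mx R f n)) X.

(* Half of the cross term of the kinetic energy is attributed to each factor. *)
Definition factor_metric (c : R) : metric_tensor E := fun p X Y =>
  c * (inner_form (F := F) (m := n) (n := n) X Y + n%:R^-1 * (central_form p X * central_form p Y)).

Lemma central_formE (p X : E) :
  central_form p X = central_part (conj_tr (mx_of_coord p) *m mx_of_coord X).
Proof.
by rewrite /central_form /inner_form (mxcoordK FL) /central_part /inner (conj_trM FL) mulmxA.
Qed.

Lemma central_form_linearl X : linear (central_form^~ X).
Proof.
move=> a p q; rewrite /central_form /inner_form (mx_of_coordD FL) (mx_of_coordZ FL).
rewrite mulmxDl -scalemxAl (mxcoordD FL) (mxcoordZ FL) (mx_of_coordD FL) (mx_of_coordZ FL).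
by rewrite (innerDl FL) (innerZl FL).
Qed.

Lemma central_form_linearr p : linear (central_form p).
Proof. by move=> a X Y; rewrite /central_form; exact: (inner_form_linearr FL). Qed.

(** Real factors are presented as 1 by 1 matrices so that products of functions fall under
    [Ck_on_bilinear]. *)
Lemma Ck_on_mulr (V : normedModType R) k (U : set V) (a b : V -> 'M[R]_1) : open U ->
  Ck_on k U a -> Ck_on k U b -> Ck_on k U (fun x => a x 0 0 * b x 0 0 : R^o).
Proof.
move=> oU; apply: (Ck_on_bilinear (B := fun u v : 'M[R]_1 => u 0 0 * v 0 0 : R^o) oU).
  by move=> y c u v; rewrite !mxE mulrDl -mulrA.
by move=> x c u v; rewrite !mxE mulrDr mulrCA.
Qed.

Lemma Ck_on_central_form (V : normedModType R) k (U : set V) (p X : V -> E) : open U ->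
  Ck_on k U p -> Ck_on k U X -> Ck_on k U (fun x => const_mx (central_form (p x) (X x)) : 'M[R]_1).
Proof.
move=> oU; apply: (Ck_on_bilinear (B := fun p X => const_mx (central_form p X) : 'M[R]_1) oU).
  by move=> Y a u v; apply/matrixP => i j; rewrite !mxE central_form_linearl.
by move=> Y a u v; apply/matrixP => i j; rewrite !mxE central_form_linearr.
Qed.

Lemma Ck_on_central_formM (V : normedModType R) k (U : set V) (p X Y : V -> E) : open U ->
  Ck_on k U p -> Ck_on k U X -> Ck_on k U Y ->
  Ck_on k U (fun x => central_form (p x) (X x) * central_form (p x) (Y x) : R^o).
Proof.
move=> oU Cp CX CY.
have := Ck_on_mulr oU (Ck_on_central_form oU Cp CX) (Ck_on_central_form oU Cp CY).
by congr (Ck_on k U _); apply/funext => x; rewrite !mxE.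
Qed.

Lemma Ck_on_scale (V : normedModType R) k (U : set V) (c : R) (a : V -> R^o) : open U ->
  Ck_on k U a -> Ck_on k U (fun x => c * a x : R^o).
Proof.
move=> oU; apply: (Ck_on_linear (L := fun x : R^o => c * x : R^o) oU).
  by move=> e x y; rewrite mulrDr mulrCA.
exact: mulrl_continuous.
Qed.

(** The first term is positive definite and the second is nonnegative, being 1/n times a square on
    the diagonal. *)
Lemma factor_metric_riemannian (S : set E) c : 0 < c -> riemannian_metric S (factor_metric c).
Proof.
move=> c0; split.
- move=> p X Y _ _ _; rewrite /factor_metric /inner_form (innerC FL).
  by rewrite [central_form p X * _]mulrC.
- move=> p X Y Z a _ _ _ _; rewrite /factor_metric (inner_form_linearl FL) central_form_linearr.
  rewrite /GRing.scale /=; ring.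
- move=> p X _ _ X0; rewrite /factor_metric mulr_gt0 // ltr_pwDl //; last first.
    by rewrite mulr_ge0 ?invr_ge0 ?ler0n // -expr2 sqr_ge0.
  rewrite lt_neqAle (inner_ge0 FL) andbT eq_sym; apply: contraNneq X0 => /(inner_eq0 FL) X0.
  by rewrite -[X](mx_of_coordK FL (m := n) (p := n)) X0 (mxcoord0 FL).
move=> d U phi [[oU Cphi] _ _ _ _] v w; split=> // k.
have Cp := Cphi k; have Cv := Ck_on_derive v (Cphi k.+1); have Cw := Ck_on_derive w (Cphi k.+1).
apply: Ck_on_scale => //; apply: Ck_onD => //; first exact: (Ck_on_inner_form FL).
apply: Ck_on_scale => //.
exact: (Ck_on_central_formM oU Cp Cv Cw).
Qed.

End FactorMetric.

Section KineticOnK.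
Context {R : realType} (f : triple) (n : nat) (hn : admissible f n).
Local Notation F := (scalars_of R f).
Let FL := scalars_of_laws R f.
Let MG := @M_set_matrix_group R f n.
Local Notation E := 'M[R]_(n * n, scalar_dim F).
Variable mu : {measure set (borel E) -> \bar R}.
Hypothesis hmu : riemannian_volume (M_mfd R f n) (trace_metric (F := F) (n := n)) mu.
Local Notation kin := (kinetic_metric (G_mfd R f n) (M_mfd R f n) mu).
Local Notation vol := (fine (mu (M_mfd R f n))).

Lemma mobius_deriv_block (g h X1 X2 q : 'M[F]_n) : unitary_set h ->
  mobius_deriv (block_mx g 0 0 h) (block_mx X1 0 0 X2) q =
  (X1 *m q - g *m q *m (conj_tr h *m X2)) *m conj_tr h.
Proof.
move=> hU; rewrite /mobius_deriv /mobius_num /mobius_den !block_mxKul !block_mxKur.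
rewrite !block_mxKdl !block_mxKdr !mul0mx !addr0 !add0r (inverse_mxE hU).
by rewrite mulmxBl !mulmxA.
Qed.

Lemma kinetic_density_block (g h X1 X2 Y1 Y2 : 'M[F]_n) (q : E) :
  unitary_set g -> unitary_set h -> unitary_set (mx_of_coord q : 'M[F]_n) ->
  kinetic_density (block_mx g 0 0 h) (block_mx X1 0 0 X2) (block_mx Y1 0 0 Y2) q =
  (inner X1 Y1 + inner X2 Y2) -
  (cross_density (conj_tr g *m X1) (conj_tr h *m Y2) q +
   cross_density (conj_tr g *m Y1) (conj_tr h *m X2) q).
Proof.
move=> [gg' g'g] hU [qq' q'q]; have [hh' h'h] := hU; rewrite /kinetic_density.
rewrite !mobius_deriv_block // (inner_mulr FL) ?(conj_trK FL) //.
set Q : 'M[F]_n := mx_of_coord q in qq' q'q *.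
rewrite (innerDl FL) !(innerDr FL) !(innerNl FL) !(innerNr FL) opprK (inner_mulr FL) //.
have cross A B : inner (A *m Q) (g *m Q *m B) = inner (conj_tr g *m A *m Q) (Q *m B).
  by rewrite -[LHS](inner_mull FL (u := conj_tr g)) ?(conj_trK FL) // !mulmxA g'g mul1mx.
have -> : inner (g *m Q *m (conj_tr h *m X2)) (g *m Q *m (conj_tr h *m Y2)) = inner X2 Y2.
  by rewrite -!(mulmxA g) (inner_mull FL) // (inner_mull FL) // (inner_mull FL) // (conj_trK FL).
rewrite (innerC FL _ (Y1 *m Q)) !cross /cross_density -/Q; ring.
Qed.

Lemma kinetic_metric_K k X Y : K_mfd R f n k ->
  tangent (K_mfd R f n) k X -> tangent (K_mfd R f n) k Y ->
  kin k X Y = product_metric (@factor_metric R f n vol) (@factor_metric R f n vol)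
    (diag_blocks k) (diag_blocks X) (diag_blocks Y).
Proof.
move=> Kk tX tY; have [g [h [kE gU hU]]] := K_mfd_block Kk.
have KG := @K_mfd_G R f n.
rewrite (kinetic_metricE FL MG mu (@G_mfd_indefinite R f n) (tangentS KG tX) (tangentS KG tY)).
have [sX1 sX2] := K_tangent_skew tX; have [sY1 sY2] := K_tangent_skew tY.
have cX := K_tangent_central Kk tX; have cY := K_tangent_central Kk tY.
rewrite (K_tangent_block tX) (K_tangent_block tY) /product_metric /diag_blocks /=.
move: sX1 sX2 sY1 sY2 cX cY; rewrite kE !block_mxKul !block_mxKdr.
set X1 := ulsubmx _; set X2 := drsubmx _; set Y1 := ulsubmx _; set Y2 := drsubmx _.
move=> sX1 sX2 sY1 sY2 cX cY.
pose I Z W := cross_integral (f := f) (n := n) mu Z W.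
have -> : \int[mu]_(q in (M_mfd R f n : set (borel E)))
    kinetic_density (block_mx g 0 0 h) (block_mx X1 0 0 X2) (block_mx Y1 0 0 Y2) q =
  (inner X1 Y1 + inner X2 Y2) * vol -
  (I (conj_tr g *m X1) (conj_tr h *m Y2) + I (conj_tr g *m Y1) (conj_tr h *m X2)).
  have iM (u : E -> R) : (forall x, M_mfd R f n x -> {for x, continuous u}) ->
    mu.-integrable (M_mfd R f n) (EFin \o u) by exact: (group_integrable FL MG hmu).
  have mM : measurable (M_mfd R f n : set (borel E)) by exact: (borel_group MG).
  have ic Z W := iM _ (fun x _ => @cross_density_continuous R f n Z W x).
  rewrite -(Rintegral_group_cst MG) /I /cross_integral -RintegralD // -RintegralB //.
  - apply: eq_Rintegral => q; rewrite inE => Mq.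
    by apply: kinetic_density_block => //; exact: (unitary_coord FL MG Mq).
  - by apply: iM => x _; exact: cst_continuous.
  apply: (iM (fun x => cross_density _ _ x + cross_density _ _ x)) => x _.
  by apply: continuousD; exact: cross_density_continuous.
rewrite /factor_metric /inner_form !central_formE !(mxcoordK FL).
have n0 : n%:R != 0 :> R by rewrite pnatr_eq0 -lt0n; case: f hn => // /ltnW /ltnW.
have IE Z W : skew_hermitian W -> I Z W = n%:R^-1 * (vol * (central_part Z * central_part W)).
  by move=> sW; rewrite -(cross_integralE hmu hn Z sW) mulKf.
rewrite !IE //.
(* The central parts of the second block become minus those of the first. The two cross terms then
   add up to minus twice vol/n times one product; subtracted, they equal the sum of the two
   nonnegative corrections when X = Y. *)
move/eqP: cX; rewrite addrC addr_eq0 => /eqP ->.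
move/eqP: cY; rewrite addrC addr_eq0 => /eqP ->.
by field.
Qed.

End KineticOnK.

Section BlockSwap.
Context {R : realType} (f : triple) (n : nat) (hn : admissible f n).
Local Notation F := (scalars_of R f).
Let FL := scalars_of_laws R f.
Local Notation E := 'M[R]_(n * n, scalar_dim F).
Variable mu : {measure set (borel E) -> \bar R}.
Hypothesis hmu : riemannian_volume (M_mfd R f n) (trace_metric (F := F) (n := n)) mu.
Local Notation kin := (kinetic_metric (G_mfd R f n) (M_mfd R f n) mu).
Local Notation swap := (@block_swap R F n).

Lemma block_swap_linear : linear swap.
Proof.
apply: (linear_mxcoord FL (L := fun A : 'M[F]_(n + n) =>
  block_mx (drsubmx A) 0 0 (ulsubmx A))) => [A B|a A].
  by rewrite add_block_mx !addr0 /drsubmx /ulsubmx !linearD.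
by rewrite scale_block_mx !scaler0 /drsubmx /ulsubmx !linearZ.
Qed.

Lemma diag_blocks_swap k : diag_blocks (swap k) = ((diag_blocks k).2, (diag_blocks k).1).
Proof. by rewrite /diag_blocks /block_swap (mxcoordK FL) block_mxKul block_mxKdr. Qed.

Lemma K_mfd_swap V : K_mfd R f n V -> K_mfd R f n (swap V).
Proof.
move=> [_ [g [h [Mg Mh gh ->]]] <-]; rewrite /block_swap (mxcoordK FL) block_mxKul block_mxKdr.
exists (block_mx h 0 0 g) => //; exists h, g; split=> //.
by move: gh; case: (f) g h {Mg Mh} => //= g h; rewrite mulrC.
Qed.

Lemma block_swapK V : K_mfd R f n V -> swap (swap V) = V.
Proof.
move=> [_ [g [h [_ _ _ ->]]] <-].
by rewrite /block_swap !(mxcoordK FL) !block_mxKul !block_mxKdr.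
Qed.

Lemma block_swap_isometry : riemannian_isometry (K_mfd R f n) kin swap.
Proof.
have ls := block_swap_linear; have cs := linear_mx_continuous ls.
apply: (linear_isometry ls ls cs cs) => //.
- exact: K_mfd_swap.
- exact: K_mfd_swap.
- exact: block_swapK.
- exact: block_swapK.
move=> p X Y Kp tX tY.
have tsX := tangent_linear ls cs K_mfd_swap tX.
have tsY := tangent_linear ls cs K_mfd_swap tY.
rewrite (kinetic_metric_K hn hmu (K_mfd_swap Kp) tsX tsY) (kinetic_metric_K hn hmu Kp tX tY).
by rewrite !diag_blocks_swap /product_metric addrC.
Qed.

End BlockSwap.

Theorem proposition2 (R : realType) (f : triple) (n : nat)
    (hn : admissible f n)
    (mu : {measure set (borel 'M[R]_(n * n, scalar_dim (scalars_of R f)))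
             -> \bar R})
    (hmu : riemannian_volume (M_mfd R f n)
             (trace_metric (F := scalars_of R f) (n := n)) mu) :
  let G := G_mfd R f n in
  let K := K_mfd R f n in
  let M := M_mfd R f n in
  let kin := kinetic_metric G M mu in
  (forall k1 k2, K_set k1 -> K_set k2 ->
     riemannian_isometry G kin (translation k1 (inverse_mx k2)))
  /\
  ((forall k, K_set k ->
      riemannian_isometry K kin (translation k 1%:M) /\
      riemannian_isometry K kin (translation 1%:M k))
   /\
   exists m1 m2 : metric_tensor 'M[R]_(n * n, scalar_dim (scalars_of R f)),
     [/\ riemannian_metric M m1,
         riemannian_metric M m2,
         forall k X Y, K k -> tangent K k X -> tangent K k Y ->
           kin k X Y = product_metric m1 m2
             (diag_blocks k) (diag_blocks X) (diag_blocks Y) &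
         riemannian_isometry K kin (@block_swap R (scalars_of R f) n)]).
Proof.
move=> G K M kin.
have KG : K `<=` G by exact: K_mfd_G.
have MG := @M_set_matrix_group R f n.
have Gt a b V : K_set a -> K_set b -> G V -> G (translation a b V) by exact: G_mfd_translation.
have Kt a b V : K_set a -> K_set b -> K V -> K (translation a b V) by exact: K_mfd_translation.
have K1 : K_set (1%:M : 'M[scalars_of R f]_(n + n)) by exact: K_set1.
split.
  move=> k1 k2 Kk1 Kk2; apply: (K_translation_isometry hmu) => //; exact: K_setV.
split.
  by move=> k Kk; split; exact: (K_translation_isometry hmu).
(* Positivity of the total volume, the constant in [factor_metric], is what makes that form positive
   definite. *)
have V0 : 0 < fine (mu M) := group_volume_gt0 (scalars_of_laws R f) MG hmu.
(* The same metric serves both factors, in accordance with the swap of the blocks being an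
   isometry. *)
exists (@factor_metric R f n (fine (mu M))), (@factor_metric R f n (fine (mu M))); split.
- exact: factor_metric_riemannian.
- exact: factor_metric_riemannian.
- by move=> k X Y; exact: kinetic_metric_K.
- exact: block_swap_isometry.
Qed.
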